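(* Let $n\ge2$ and let $k$ be a positive integer. For every integral signature $\lambda=(\lambda_1\ge\cdots\ge\lambda_n)$, $$P_\lambda(x_1,\ldots,x_n;q^2,q^{2k})=\sum_{\mu\prec\lambda}x_n^{|\lambda|-|\mu|}\,P_\mu(x_1,\ldots,x_{n-1};q^2,q^{2k})\,\psi_{\lambda/\mu}(q^2,q^{2k}),$$ where the sum is over signatures $\mu=(\mu_1\ge\cdots\ge\mu_{n-1})$ interlacing with $\lambda$ and $$\psi_{\lambda/\mu}(q^2,q^{2k})=\frac{\prod_{1\le i\le j\le n-1}[\lambda_i-\mu_j+k(j-i)+k-1]_{k-1}\prod_{1\le i<j\le n}[\mu_i-\lambda_j+k(j-i)-1]_{k-1}}{\prod_{1\le i\le j\le n-1}[\mu_i-\mu_j+k(j-i)+k-1]_{k-1}\prod_{1\le i<j\le n}[\lambda_i-\lambda_j+k(j-i)-1]_{k-1}}.$$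
   Context: $q$ is generic (not a root of unity). $[m]=\frac{q^m-q^{-m}}{q-q^{-1}}$, $[m]_s=[m][m-1]\cdots[m-s+1]$, $[m]_0=1$. An integral signature is a sequence $\lambda_1\ge\cdots\ge\lambda_n$ with $\lambda_i-\lambda_j\in\mathbb Z$; $|\lambda|=\sum_i\lambda_i$. Interlacing $\mu\prec\lambda$ means $\lambda_1\ge\mu_1\ge\lambda_2\ge\cdots\ge\mu_{n-1}\ge\lambda_n$ (with all $\lambda_i-\mu_j\in\mathbb Z$). Macdonald polynomials: for a partition $\lambda$ (with $n$ parts, possibly zero), $P_\lambda(x;q^2,t^2)$ is the symmetric polynomial in $x_1,\ldots,x_n$ with leading term $x^\lambda$ (coefficient $1$) satisfying $D^r_{n,x}(q^2,t^2)P_\lambda=e_r(q^{2\lambda}t^{2\rho})P_\lambda$ for all $r$, where $e_r$ is the elementary symmetric polynomial evaluated at the $n$ values $q^{2\lambda_i}t^{2\rho_i}$, $\rho=(\frac{n-1}{2},\ldots,\frac{1-n}{2})$, and $$D^r_{n,x}(q^2,t^2)=t^{r(r-n)}\sum_{|I|=r}\prod_{i\in I,\,j\notin I}\frac{t^2x_i-x_j}{x_i-x_j}T_{q^2,I},$$ with $T_{q^2,I}$ multiplying $x_i$ by $q^2$ for each $i\in I$. It is extended to arbitrary signatures by $P_{(\lambda_1+c,\ldots,\lambda_n+c)}(x;q^2,t^2)=(x_1\cdots x_n)^cP_\lambda(x;q^2,t^2)$. In one variable $P_\lambda(x_1)=x_1^{\lambda_1}$. *)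

(* Defs.v *)
From Stdlib Require ClassicalEpsilon.
From HB Require Import structures.
From mathcomp Require Import all_boot all_order all_algebra fraction finmap mpoly.
From mathcomp Require monalg.

Set Implicit Arguments.
Unset Strict Implicit.
Unset Printing Implicit Defensive.

Import Order.TTheory GRing.Theory Num.Theory.
Local Open Scope ring_scope.

Section GroupAlgebra.
Import monalg.

(* The group algebra F[A] of an additive abelian group A.  The ring structure *)
(* of monalg is not available here: its monoids of exponents have no          *)
(* invertible elements.                                                       *)
Definition group_alg (F : comNzRingType) (A : zmodType) := {malg F[A]}.

Variables (F : comNzRingType) (A : zmodType).

HB.instance Definition _ := GRing.Zmodule.copy (group_alg F A) {malg F[A]}.
HB.instance Definition _ := GRing.Zmodule_isLmodule.Build F (group_alg F A)
  (@fgscaleA A F) (@fgscale1r A F) (@fgscaleDr A F)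
  (fun v a b => @fgscaleDl A F v a b).

Implicit Types (f g h : group_alg F A) (a b : A) (c : F).

Definition gmonom a c : group_alg F A := mkmalgU a c.

Definition gone : group_alg F A := gmonom 0 1.

Definition gmul f g : group_alg F A :=
  \sum_(a <- msupp f) \sum_(b <- msupp g) gmonom (a + b) (mcoeff a f * mcoeff b g).

Lemma gmonom0 a : gmonom a 0 = 0.
Proof. exact: monalgU0. Qed.

Lemma gmonomD a c1 c2 : gmonom a (c1 + c2) = gmonom a c1 + gmonom a c2.
Proof. exact: monalgUD. Qed.

Lemma gmulw (d1 d2 : {fset A}) f g :
    (msupp f `<=` d1)%fset -> (msupp g `<=` d2)%fset ->
  gmul f g = \sum_(a <- d1) \sum_(b <- d2) gmonom (a + b) (mcoeff a f * mcoeff b g).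
Proof.
move=> le_d1 le_d2; rewrite /gmul (big_fset_incl _ le_d1) /=.
  apply/eq_bigr=> a _; apply/big_fset_incl => // b _ /mcoeff_outdom ->.
  by rewrite mulr0 gmonom0.
move=> a _ /mcoeff_outdom fa0.
by rewrite big1 // => b _; rewrite fa0 mul0r gmonom0.
Qed.

Lemma gmulC : commutative gmul.
Proof.
move=> f g; rewrite /gmul exchange_big; apply/eq_bigr=> a _.
by apply/eq_bigr=> b _; rewrite mulrC addrC.
Qed.

Lemma gmul0 : left_zero 0 gmul.
Proof. by move=> f; rewrite /gmul msupp0 big_seq_fset0. Qed.

Lemma gmulMM a1 a2 c1 c2 :
  gmul (gmonom a1 c1) (gmonom a2 c2) = gmonom (a1 + a2) (c1 * c2).
Proof. by rewrite (gmulw msuppU_le msuppU_le) !big_seq_fset1 !mcoeffUU. Qed.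

Lemma gmulDl : left_distributive gmul +%R.
Proof.
move=> f1 f2 g.
rewrite (gmulw (msuppD_le f1 f2) (fsubset_refl (msupp g))).
rewrite (gmulw (fsubsetUl (msupp f1) (msupp f2)) (fsubset_refl (msupp g))).
rewrite (gmulw (fsubsetUr (msupp f1) (msupp f2)) (fsubset_refl (msupp g))).
rewrite -big_split /=; apply/eq_bigr=> a _.
rewrite -big_split /=; apply/eq_bigr=> b _.
by rewrite mcoeffD mulrDl gmonomD.
Qed.

Lemma gmulDr : right_distributive gmul +%R.
Proof. by move=> f g1 g2; rewrite gmulC gmulDl ![gmul _ f]gmulC. Qed.

Lemma gmul0r : right_zero 0 gmul.
Proof. by move=> f; rewrite gmulC gmul0. Qed.

Lemma gmonomE f : f = \sum_(a <- msupp f) gmonom a (mcoeff a f).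
Proof. exact: monalgE. Qed.

Lemma gmul_suml (I : Type) (r : seq I) (G : I -> group_alg F A) g :
  gmul (\sum_(i <- r) G i) g = \sum_(i <- r) gmul (G i) g.
Proof.
exact: (big_morph (gmul^~ g) (fun x y => gmulDl x y g) (gmul0 g)).
Qed.

Lemma gmul_sumr (I : Type) (r : seq I) (G : I -> group_alg F A) g :
  gmul g (\sum_(i <- r) G i) = \sum_(i <- r) gmul g (G i).
Proof. exact: (big_morph (gmul g) (gmulDr g) (gmul0r g)). Qed.

Lemma gmul1 : left_id gone gmul.
Proof.
move=> f; rewrite [X in gmul _ X]gmonomE gmul_sumr [RHS]gmonomE.
by apply/eq_bigr=> a _; rewrite gmulMM add0r mul1r.
Qed.

Lemma gmulA : associative gmul.
Proof.
move=> f g h; rewrite [f]gmonomE !gmul_suml; apply/eq_bigr=> a _.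
rewrite [g]gmonomE !(gmul_suml, gmul_sumr); apply/eq_bigr=> b _.
rewrite [h]gmonomE !gmul_sumr; apply/eq_bigr=> d _.
by rewrite !gmulMM addrA mulrA.
Qed.

Lemma gone_neq0 : gone != 0.
Proof. by rewrite monalgU_eq0 oner_eq0. Qed.

HB.instance Definition _ := GRing.Zmodule_isComNzRing.Build (group_alg F A)
  gmulA gmulC gmul1 gmulDl gone_neq0.

End GroupAlgebra.

Section QNumbers.
Variables (F : fieldType) (q : F).

Definition qint (m : int) : F := (q ^ m - q ^ (- m)) / (q - q^-1).

Definition qfall (m : int) (s : nat) : F := \prod_(i < s) qint (m - i%:Z).

End QNumbers.

Section MacdonaldPolynomial.
Variables (F : fieldType) (n : nat) (q t : F).
Implicit Types (p : {mpoly F[n]}) (la m : 'X_{1..n}) (I : {set 'I_n}).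

Definition qshift I p : {mpoly F[n]} :=
  p \mPo [tuple if i \in I then q ^+ 2 *: 'X_i else 'X_i | i < n].

Definition macdonald_coef I : {fraction {mpoly F[n]}} :=
  \prod_(i in I) \prod_(j in ~: I)
    (tofrac (t ^+ 2 *: 'X_i - 'X_j) / tofrac ('X_i - 'X_j)).

Definition macdonald_op (r : nat) p : {fraction {mpoly F[n]}} :=
  tofrac (t ^ (r%:Z * (r%:Z - n%:Z)))%:MP *
  \sum_(I : {set 'I_n} | #|I| == r) macdonald_coef I * tofrac (qshift I p).

(* Indices start at 0 here, so that 2 rho_i = n - 1 - 2 i. *)
Definition macdonald_eigenval la (r : nat) : F :=
  (mesym n F r).@[fun i => q ^+ (2 * la i) * t ^ (n%:Z - 1 - (2 * i)%:Z)].

Definition dominated m la : bool :=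
  (mdeg m == mdeg la) &&
  [forall j : 'I_n, (\sum_(i < n | i <= j) m i <= \sum_(i < n | i <= j) la i)%N].

(* "Leading term" refers to the dominance order, as usual for Macdonald       *)
(* polynomials.                                                               *)
Definition is_macdonald la p : Prop :=
  [/\ p \is symmetric,
      p@_la = 1,
      forall m, m \in msupp p -> dominated m la
    & forall r, (r <= n)%N ->
        macdonald_op r p = tofrac (macdonald_eigenval la r *: p)].

(* P_la(x_1, ..., x_n; q^2, t^2) for a partition la *)
Definition macdonald_poly la : {mpoly F[n]} :=
  ClassicalEpsilon.epsilon (inhabits 0) (is_macdonald la).

End MacdonaldPolynomial.

Section Signatures.
Variable V : archiNumDomainType.

Definition is_signature n (la : n.-tuple V) : Prop :=
  forall i j : 'I_n, (i <= j)%N ->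
    la`_j <= la`_i /\ la`_i - la`_j \is a Num.int.

Definition weight n (la : n.-tuple V) : V := \sum_(i < n) la`_i.

Definition interlace n (mu : n.-tuple V) (la : n.+1.-tuple V) : bool :=
  [forall i : 'I_n, la`_i.+1 <= mu`_i <= la`_i] &&
  [forall i : 'I_n.+1, forall j : 'I_n, la`_i - mu`_j \is a Num.int].

(* The list of all mu interlacing with the signature la: the integers         *)
(* mu_i - la_(i+1) lie between 0 and la_1 - la_(n+1).                         *)
Definition interlacing n (la : n.+1.-tuple V) : seq (n.-tuple V) :=
  [seq mu <- [seq [tuple la`_i.+1 + (d i)%:R | i < n]
               | d : {ffun 'I_n -> 'I_(Num.truncn (la`_0 - la`_n)).+1}]
     | interlace mu la].

Lemma interlacing_uniq n (la : n.+1.-tuple V) : uniq (interlacing la).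
Proof.
apply/filter_uniq; rewrite map_inj_uniq ?enum_uniq // => d e de.
apply/ffunP=> i; apply/val_inj/eqP; rewrite -(eqr_nat V); apply/eqP.
by have := congr1 (fun s => tnth s i) de; rewrite !tnth_mktuple => /addrI.
Qed.

Lemma mem_interlacing n (la : n.+1.-tuple V) (mu : n.-tuple V) :
  is_signature la -> (mu \in interlacing la) = interlace mu la.
Proof.
move=> sig_la; rewrite mem_filter; case: (boolP (interlace mu la)) => //=.
case/andP=> /forallP lemu /forallP intmu.
pose x (i : 'I_n) : V := mu`_i - la`_i.+1.
have x_nat i : x i \is a Num.nat.
  have /andP[le1 _] := lemu i.
  rewrite natrEint subr_ge0 le1 andbT -[x i]opprB rpredN.
  by have /forallP/(_ i) := intmu (lift ord0 i).
have le_x i : (Num.truncn (x i) < (Num.truncn (la`_0 - la`_n)).+1)%N.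
  have /andP[le1 le2] := lemu i.
  have [le3 _] := sig_la ord0 (widen_ord (leqnSn n) i) isT.
  have [le4 _] := sig_la (lift ord0 i) ord_max (leq_ord _).
  by rewrite ltnS le_truncn // lerB // (le_trans le2).
apply/mapP; exists [ffun i => Ordinal (le_x i)]; first by rewrite mem_enum.
apply/eq_from_tnth=> i; rewrite tnth_mktuple ffunE /= truncnK // addrC subrK.
by rewrite (tnth_nth 0).
Qed.

End Signatures.

(* Generalized Laurent polynomials in n variables, with exponents in V. *)
Definition gpoly (F : comNzRingType) (V : archiNumDomainType) (n : nat) :=
  group_alg F 'rV[V]_n.

Section Branching.
Variables (F : fieldType) (V : archiNumDomainType).

(* x_i ^ c *)
Definition xpow N (i : 'I_N) (c : V) : gpoly F V N :=
  gmonom (c *: delta_mx 0 i) 1.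

(* P_la(y_1, ..., y_n; q^2, t^2) for a signature la, where y_i := x_(v i):    *)
(* (y_1 ... y_n)^c times the Macdonald polynomial of the partition la - c,    *)
(* with c the last entry of la.                                               *)
Definition macdonald (q t : F) n N (v : 'I_n -> 'I_N) (la : n.-tuple V) :
    gpoly F V N :=
  let c := last 0 la in
  (\prod_(i < n) xpow (v i) c) *
  mmap (gmonom 0) (fun i => xpow (v i) 1)
    (macdonald_poly q t [multinom Num.truncn (la`_i - c) | i < n]).

(* la has n.+1 entries, so that n is n - 1 in the usual formula.  All the     *)
(* differences below are integers when mu interlaces with the signature la.   *)
Definition psi (q : F) (k n : nat) (la : n.+1.-tuple V) (mu : n.-tuple V) : F :=
  let K (i j : nat) : int := k%:Z * (j%:Z - i%:Z) in
  ((\prod_(i < n) \prod_(j < n | (i <= j)%N)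
      qfall q (Num.floor (la`_i - mu`_j) + K i j + k%:Z - 1) k.-1) *
   (\prod_(i < n.+1) \prod_(j < n.+1 | (i < j)%N)
      qfall q (Num.floor (mu`_i - la`_j) + K i j - 1) k.-1)) /
  ((\prod_(i < n) \prod_(j < n | (i <= j)%N)
      qfall q (Num.floor (mu`_i - mu`_j) + K i j + k%:Z - 1) k.-1) *
   (\prod_(i < n.+1) \prod_(j < n.+1 | (i < j)%N)
      qfall q (Num.floor (la`_i - la`_j) + K i j - 1) k.-1)).

End Branching.

(* Main.v *)
(* Put Q = q^2, T = Q^k and define polynomials R_la recursively by the branching
   rule; the claim is that R_la is the Macdonald polynomial P_la.

   Two partial fraction identities, proved by Lagrange interpolation in one
   variable at a time, translate through x_i = la_i - k i into identities between
   the branching coefficients psi and the Pieri coefficients.  By induction on the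
   number of variables the first one gives the Pieri formula
   prod_i (w + x_i) R_la = sum_I w^(n-|I|) psi'_I R_(la + e_I), from which R_la is
   symmetric, and the second one, fed with the Pieri formula in n - 1 variables,
   shows that R_la is an eigenfunction of the first operator D^1.

   The operators D^1 and D^s commute, so D^s R_la lies in the same eigenspace of
   D^1.  If Q is a natural number N >= 2, that eigenspace is a line: cleared of the
   Vandermonde denominator, an eigenfunction has a strictly decreasing leading
   exponent, which is read off the eigenvalue by uniqueness of base N expansions.
   Hence D^s R_la is a multiple of R_la for these Q, and then for every Q that is
   not a root of unity, because the difference is a rational function of Q without
   poles there.  Finally a polynomial with the defining properties of P_la is
   unique, since the eigenvalues of all D^s together determine la. *)

Require Import Defs.
From Stdlib Require ClassicalEpsilon.
From HB Require Import structures.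
From mathcomp Require Import all_boot all_order all_algebra all_fingroup fraction mpoly.
From mathcomp Require monalg.
From mathcomp Require Import zify ring.

Set Implicit Arguments.
Unset Strict Implicit.
Unset Printing Implicit Defensive.

Import Order.TTheory GRing.Theory Num.Theory.
Local Open Scope ring_scope.

(** * Polynomial functions and density *)

Section PolynomialFunctions.
Variable F : fieldType.

(* On the complement of [bad], [f] is a polynomial function of degree at most [d]. *)
Definition polyfun (bad : pred F) (d : nat) (f : F -> F) :=
  exists2 p : {poly F}, (size p <= d.+1)%N & forall v, ~~ bad v -> f v = p.[v].

Implicit Types (bad : pred F) (f g : F -> F).

Lemma polyfun_ext bad d f g :
  (forall v, ~~ bad v -> f v = g v) -> polyfun bad d g -> polyfun bad d f.
Proof. by move=> fg [p sp pE]; exists p => // v bv; rewrite fg ?pE. Qed.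

Lemma polyfun_cst bad d c : polyfun bad d (fun=> c).
Proof.
exists c%:P => [|v _]; last by rewrite hornerC.
exact: leq_trans (size_polyC_leq1 c) _.
Qed.

Lemma polyfun_lin bad a b : polyfun bad 1 (fun v => a * v + b).
Proof.
exists (a *: 'X + b%:P) => [|v _]; last by rewrite !hornerE.
by rewrite -mul_polyC -cons_poly_def size_cons_poly; case: ifP => //; rewrite ltnS size_polyC_leq1.
Qed.

Lemma polyfunD bad d f g : polyfun bad d f -> polyfun bad d g ->
  polyfun bad d (fun v => f v + g v).
Proof.
move=> [p sp pE] [r sr rE]; exists (p + r) => [|v bv].
  by rewrite (leq_trans (size_polyD _ _)) // geq_max sp.
by rewrite hornerD pE ?rE.
Qed.

Lemma polyfunM bad d e f g : polyfun bad d f -> polyfun bad e g ->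
  polyfun bad (d + e) (fun v => f v * g v).
Proof.
move=> [p sp pE] [r sr rE]; exists (p * r) => [|v bv]; last by rewrite hornerM pE ?rE.
have [->|p0] := eqVneq p 0; first by rewrite mul0r size_poly0.
have [->|r0] := eqVneq r 0; first by rewrite mulr0 size_poly0.
by rewrite size_mul //; move: (size p) (size r) sp sr => a b; lia.
Qed.

Lemma polyfunZ bad d c f : polyfun bad d f -> polyfun bad d (fun v => c * f v).
Proof. by move=> pf; rewrite -[d]add0n; apply/polyfunM/pf/polyfun_cst. Qed.

Lemma polyfun_sum bad d (I : Type) (r : seq I) (P : pred I) (G : I -> F -> F) :
  (forall i, P i -> polyfun bad d (G i)) ->
  polyfun bad d (fun v => \sum_(i <- r | P i) G i v).
Proof.
move=> pG; elim: r => [|i r IHr].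
  by apply: polyfun_ext (polyfun_cst bad d 0) => v _; rewrite big_nil.
case: (boolP (P i)) => Pi.
  apply: (polyfun_ext (g := fun v => G i v + \sum_(j <- r | P j) G j v)).
    by move=> v _; rewrite big_cons Pi.
  exact: polyfunD (pG i Pi) IHr.
by apply: polyfun_ext IHr => v _; rewrite big_cons (negPf Pi).
Qed.

Lemma polyfun_prod bad (I : finType) (S : {set I}) (G : I -> F -> F) :
  (forall i, i \in S -> polyfun bad 1 (G i)) ->
  polyfun bad #|S| (fun v => \prod_(i in S) G i v).
Proof.
elim: {S}_.+1 {-2}S (ltnSn #|S|) => // m IHm S leSm pG.
have [->|[i iS]] := set_0Vmem S.
  by apply: polyfun_ext (polyfun_cst bad _ 1) => v _; rewrite big_set0.
rewrite (cardsD1 i) iS; apply: (polyfun_ext (g := fun v => G i v * \prod_(j in S :\ i) G j v)).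
  by move=> v _; rewrite (big_setD1 i).
apply: polyfunM; first exact: pG.
apply: IHm => [|j]; first by move: leSm; rewrite (cardsD1 i) iS.
by rewrite in_setD1 => /andP[_ /pG].
Qed.

Lemma polyfun_eq0 bad d f (rs : seq F) :
  polyfun bad d f -> uniq rs -> (d < size rs)%N ->
  (forall r, r \in rs -> ~~ bad r /\ f r = 0) ->
  forall v, ~~ bad v -> f v = 0.
Proof.
move=> [p sp pE] urs lers rs0 v bv; rewrite pE //.
suff -> : p = 0 by rewrite horner0.
apply/(roots_geq_poly_eq0 (rs := rs)) => //; last exact: leq_trans lers.
by apply/allP=> r /rs0[br fr0]; rewrite rootE -pE // fr0.
Qed.

Lemma natr_inj_pchar0 : [pchar F] =i pred0 -> injective (fun n : nat => n%:R : F).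
Proof.
move=> /pcharf0P ch m n; wlog le_mn : m n / (m <= n)%N => [H|].
  by have [/H//|/ltnW/H H' /esym/H'] := leqP m n.
move=> /eqP; rewrite eq_sym -subr_eq0 -natrB // ch subn_eq0 => le_nm.
by apply/eqP; rewrite eqn_leq le_mn.
Qed.

(* Density: an infinite supply of points is what characteristic zero is for. *)
Lemma polyfun_dense d f (rs : seq F) : [pchar F] =i pred0 ->
  polyfun pred0 d f -> (forall v, v \notin rs -> f v = 0) -> forall v, f v = 0.
Proof.
move=> ch pf f0 v; pose N := (d + size rs).+1.
pose ns := [seq x <- [seq n%:R | n <- iota 0 N] | x \notin rs] : seq F.
have uns : uniq [seq (n%:R : F) | n <- iota 0 N].
  by rewrite map_inj_uniq ?iota_uniq //; exact: natr_inj_pchar0.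
apply: (polyfun_eq0 pf (rs := ns)) => //; first exact: filter_uniq.
  have e : (size [seq x <- [seq (n%:R : F) | n <- iota 0 N] | x \in rs] + size ns)%N = N.
    by rewrite !size_filter count_predC size_map size_iota.
  have le_rs : (size [seq x <- [seq (n%:R : F) | n <- iota 0 N] | x \in rs] <= size rs)%N.
    apply: uniq_leq_size; first exact: filter_uniq.
    by move=> x; rewrite mem_filter => /andP[].
  by move: le_rs e; rewrite /N; lia.
by move=> r; rewrite mem_filter => /andP[/f0].
Qed.
End PolynomialFunctions.

(** * Two partial fraction identities *)

Lemma big_subset_split (V : zmodType) (I : finType) (B : {set I}) c (G : {set I} -> V) :
  c \in B ->
  \sum_(S : {set I} | S \subset B) G S =
  \sum_(S : {set I} | S \subset B :\ c) (G S + G (c |: S)).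
Proof.
move=> cB; rewrite (bigID (fun S : {set I} => c \in S)) /= addrC big_split /=; congr (_ + _).
  by apply: eq_bigl => S; rewrite subsetD1.
rewrite (reindex_onto (fun S => c |: S) (fun S => S :\ c)) /=; last first.
  by move=> S /andP[_ cS]; rewrite setD1K.
apply: eq_bigl => S; rewrite subsetD1 setU11 andbT subUset sub1set cB /=.
by congr (_ && _); apply/eqP/idP => [<-|cS]; rewrite ?setD11 // setU1K.
Qed.

Section Kernel.
Variables (F : fieldType) (I J : finType).
Implicit Types (s T : F) (X : I -> F) (V : J -> F).
Implicit Types (A : {set I}) (B : {set J}).

Definition xterm s T X V A B (S : {set I}) : F :=
  s ^+ 'C(#|S|, 2) * (\prod_(i in S) \prod_(j in A :\: S) ((s * X i - X j) / (X i - X j))) *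
  ((\prod_(i in S) \prod_(j in B) (T * X i - V j)) *
   (\prod_(i in A :\: S) \prod_(j in B) (s * T * X i - V j))).

Definition vterm s T X V A B (S : {set J}) : F :=
  s ^+ 'C(#|S|.+1, 2) * (\prod_(i in S) \prod_(j in B :\: S) ((V i - s * V j) / (V i - V j))) *
  ((\prod_(j in S) \prod_(i in A) (T * X i - V j)) *
   (\prod_(j in B :\: S) \prod_(i in A) (s * T * X i - V j))).

Definition vbracket s T X V A B (S : {set J}) : F :=
  s * (\sum_(j in B) V j) + (1 - s) * (\sum_(j in S) V j) +
  T ^+ #|A| * s ^+ #|S|.+1 * (\prod_(i in A) X i) / (\prod_(j in B) V j) -
  s * T * (\sum_(i in A) X i).

Lemma eq_vterm s T X V V' A B (S : {set J}) : S \subset B -> {in B, V =1 V'} ->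
  vterm s T X V A B S = vterm s T X V' A B S.
Proof.
move=> sSB VV'; have SV i : i \in S -> V i = V' i by move=> /(subsetP sSB)/VV'.
have DV i : i \in B :\: S -> V i = V' i by rewrite inE => /andP[_ /VV'].
congr (_ * _ * (_ * _)); apply: eq_bigr => i iS; apply: eq_bigr => j jS;
  by rewrite ?(SV _ iS) ?(DV _ iS) ?(DV _ jS).
Qed.

Lemma eq_xterm s T X V V' A B (S : {set I}) : {in B, V =1 V'} ->
  xterm s T X V A B S = xterm s T X V' A B S.
Proof.
move=> VV'; congr (_ * _ * (_ * _)); apply: eq_bigr => i iS; apply: eq_bigr => j jS;
  by rewrite VV'.
Qed.

Lemma xterm_splitB s T X V A B (S : {set I}) c : c \in B ->
  xterm s T X V A B S =
  (\prod_(i in S) (T * X i - V c)) * (\prod_(i in A :\: S) (s * T * X i - V c)) *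
  xterm s T X V A (B :\ c) S.
Proof.
move=> cB; rewrite /xterm.
have e (U : {set I}) u : \prod_(i in U) \prod_(j in B) (u * X i - V j) =
   (\prod_(i in U) (u * X i - V c)) * \prod_(i in U) \prod_(j in B :\ c) (u * X i - V j).
  by rewrite -big_split; apply: eq_bigr => i _; rewrite (big_setD1 c).
by rewrite !e; ring.
Qed.

Lemma setDD1 (K : finType) (A S : {set K}) a : a \in A -> a \notin S ->
  (A :\: S) :\ a = (A :\ a) :\: S /\ a \in A :\: S.
Proof.
by move=> aA aS; split; [apply/setP=> x; rewrite !inE andbCA | rewrite inE aS].
Qed.

Lemma setDU1 (K : finType) (A S : {set K}) a : A :\: (a |: S) = (A :\ a) :\: S.
Proof. by apply/setP=> x; rewrite !inE negb_or -!andbA; do !bool_congr. Qed.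

Lemma xterm_inA s T X V A B (S : {set I}) a : a \in A -> S \subset A :\ a ->
  xterm s T X V A B (a |: S) =
  s ^+ #|S| * (\prod_(j in (A :\ a) :\: S) ((s * X a - X j) / (X a - X j))) *
  (\prod_(j in B) (T * X a - V j)) * xterm s T X V (A :\ a) B S.
Proof.
move=> aA; rewrite subsetD1 => /andP[sSA aS].
rewrite /xterm setDU1 cardsU1 aS add1n binS bin1 exprD !big_setU1 //=; ring.
Qed.

Lemma xterm_outA s T X V A B (S : {set I}) a : a \in A -> S \subset A :\ a ->
  xterm s T X V A B S =
  (\prod_(i in S) ((s * X i - X a) / (X i - X a))) *
  (\prod_(j in B) (s * T * X a - V j)) * xterm s T X V (A :\ a) B S.
Proof.
move=> aA; rewrite subsetD1 => /andP[sSA aS].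
have [e aAS] := setDD1 aA aS.
rewrite /xterm [\prod_(i in A :\: S) _](big_setD1 a) //= e.
rewrite [X in _ * X * _](eq_bigr (fun i => (s * X i - X a) / (X i - X a) *
   \prod_(j in (A :\ a) :\: S) ((s * X i - X j) / (X i - X j)))); last first.
  by move=> i _; rewrite (big_setD1 a) //= e.
by rewrite big_split /=; ring.
Qed.

Lemma vterm_inB s T X V A B (S : {set J}) c : c \in B -> S \subset B :\ c ->
  vterm s T X V A B (c |: S) =
  s ^+ #|S|.+1 * (\prod_(j in (B :\ c) :\: S) ((V c - s * V j) / (V c - V j))) *
  (\prod_(i in A) (T * X i - V c)) * vterm s T X V A (B :\ c) S.
Proof.
move=> cB; rewrite subsetD1 => /andP[sSB cS].
rewrite /vterm setDU1 cardsU1 cS add1n [in LHS]binS bin1 exprD !big_setU1 //=; ring.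
Qed.

Lemma vterm_outB s T X V A B (S : {set J}) c : c \in B -> S \subset B :\ c ->
  vterm s T X V A B S =
  (\prod_(i in S) ((V i - s * V c) / (V i - V c))) *
  (\prod_(i in A) (s * T * X i - V c)) * vterm s T X V A (B :\ c) S.
Proof.
move=> cB; rewrite subsetD1 => /andP[sSB cS].
have [e cBS] := setDD1 cB cS.
rewrite /vterm [\prod_(i in B :\: S) _](big_setD1 c) //= e.
rewrite [X in _ * X * _](eq_bigr (fun i => (V i - s * V c) / (V i - V c) *
   \prod_(j in (B :\ c) :\: S) ((V i - s * V j) / (V i - V j)))); last first.
  by move=> i _; rewrite (big_setD1 c) //= e.
by rewrite big_split /=; ring.
Qed.

Lemma vterm_splitA s T X V A B (S : {set J}) a : a \in A ->
  vterm s T X V A B S =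
  (\prod_(j in S) (T * X a - V j)) * (\prod_(j in B :\: S) (s * T * X a - V j)) *
  vterm s T X V (A :\ a) B S.
Proof.
move=> aA; rewrite /vterm.
have e (U : {set J}) u : \prod_(j in U) \prod_(i in A) (u * X i - V j) =
   (\prod_(j in U) (u * X a - V j)) * \prod_(j in U) \prod_(i in A :\ a) (u * X i - V j).
  by rewrite -big_split; apply: eq_bigr => i _; rewrite (big_setD1 a).
by rewrite !e; ring.
Qed.
Lemma prod_setID_sub (R : comNzRingType) (K : finType) (A S : {set K}) (f : K -> R) :
  S \subset A -> \prod_(i in A) f i = (\prod_(i in S) f i) * \prod_(i in A :\: S) f i.
Proof. by move=> /setIidPr sSA; rewrite (big_setID S) sSA. Qed.

Lemma xterm_at_sT s T X V A B (S : {set I}) a c : a \in A -> c \in B -> S \subset A :\ a ->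
  {in A :\ a, forall j, X a != X j} -> V c = s * T * X a ->
  xterm s T X V A B S = 0 /\
  xterm s T X V A B (a |: S) =
  (1 - s) * T * X a * (\prod_(j in B :\ c) (T * X a - V j)) *
  (\prod_(i in A :\ a) (s * T * (X i - s * X a))) * xterm s T X V (A :\ a) (B :\ c) S.
Proof.
move=> aA cB sSA Xa Vc; have := sSA; rewrite subsetD1 => /andP[_ aS]; split.
  rewrite (xterm_splitB _ _ _ _ _ _ cB) (big_setD1 a (A := A :\: S)) /=; last first.
    by rewrite inE aS.
  by rewrite Vc subrr mul0r mulr0 mul0r.
rewrite (xterm_splitB _ _ _ _ _ _ cB) (xterm_inA _ _ _ _ _ aA sSA) big_setU1 //= setDU1.
rewrite (prod_setID_sub _ sSA).
have -> : \prod_(i in S) (s * T * (X i - s * X a)) =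
    s ^+ #|S| * \prod_(i in S) (T * X i - V c).
  by rewrite -prodr_const -big_split /=; apply: eq_bigr => i _; rewrite Vc; ring.
have -> : \prod_(i in (A :\ a) :\: S) (s * T * (X i - s * X a)) =
    (\prod_(j in (A :\ a) :\: S) ((s * X a - X j) / (X a - X j))) *
    \prod_(i in (A :\ a) :\: S) (s * T * X i - V c).
  rewrite -big_split /=; apply: eq_bigr => i; rewrite inE => /andP[_ /Xa].
  by rewrite -subr_eq0 Vc => ?; field.
by rewrite Vc; ring.
Qed.

Lemma xterm_at_T s T X V A B (S : {set I}) a c : a \in A -> c \in B -> S \subset A :\ a ->
  {in A :\ a, forall j, X a != X j} -> V c = T * X a ->
  xterm s T X V A B (a |: S) = 0 /\
  xterm s T X V A B S =
  (s - 1) * T * X a * (\prod_(j in B :\ c) (s * T * X a - V j)) *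
  (\prod_(i in A :\ a) (T * (s * X i - X a))) * xterm s T X V (A :\ a) (B :\ c) S.
Proof.
move=> aA cB sSA Xa Vc; have := sSA; rewrite subsetD1 => /andP[_ aS]; split.
  rewrite (xterm_splitB _ _ _ _ _ _ cB) (big_setU1 _ aS) /=.
  by rewrite Vc subrr !mul0r.
have [e aAS] := setDD1 aA aS.
rewrite (xterm_splitB _ _ _ _ _ _ cB) (xterm_outA _ _ _ _ _ aA sSA) (big_setD1 a aAS) /= e.
rewrite (prod_setID_sub _ sSA).
have -> : \prod_(i in S) (T * (s * X i - X a)) =
    (\prod_(i in S) ((s * X i - X a) / (X i - X a))) * \prod_(i in S) (T * X i - V c).
  rewrite -big_split /=; apply: eq_bigr => i /(subsetP sSA)/Xa.
  by rewrite eq_sym -subr_eq0 Vc => ?; field.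
have -> : \prod_(i in (A :\ a) :\: S) (T * (s * X i - X a)) =
    \prod_(i in (A :\ a) :\: S) (s * T * X i - V c).
  by apply: eq_bigr => i _; rewrite Vc; ring.
by rewrite Vc; ring.
Qed.

Lemma vterm_at_sT s T X V A B (S : {set J}) a c : a \in A -> c \in B -> S \subset B :\ c ->
  {in B :\ c, forall j, V c != V j} -> V c = s * T * X a ->
  vterm s T X V A B S = 0 /\
  vterm s T X V A B (c |: S) =
  s * (1 - s) * T * X a * (\prod_(i in A :\ a) (T * (X i - s * X a))) *
  (\prod_(j in B :\ c) (s * (T * X a - V j))) * vterm s T X V (A :\ a) (B :\ c) S.
Proof.
move=> aA cB sSB VVc Vc; have := sSB; rewrite subsetD1 => /andP[_ cS]; split.
  rewrite (vterm_splitA _ _ _ _ _ _ aA) (big_setD1 c (A := B :\: S)) /=; last first.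
    by rewrite inE cS.
  by rewrite Vc subrr mul0r mulr0 mul0r.
rewrite (vterm_inB _ _ _ _ _ cB sSB) (vterm_splitA _ _ _ _ _ _ aA) (big_setD1 a aA) /=.
rewrite (prod_setID_sub _ sSB).
have -> : \prod_(i in S) (s * (T * X a - V i)) =
    s ^+ #|S| * \prod_(j in S) (T * X a - V j).
  by rewrite -prodr_const -big_split /=; apply: eq_bigr => i _; ring.
have -> : \prod_(i in (B :\ c) :\: S) (s * (T * X a - V i)) =
    (\prod_(j in (B :\ c) :\: S) ((V c - s * V j) / (V c - V j))) *
    \prod_(i in (B :\ c) :\: S) (s * T * X a - V i).
  rewrite -big_split /=; apply: eq_bigr => i; rewrite inE => /andP[_ /VVc].
  by rewrite -subr_eq0 Vc => ?; field.
have -> : \prod_(i in A :\ a) (T * (X i - s * X a)) = \prod_(i in A :\ a) (T * X i - V c).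
  by apply: eq_bigr => i _; rewrite Vc; ring.
by rewrite Vc exprS; ring.
Qed.

Lemma vterm_at_T s T X V A B (S : {set J}) a c : a \in A -> c \in B -> S \subset B :\ c ->
  {in B :\ c, forall j, V c != V j} -> V c = T * X a ->
  vterm s T X V A B (c |: S) = 0 /\
  vterm s T X V A B S =
  (s - 1) * T * X a * (\prod_(i in A :\ a) (T * (s * X i - X a))) *
  (\prod_(j in B :\ c) (s * T * X a - V j)) * vterm s T X V (A :\ a) (B :\ c) S.
Proof.
move=> aA cB sSB VVc Vc; have := sSB; rewrite subsetD1 => /andP[_ cS]; split.
  rewrite (vterm_splitA _ _ _ _ _ _ aA) (big_setU1 _ cS) /=.
  by rewrite Vc subrr !mul0r.
rewrite (vterm_outB _ _ _ _ _ cB sSB) (vterm_splitA _ _ _ _ _ _ aA) (big_setD1 a aA) /=.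
rewrite (prod_setID_sub _ sSB).
have -> : \prod_(i in S) (s * T * X a - V i) =
    (\prod_(i in S) ((V i - s * V c) / (V i - V c))) * \prod_(j in S) (T * X a - V j).
  rewrite -big_split /=; apply: eq_bigr => i /(subsetP sSB)/VVc.
  by rewrite eq_sym -subr_eq0 Vc => ?; field.
have -> : \prod_(i in A :\ a) (T * (s * X i - X a)) = \prod_(i in A :\ a) (s * T * X i - V c).
  by apply: eq_bigr => i _; rewrite Vc; ring.
by rewrite Vc; ring.
Qed.
Record generic_position s T X V A B : Prop := GenericPosition {
  gp_s : s != 0;
  gp_T : T != 0;
  gp_X0 : {in A, forall i, X i != 0};
  gp_V0 : {in B, forall j, V j != 0};
  gp_X : {in A &, injective X};
  gp_V : {in B &, injective V};
  gp_sX : {in A &, forall i j, s * X i != X j};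
  gp_XV : {in A & B, forall i j, T * X i != V j};
  gp_sXV : {in A & B, forall i j, s * T * X i != V j}
}.

Lemma generic_positionS s T X V A B A' B' : A' \subset A -> B' \subset B ->
  generic_position s T X V A B -> generic_position s T X V A' B'.
Proof.
move=> /subsetP sA /subsetP sB [s0 T0 X0 V0 iX iV sX XV sXV]; split => //.
- by move=> i /sA/X0.
- by move=> i /sB/V0.
- exact: sub_in2 iX.
- exact: sub_in2 iV.
- exact: sub_in2 sX.
- by move=> i j /sA iA /sB jB; apply: XV.
- by move=> i j /sA iA /sB jB; apply: sXV.
Qed.

Definition upd V (c : J) v : J -> F := fun j => if j == c then v else V j.

Lemma updE V c v : upd V c v c = v.
Proof. by rewrite /upd eqxx. Qed.

Lemma upd_out V c v B : {in B :\ c, upd V c v =1 V}.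
Proof. by move=> j; rewrite in_setD1 /upd => /andP[/negPf->]. Qed.

Definition interp_nodes s T X A : seq F :=
  [seq s * T * X a | a in A] ++ [seq T * X a | a in A].

Lemma size_interp_nodes s T X A : size (interp_nodes s T X A) = (#|A| + #|A|)%N.
Proof. by rewrite size_cat !size_image. Qed.

Lemma uniq_interp_nodes s T X V A B : generic_position s T X V A B ->
  uniq (interp_nodes s T X A).
Proof.
case=> s0 T0 _ _ iX _ sX _ _; rewrite cat_uniq; apply/and3P; split.
- rewrite map_inj_in_uniq ?enum_uniq // => i j; rewrite !mem_enum => iA jA /(mulfI _) e.
  by apply: iX => //; apply: e; rewrite mulf_neq0.
- apply/hasPn => x /imageP[i iA ->]; apply/imageP => -[j jA]; rewrite mulrAC.
  by rewrite [RHS]mulrC => /(mulfI T0)/esym/eqP; apply/negP/sX.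
- rewrite map_inj_in_uniq ?enum_uniq // => i j; rewrite !mem_enum => iA jA /(mulfI T0).
  exact: iX.
Qed.

Lemma interp_nodes_out s T X V A B c r : generic_position s T X V A B ->
  r \in interp_nodes s T X A -> r \notin [seq V j | j in B :\ c].
Proof.
case=> s0 T0 _ _ iX _ sX XV sXV; rewrite mem_cat => /orP[]/imageP[i iA ->];
  apply/imageP => -[j]; rewrite in_setD1 => /andP[_ jB] /eqP; apply/negP.
- exact: sXV.
- exact: XV.
Qed.

Lemma polyfun_xterm s T X V A B (S : {set I}) c bad : c \in B -> S \subset A ->
  polyfun bad #|A| (fun v => xterm s T X (upd V c v) A B S).
Proof.
move=> cB sSA.
apply: (polyfun_ext (g := fun v => xterm s T X V A (B :\ c) S *
  ((\prod_(i in S) (T * X i - v)) * (\prod_(i in A :\: S) (s * T * X i - v))))).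
  move=> v _; rewrite (xterm_splitB _ _ _ _ _ _ cB) updE mulrC; congr (_ * _).
  exact/eq_xterm/upd_out.
rewrite -(cardsID S A) (setIidPr sSA); apply/polyfunZ/polyfunM; apply: polyfun_prod => i _.
- by apply: polyfun_ext (polyfun_lin bad (-1) (T * X i)) => v _; ring.
- by apply: polyfun_ext (polyfun_lin bad (-1) (s * T * X i)) => v _; ring.
Qed.

Lemma vterm_updE s T X V A B (S : {set J}) c v : c \in B -> S \subset B :\ c ->
  v \notin [seq V j | j in B :\ c] ->
  (\prod_(j in B :\ c) (v - V j)) * vterm s T X (upd V c v) A B S =
  (\prod_(j in S) (s * v - V j)) * (\prod_(j in (B :\ c) :\: S) (v - V j)) *
  (\prod_(i in A) (s * T * X i - v)) * vterm s T X V A (B :\ c) S.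
Proof.
move=> cB sSB vV.
rewrite (vterm_outB _ _ _ _ _ cB sSB) updE (prod_setID_sub _ sSB).
have -> : \prod_(j in S) (s * v - V j) = (\prod_(j in S) (v - V j)) *
    \prod_(j in S) ((upd V c v j - s * v) / (upd V c v j - v)).
  rewrite -big_split /=; apply: eq_bigr => j jS; have jB := subsetP sSB _ jS.
  rewrite (@upd_out V c v B) //; have : V j - v != 0; last by move=> ?; field.
  by rewrite subr_eq0; apply: contraNneq vV => <-; apply/image_f.
rewrite (eq_vterm _ _ _ _ sSB (@upd_out V c v B)).
ring.
Qed.

Lemma vterm_updU1E s T X V A B (S : {set J}) c v : c \in B -> S \subset B :\ c ->
  v \notin [seq V j | j in B :\ c] ->
  (\prod_(j in B :\ c) (v - V j)) * vterm s T X (upd V c v) A B (c |: S) =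
  s ^+ #|S|.+1 * (\prod_(j in S) (v - V j)) * (\prod_(j in (B :\ c) :\: S) (v - s * V j)) *
  (\prod_(i in A) (T * X i - v)) * vterm s T X V A (B :\ c) S.
Proof.
move=> cB sSB vV.
rewrite (vterm_inB _ _ _ _ _ cB sSB) updE (prod_setID_sub _ sSB).
have -> : \prod_(j in (B :\ c) :\: S) (v - s * V j) =
    (\prod_(j in (B :\ c) :\: S) (v - V j)) *
    \prod_(j in (B :\ c) :\: S) ((v - s * upd V c v j) / (v - upd V c v j)).
  rewrite -big_split /=; apply: eq_bigr => j; rewrite in_setD => /andP[_ jB].
  rewrite (@upd_out V c v B) //; have : v - V j != 0; last by move=> ?; field.
  by rewrite subr_eq0; apply: contraNneq vV => ->; apply/image_f.
rewrite (eq_vterm _ _ _ _ sSB (@upd_out V c v B)).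
ring.
Qed.

Lemma polyfun_vterm s T X V A B (S : {set J}) c : c \in B -> S \subset B :\ c ->
  polyfun [pred v | v \in [seq V j | j in B :\ c]] (#|A| + #|B :\ c|)
    (fun v => (\prod_(j in B :\ c) (v - V j)) * vterm s T X (upd V c v) A B S) /\
  polyfun [pred v | v \in [seq V j | j in B :\ c]] (#|A| + #|B :\ c|)
    (fun v => (\prod_(j in B :\ c) (v - V j)) * vterm s T X (upd V c v) A B (c |: S)).
Proof.
move=> cB sSB; set d := (_ + _)%N.
have dE : d = (#|S| + #|(B :\ c) :\: S| + #|A|)%N.
  by rewrite /d -(cardsID S (B :\ c)) (setIidPr sSB) addnC.
have lin u w : polyfun [pred v | v \in [seq V j | j in B :\ c]] 1 (fun v => u * v + w).
  exact: polyfun_lin.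
split.
- apply: polyfun_ext => [v vV|]; first exact: vterm_updE.
  apply: (polyfun_ext (g := fun v => vterm s T X V A (B :\ c) S *
    ((\prod_(j in S) (s * v - V j)) * (\prod_(j in (B :\ c) :\: S) (v - V j)) *
     (\prod_(i in A) (s * T * X i - v))))); first by move=> v _; rewrite mulrC.
  rewrite dE; apply/polyfunZ/polyfunM; first apply/polyfunM; apply: polyfun_prod => i _.
  + by apply: polyfun_ext (lin s (- V i)) => v _; ring.
  + by apply: polyfun_ext (lin 1 (- V i)) => v _; ring.
  + by apply: polyfun_ext (lin (-1) (s * T * X i)) => v _; ring.
- apply: polyfun_ext => [v vV|]; first exact: vterm_updU1E.
  apply: (polyfun_ext (g := fun v => (s ^+ #|S|.+1 * vterm s T X V A (B :\ c) S) *
    ((\prod_(j in S) (v - V j)) * (\prod_(j in (B :\ c) :\: S) (v - s * V j)) *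
     (\prod_(i in A) (T * X i - v))))); first by move=> v _; ring.
  rewrite dE; apply/polyfunZ/polyfunM; first apply/polyfunM; apply: polyfun_prod => i _.
  + by apply: polyfun_ext (lin 1 (- V i)) => v _; ring.
  + by apply: polyfun_ext (lin 1 (- s * V i)) => v _; ring.
  + by apply: polyfun_ext (lin (-1) (T * X i)) => v _; ring.
Qed.
Lemma big_subset0 (R : zmodType) (K : finType) (G : {set K} -> R) :
  \sum_(S : {set K} | S \subset set0) G S = G set0.
Proof. by rewrite (eq_bigl (pred1 set0)) ?big_pred1_eq // => S; rewrite subset0. Qed.

Lemma big_subset1 (R : zmodType) (K : finType) a (G : {set K} -> R) :
  \sum_(S : {set K} | S \subset [set a]) G S = G set0 + G [set a].
Proof. by rewrite (big_subset_split _ (set11 a)) setDv big_subset0 setU0. Qed.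

Lemma cards_setDS (K : finType) (A S : {set K}) a : a \in A -> S \subset A :\ a ->
  #|A :\: S| = #|(A :\ a) :\: S|.+1 /\ #|A :\: (a |: S)| = #|(A :\ a) :\: S|.
Proof.
move=> aA; rewrite subsetD1 setDU1 => /andP[sSA aS]; split => //.
by have [e aAS] := setDD1 aA aS; rewrite (cardsD1 a) aAS e.
Qed.

Lemma kernel_identity_generic s T X V A B x y : #|A| = #|B|.+1 ->
  generic_position s T X V A B ->
  \sum_(S : {set I} | S \subset A) x ^+ #|A :\: S| * y ^+ #|S| * xterm s T X V A B S =
  (x + y) * \sum_(S : {set J} | S \subset B) x ^+ #|B :\: S| * y ^+ #|S| * vterm s T X V A B S.
Proof.
move: {2}#|B| (erefl #|B|) => n; elim: n => [|n IHn] in V A B *.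
  move=> /eqP; rewrite cards_eq0 => /eqP-> /eqP; rewrite cards0 => /cards1P[a ->] _.
  rewrite big_subset1 big_subset0 /xterm /vterm !setD0 !setDv !big_set0 cards1 cards0 bin0n /=.
  by rewrite cards0 !big_set1 !big_set0 (bin_small (ltnSn 1)); ring.
move=> cB cA gen; have [c Bc] : exists c, c \in B by apply/card_gt0P; rewrite cB.
pose lhs V' := \sum_(S : {set I} | S \subset A) x ^+ #|A :\: S| * y ^+ #|S| * xterm s T X V' A B S.
pose rhs V' := (x + y) * \sum_(S : {set J} | S \subset B)
  x ^+ #|B :\: S| * y ^+ #|S| * vterm s T X V' A B S.
have cB' : #|B :\ c| = n by move: cB; rewrite (cardsD1 c) Bc => -[].
pose f v := (\prod_(j in B :\ c) (v - V j)) * (lhs (upd V c v) - rhs (upd V c v)).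
have pf : polyfun [pred v | v \in [seq V j | j in B :\ c]] (#|A| + #|B :\ c|) f.
  apply: (polyfun_ext (g := fun v =>
    (\sum_(S : {set I} | S \subset A) (x ^+ #|A :\: S| * y ^+ #|S|) *
       (xterm s T X (upd V c v) A B S * \prod_(j in B :\ c) (v - V j))) +
    (\sum_(S : {set J} | S \subset B :\ c)
       (((x + y) * - (x ^+ #|B :\: S| * y ^+ #|S|)) *
          ((\prod_(j in B :\ c) (v - V j)) * vterm s T X (upd V c v) A B S) +
       (((x + y) * - (x ^+ #|B :\: (c |: S)| * y ^+ #|c |: S|)) *
          ((\prod_(j in B :\ c) (v - V j)) * vterm s T X (upd V c v) A B (c |: S))))))).
    move=> v _; rewrite /f mulrBr; congr (_ + _).
      by rewrite /lhs mulr_sumr; apply: eq_bigr => S _; ring.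
    rewrite /rhs (big_subset_split _ Bc) mulrCA mulr_sumr -mulrN -sumrN mulr_sumr.
    by apply: eq_bigr => S _; ring.
  apply: polyfunD; apply: polyfun_sum => S sS.
    apply/polyfunZ/polyfunM; first exact: polyfun_xterm.
    apply: polyfun_prod => j _.
    by apply: polyfun_ext (polyfun_lin _ 1 (- V j)) => v _; ring.
  have [p1 p2] := polyfun_vterm s T X V A Bc sS.
  by apply: polyfunD; apply: polyfunZ.
have VB v j : v \notin [seq V j | j in B :\ c] -> j \in B :\ c -> upd V c v c != upd V c v j.
  move=> vV jB; rewrite updE (@upd_out V c v B) //; apply: contraNneq vV => ->.
  exact: image_f.
have XA a : a \in A -> {in A :\ a, forall j, X a != X j}.
  by move=> aA j; rewrite in_setD1 eq_sym => /andP[+ jA]; apply: contraNneq => /(gp_X gen)->.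
have fr r : r \in interp_nodes s T X A -> f r = 0.
  move=> rn; have rV := interp_nodes_out c gen rn.
  suff e : lhs (upd V c r) = rhs (upd V c r) by rewrite /f e subrr mulr0.
  move: rn; rewrite mem_cat => /orP[]/imageP[a aA re].
    have eT : \prod_(j in B :\ c) (T * X a - upd V c r j) = \prod_(j in B :\ c) (T * X a - V j).
      by apply: eq_bigr => j jB; rewrite (@upd_out V c r B).
    have eT' : \prod_(j in B :\ c) (s * (T * X a - upd V c r j)) =
        \prod_(j in B :\ c) (s * (T * X a - V j)).
      by apply: eq_bigr => j jB; rewrite (@upd_out V c r B).
    have rc : upd V c r c = s * T * X a by rewrite updE.
    have cA' : #|A :\ a| = #|B :\ c|.+1 by move: cA; rewrite cB (cardsD1 a) aA cB' => -[].
    have := IHn V _ _ cB' cA' (generic_positionS (subsetDl _ _) (subsetDl _ _) gen).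
    rewrite /lhs /rhs (big_subset_split _ aA) (big_subset_split _ Bc) /= => H.
    rewrite (eq_bigr (fun S : {set I} => ((1 - s) * T * X a * (\prod_(j in B :\ c) (T * X a - V j)) *
      (\prod_(i in A :\ a) (s * T * (X i - s * X a))) * y) *
      (x ^+ #|(A :\ a) :\: S| * y ^+ #|S| * xterm s T X V (A :\ a) (B :\ c) S))); last first.
      move=> S sS; have [-> ->] := xterm_at_sT aA Bc sS (XA a aA) rc.
      have [-> ->] := cards_setDS aA sS.
      have [_ aS] : S \subset A /\ a \notin S by move: sS; rewrite subsetD1 => /andP[].
      rewrite (eq_xterm _ _ _ _ _ (@upd_out V c r B)) cardsU1 aS add1n !exprS.
      rewrite eT.
      by ring.
    rewrite -mulr_sumr H.
    rewrite [in RHS](eq_bigr (fun S : {set J} =>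
      (s * (1 - s) * T * X a * (\prod_(i in A :\ a) (T * (X i - s * X a))) *
       (\prod_(j in B :\ c) (s * (T * X a - V j))) * y) *
      (x ^+ #|(B :\ c) :\: S| * y ^+ #|S| * vterm s T X V (A :\ a) (B :\ c) S))); last first.
      move=> S sS; have [-> ->] := vterm_at_sT aA Bc sS (fun j => @VB r j rV) rc.
      have [-> ->] := cards_setDS Bc sS.
      have [_ cS] : S \subset B /\ c \notin S by move: sS; rewrite subsetD1 => /andP[].
      rewrite (eq_vterm _ _ _ _ sS (@upd_out V c r B)) cardsU1 cS add1n !exprS.
      rewrite eT'.
      by ring.
    rewrite -mulr_sumr.
    have -> : \prod_(i in A :\ a) (s * T * (X i - s * X a)) =
        s * s ^+ #|B :\ c| * \prod_(i in A :\ a) (T * (X i - s * X a)).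
      by rewrite -exprS -cA' -prodr_const -big_split; apply: eq_bigr => i _ /=; ring.
    have -> : \prod_(j in B :\ c) (s * (T * X a - V j)) =
        s ^+ #|B :\ c| * \prod_(j in B :\ c) (T * X a - V j).
      by rewrite -prodr_const -big_split.
    by ring.
  have eT : \prod_(j in B :\ c) (s * T * X a - upd V c r j) =
      \prod_(j in B :\ c) (s * T * X a - V j).
    by apply: eq_bigr => j jB; rewrite (@upd_out V c r B).
  have rc : upd V c r c = T * X a by rewrite updE.
  have cA' : #|A :\ a| = #|B :\ c|.+1 by move: cA; rewrite cB (cardsD1 a) aA cB' => -[].
  have := IHn V _ _ cB' cA' (generic_positionS (subsetDl _ _) (subsetDl _ _) gen).
  rewrite /lhs /rhs (big_subset_split _ aA) (big_subset_split _ Bc) /= => H.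
  rewrite (eq_bigr (fun S : {set I} =>
    ((s - 1) * T * X a * (\prod_(j in B :\ c) (s * T * X a - V j)) *
    (\prod_(i in A :\ a) (T * (s * X i - X a))) * x) *
    (x ^+ #|(A :\ a) :\: S| * y ^+ #|S| * xterm s T X V (A :\ a) (B :\ c) S))); last first.
    move=> S sS; have [-> ->] := xterm_at_T s aA Bc sS (XA a aA) rc.
    have [-> ->] := cards_setDS aA sS.
    rewrite (eq_xterm _ _ _ _ _ (@upd_out V c r B)) !exprS eT.
    by ring.
  rewrite -mulr_sumr H.
  rewrite [in RHS](eq_bigr (fun S : {set J} =>
    ((s - 1) * T * X a * (\prod_(i in A :\ a) (T * (s * X i - X a))) *
     (\prod_(j in B :\ c) (s * T * X a - V j)) * x) *
    (x ^+ #|(B :\ c) :\: S| * y ^+ #|S| * vterm s T X V (A :\ a) (B :\ c) S))); last first.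
    move=> S sS; have [-> ->] := vterm_at_T s aA Bc sS (fun j => @VB r j rV) rc.
    have [-> ->] := cards_setDS Bc sS.
    rewrite (eq_vterm _ _ _ _ sS (@upd_out V c r B)) !exprS eT.
    by ring.
  by rewrite -mulr_sumr; ring.
have VcV : V c \notin [seq V j | j in B :\ c].
  by apply/imageP=> -[j]; rewrite in_setD1 => /andP[jc jB] /(gp_V gen Bc jB) cj; rewrite cj eqxx in jc.
have fVc : f (V c) = 0.
  apply: (polyfun_eq0 pf (uniq_interp_nodes gen)) => //.
    by rewrite size_interp_nodes ltn_add2l cB' cA cB; lia.
  by move=> r rn; split; [exact: (interp_nodes_out c gen rn) | exact: fr].
have updV : upd V c (V c) =1 V by move=> j; rewrite /upd; case: eqP => [->|].
have lV : lhs (upd V c (V c)) = lhs V.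
  by apply: eq_bigr => S _; congr (_ * _); apply: eq_xterm => j _; apply: updV.
have rV : rhs (upd V c (V c)) = rhs V.
  congr (_ * _); apply: eq_bigr => S sS; congr (_ * _).
  by apply: eq_vterm => // j _; apply: updV.
apply/eqP; rewrite -subr_eq0 -/(lhs V) -/(rhs V) -lV -rV.
move/eqP: fVc; rewrite mulf_eq0 => /orP[|//]; rewrite prodf_seq_eq0 => /hasP[j _ /andP[jB]].
by move=> /eqP/subr0_eq e; case/negP: VcV; rewrite e; apply: image_f.
Qed.
Lemma vbracket_at_sT s T X V A B (S : {set J}) a c : a \in A -> c \in B -> S \subset B :\ c ->
  V c != 0 -> V c = s * T * X a ->
  vbracket s T X V A B (c |: S) = vbracket s T X V (A :\ a) (B :\ c) S.
Proof.
move=> aA cB; rewrite subsetD1 => /andP[sSB cS] Vc0 Vc; rewrite /vbracket.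
rewrite !(big_setD1 c cB) !(big_setD1 a aA) !(big_setU1 _ cS) /= cardsU1 cS (cardsD1 a A) aA.
rewrite !add1n !exprS invfM Vc; rewrite Vc in Vc0.
have [s0 T0 X0] : [/\ s != 0, T != 0 & X a != 0].
  by move: Vc0; rewrite !mulf_eq0 !negb_or => /andP[/andP[]].
move: (\prod_(j in B :\ c) V j)^-1 => P; field.
by rewrite s0 T0 X0.
Qed.

Lemma vbracket_at_T s T X V A B (S : {set J}) a c : a \in A -> c \in B -> S \subset B :\ c ->
  V c != 0 -> V c = T * X a ->
  vbracket s T X V A B S = vbracket s T X V (A :\ a) (B :\ c) S.
Proof.
move=> aA cB; rewrite subsetD1 => /andP[sSB cS] Vc0 Vc; rewrite /vbracket.
rewrite !(big_setD1 c cB) !(big_setD1 a aA) /= (cardsD1 a A) aA.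
rewrite !add1n !exprS invfM Vc; rewrite Vc in Vc0.
have [T0 X0] : T != 0 /\ X a != 0 by apply/andP; rewrite -negb_or -mulf_eq0.
move: (\prod_(j in B :\ c) V j)^-1 => P; field.
by rewrite T0 X0.
Qed.

Lemma eq_vbracket s T X V V' A B (S : {set J}) : S \subset B -> {in B, V =1 V'} ->
  vbracket s T X V A B S = vbracket s T X V' A B S.
Proof.
move=> /subsetP sSB VV'; rewrite /vbracket.
by rewrite !(eq_bigr _ VV') (eq_bigr V' (fun j jS => VV' _ (sSB _ jS))).
Qed.

Lemma bracket_identity_generic s T X V A B : #|A| = #|B|.+1 ->
  generic_position s T X V A B ->
  \sum_(S : {set J} | S \subset B)
    (-1) ^+ #|S| * vterm s T X V A B S * vbracket s T X V A B S = 0.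
Proof.
move: {2}#|B| (erefl #|B|) => n; elim: n => [|n IHn] in V A B *.
  move=> /eqP; rewrite cards_eq0 => /eqP-> /eqP; rewrite cards0 => /cards1P[a ->] _.
  rewrite big_subset0 /vbracket !big_set0 !big_set1 cards1 cards0.
  by rewrite divr1; ring.
move=> cB cA gen; have [c Bc] : exists c, c \in B by apply/card_gt0P; rewrite cB.
have cB' : #|B :\ c| = n by move: cB; rewrite (cardsD1 c) Bc => -[].
pose D v := \prod_(j in B :\ c) (v - V j).
pose P := T ^+ #|A| * (\prod_(i in A) X i) / \prod_(j in B :\ c) V j.
pose br (S : {set J}) v := v * (s * v + (s * (\sum_(j in B :\ c) V j) + (1 - s) * (\sum_(j in S) V j) -
  s * T * \sum_(i in A) X i)) + s ^+ #|S|.+1 * P.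
pose br1 (S : {set J}) v := v * (v + (s * (\sum_(j in B :\ c) V j) + (1 - s) * (\sum_(j in S) V j) -
  s * T * \sum_(i in A) X i)) + s ^+ #|S|.+2 * P.
have brE (S : {set J}) v : v != 0 -> S \subset B :\ c ->
    v * vbracket s T X (upd V c v) A B S = br S v /\
    v * vbracket s T X (upd V c v) A B (c |: S) = br1 S v.
  move=> v0 sSB; have := sSB; rewrite subsetD1 => /andP[_ cS].
  have eS : \sum_(j in S) upd V c v j = \sum_(j in S) V j.
    by apply: eq_bigr => j /(subsetP sSB) jB; rewrite (@upd_out V c v B).
  rewrite /vbracket !(big_setD1 c Bc) !(big_setU1 _ cS) /= cardsU1 cS add1n updE eS.
  rewrite !(eq_bigr _ (@upd_out V c v B)) invfM /br /br1 /P !exprS.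
  by move: (\prod_(j in B :\ c) V j)^-1 => R; split; field.
pose f v := \sum_(S : {set J} | S \subset B :\ c)
  ((-1) ^+ #|S| * (D v * vterm s T X (upd V c v) A B S * br S v) -
   (-1) ^+ #|S| * (D v * vterm s T X (upd V c v) A B (c |: S) * br1 S v)).
pose tot V' := \sum_(S : {set J} | S \subset B)
    (-1) ^+ #|S| * vterm s T X V' A B S * vbracket s T X V' A B S.
have fE v : v != 0 -> f v = v * D v * tot (upd V c v).
  move=> v0; rewrite /tot (big_subset_split _ Bc) mulr_sumr; apply: eq_bigr => S sS.
  have [<- <-] := brE S v v0 sS; have := sS; rewrite subsetD1 => /andP[_ cS].
  by rewrite cardsU1 cS add1n exprS; ring.
have pf : polyfun [pred v | v \in [seq V j | j in B :\ c]] (#|A| + #|B :\ c| + 2) f.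
  have quad u w z bad : polyfun bad 2 (fun v : F => v * (u * v + w) + z).
    apply: polyfunD; last exact: polyfun_cst.
    apply: (@polyfunM _ _ 1 1); last exact: polyfun_lin.
    by apply: polyfun_ext (polyfun_lin _ 1 0) => v _; ring.
  apply: polyfun_sum => S sS; have [p1 p2] := polyfun_vterm s T X V A Bc sS.
  apply: polyfunD; first by apply/polyfunZ/polyfunM; [exact: p1 | exact: quad].
  apply: (polyfun_ext (g := fun v =>
    (- (-1) ^+ #|S|) * (D v * vterm s T X (upd V c v) A B (c |: S) * br1 S v))).
    by move=> v _; rewrite mulNr.
  apply/polyfunZ/polyfunM; first exact: p2.
  by apply: polyfun_ext (quad 1 _ _ _) => v _; rewrite mul1r.
have VB v j : v \notin [seq V j | j in B :\ c] -> j \in B :\ c -> upd V c v c != upd V c v j.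
  move=> vV jB; rewrite updE (@upd_out V c v B) //; apply: contraNneq vV => ->.
  exact: image_f.
have nodes0 r : r \in interp_nodes s T X A -> r != 0.
  by case: (gen) => s0 T0 X0 _ _ _ _ _ _; rewrite mem_cat =>
    /orP[]/imageP[i iA ->]; rewrite !mulf_neq0 ?X0.
have V0 : 0 \notin [seq V j | j in B :\ c].
  apply/imageP=> -[j]; rewrite in_setD1 => /andP[_ /(gp_V0 gen)/eqP Vj /esym //].
have f0 : f 0 = 0.
  apply: big1 => S sS; rewrite vterm_updE // vterm_updU1E // /br /br1 !mul0r !add0r.
  apply/eqP; rewrite subr_eq0; apply/eqP; congr (_ * _).
  have -> : \prod_(j in S) (s * 0 - V j) = \prod_(j in S) (0 - V j).
    by apply: eq_bigr => j _; rewrite mulr0.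
  have -> : \prod_(j in (B :\ c) :\: S) (0 - s * V j) =
      s ^+ #|(B :\ c) :\: S| * \prod_(j in (B :\ c) :\: S) (0 - V j).
    by rewrite -prodr_const -big_split; apply: eq_bigr => j _ /=; ring.
  have -> : \prod_(i in A) (s * T * X i - 0) =
      s ^+ #|(B :\ c) :\: S| * s ^+ #|S| * s ^+ 2 * \prod_(i in A) (T * X i - 0).
    have cE : (#|(B :\ c) :\: S| + #|S| + 2 = #|A|)%N.
      by have := cardsID S (B :\ c); rewrite (setIidPr sS); move: cA; rewrite cB cB'; lia.
    rewrite -!exprD cE.
    by rewrite -prodr_const -big_split; apply: eq_bigr => j _ /=; ring.
  by rewrite !exprS; ring.
have fr r : r \in interp_nodes s T X A -> f r = 0.
  move=> rn; have rV := interp_nodes_out c gen rn; have r0 := nodes0 r rn.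
  rewrite fE //; suff -> : tot (upd V c r) = 0 by rewrite mulr0.
  have rc0 : upd V c r c != 0 by rewrite updE.
  rewrite /tot (big_subset_split _ Bc).
  move: rn; rewrite mem_cat => /orP[]/imageP[a aA re].
    have rc : upd V c r c = s * T * X a by rewrite updE.
    have cA' : #|A :\ a| = #|B :\ c|.+1 by move: cA; rewrite cB (cardsD1 a) aA cB' => -[].
    have H := IHn V _ _ cB' cA' (generic_positionS (subsetDl _ _) (subsetDl _ _) gen).
    rewrite -[RHS](mulr0 (- (s * (1 - s) * T * X a * (\prod_(i in A :\ a) (T * (X i - s * X a))) *
       (\prod_(j in B :\ c) (s * (T * X a - upd V c r j)))))) -[X in _ = _ * X]H mulr_sumr; apply: eq_bigr => S sS.
    have [-> ->] := vterm_at_sT aA Bc sS (fun j => @VB r j rV) rc.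
    rewrite (vbracket_at_sT aA Bc sS rc0 rc).
    rewrite (eq_vterm _ _ _ _ sS (@upd_out V c r B)) (eq_vbracket _ _ _ _ sS (@upd_out V c r B)).
    by have := sS; rewrite subsetD1 => /andP[_ cS]; rewrite cardsU1 cS add1n exprS; ring.
  have rc : upd V c r c = T * X a by rewrite updE.
  have cA' : #|A :\ a| = #|B :\ c|.+1 by move: cA; rewrite cB (cardsD1 a) aA cB' => -[].
  have H := IHn V _ _ cB' cA' (generic_positionS (subsetDl _ _) (subsetDl _ _) gen).
  rewrite -[RHS](mulr0 ((s - 1) * T * X a * (\prod_(i in A :\ a) (T * (s * X i - X a))) *
     (\prod_(j in B :\ c) (s * T * X a - upd V c r j)))) -[X in _ = _ * X]H mulr_sumr; apply: eq_bigr => S sS.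
  have [-> ->] := vterm_at_T s aA Bc sS (fun j => @VB r j rV) rc.
  rewrite (vbracket_at_T s aA Bc sS rc0 rc).
  rewrite (eq_vterm _ _ _ _ sS (@upd_out V c r B)) (eq_vbracket _ _ _ _ sS (@upd_out V c r B)).
  by ring.
have VcV : V c \notin [seq V j | j in B :\ c].
  by apply/imageP=> -[j]; rewrite in_setD1 => /andP[jc jB] /(gp_V gen Bc jB) cj; rewrite cj eqxx in jc.
have fVc : f (V c) = 0.
  apply: (polyfun_eq0 pf (rs := 0 :: interp_nodes s T X A)) => //=.
  - rewrite (uniq_interp_nodes gen) andbT; apply/negP => /nodes0; by rewrite eqxx.
  - by rewrite size_interp_nodes cB' cA cB; lia.
  - move=> r; rewrite inE => /orP[/eqP->|rn]; first by split.
    by split; [exact: (interp_nodes_out c gen rn) | exact: fr].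
have updV : upd V c (V c) =1 V by move=> j; rewrite /upd; case: eqP => [->|].
have Vc0 := gp_V0 gen Bc.
have tV : tot (upd V c (V c)) = tot V.
  apply: eq_bigr => S sS; rewrite (eq_vterm _ _ _ _ sS (fun j _ => updV j)).
  by rewrite (eq_vbracket _ _ _ _ sS (fun j _ => updV j)).
move/eqP: fVc; rewrite fE // tV !mulf_eq0 (negPf Vc0) /= => /orP[|/eqP //].
rewrite prodf_seq_eq0 => /hasP[j _ /andP[jB]].
by move=> /eqP/subr0_eq e; case/negP: VcV; rewrite e; apply: image_f.
Qed.

Definition is_polyfun (f : F -> F) := exists p : {poly F}, forall v, f v = p.[v].

Lemma is_polyfun_cst c : is_polyfun (fun=> c).
Proof. by exists c%:P => v; rewrite hornerC. Qed.

Lemma is_polyfun_id : is_polyfun (fun v => v).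
Proof. by exists 'X => v; rewrite hornerX. Qed.

Lemma is_polyfunD f g : is_polyfun f -> is_polyfun g -> is_polyfun (fun v => f v + g v).
Proof. by move=> [p pE] [r rE]; exists (p + r) => v; rewrite hornerD pE rE. Qed.

Lemma is_polyfunM f g : is_polyfun f -> is_polyfun g -> is_polyfun (fun v => f v * g v).
Proof. by move=> [p pE] [r rE]; exists (p * r) => v; rewrite hornerM pE rE. Qed.

Lemma is_polyfunN f : is_polyfun f -> is_polyfun (fun v => - f v).
Proof. by move=> [p pE]; exists (- p) => v; rewrite hornerN pE. Qed.

Lemma is_polyfunX f n : is_polyfun f -> is_polyfun (fun v => f v ^+ n).
Proof. by move=> [p pE]; exists (p ^+ n) => v; rewrite horner_exp pE. Qed.

Lemma is_polyfun_sum (K : Type) (r : seq K) (P : pred K) (f : K -> F -> F) :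
  (forall i, is_polyfun (f i)) -> is_polyfun (fun v => \sum_(i <- r | P i) f i v).
Proof.
move=> pf; elim: r => [|i r [p pE]]; first by exists 0 => v; rewrite big_nil horner0.
have [pi piE] := pf i; exists (if P i then pi + p else p) => v.
by rewrite big_cons; case: ifP => _; rewrite ?hornerD -?piE pE.
Qed.

Lemma is_polyfun_prod (K : Type) (r : seq K) (P : pred K) (f : K -> F -> F) :
  (forall i, is_polyfun (f i)) -> is_polyfun (fun v => \prod_(i <- r | P i) f i v).
Proof.
move=> pf; elim: r => [|i r [p pE]]; first by exists 1 => v; rewrite big_nil hornerC.
have [pi piE] := pf i; exists (if P i then pi * p else p) => v.
by rewrite big_cons; case: ifP => _; rewrite ?hornerM -?piE pE.
Qed.

Lemma is_polyfun_dense f (rs : seq F) : [pchar F] =i pred0 ->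
  is_polyfun f -> (forall v, v \notin rs -> f v = 0) -> forall v, f v = 0.
Proof.
move=> ch [p pE]; apply: (@polyfun_dense _ (size p)) => //.
by exists p => // ; rewrite leqW.
Qed.

Ltac polyfun_tac := repeat first
  [ apply: is_polyfun_cst | apply: is_polyfun_id | apply: is_polyfun_sum => ?
  | apply: is_polyfun_prod => ? | apply: is_polyfunD | apply: is_polyfunN
  | apply: is_polyfunM | apply: is_polyfunX ].

Section Density.
Variables (X : I -> F) (V : J -> F) (A : {set I}) (B : {set J}).
Hypotheses (ch : [pchar F] =i pred0).
Hypotheses (X0 : {in A, forall i, X i != 0}) (V0 : {in B, forall j, V j != 0}).
Hypotheses (iX : {in A &, injective X}) (iV : {in B &, injective V}).

Lemma generic_density (f : F -> F -> F) :
  (forall s, is_polyfun (f s)) -> (forall T, is_polyfun (f^~ T)) ->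
  (forall s T, generic_position s T X V A B -> f s T = 0) -> forall s T, f s T = 0.
Proof.
move=> pT ps f0 s T; move: s.
apply: (is_polyfun_dense (rs := 0 :: [seq X j / X i | i <- enum A, j <- enum A])) => // s.
rewrite inE negb_or => /andP[s0 sX]; move: T.
apply: (is_polyfun_dense (rs := 0 :: [seq V j / X i | i <- enum A, j <- enum B] ++
  [seq V j / (s * X i) | i <- enum A, j <- enum B])) => // T.
rewrite inE mem_cat !negb_or => /and3P[T0 TX sTX]; apply: f0; split => //.
- move=> i j iA jA; apply: contraNneq sX => e; apply/allpairsP; exists (i, j).
  by rewrite !mem_enum /=; split=> //; rewrite -e mulfK ?X0.
- move=> i j iA jB; apply: contraNneq TX => e; apply/allpairsP; exists (i, j).
  by rewrite !mem_enum /=; split=> //; rewrite -e mulfK ?X0.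
- move=> i j iA jB; apply: contraNneq sTX => e; apply/allpairsP; exists (i, j).
  by rewrite !mem_enum /=; split=> //; rewrite -e [s * T]mulrC -(mulrA T s) mulfK // mulf_neq0 ?X0.
Qed.

Lemma kernel_identity s T x y : #|A| = #|B|.+1 ->
  \sum_(S : {set I} | S \subset A) x ^+ #|A :\: S| * y ^+ #|S| * xterm s T X V A B S =
  (x + y) * \sum_(S : {set J} | S \subset B) x ^+ #|B :\: S| * y ^+ #|S| * vterm s T X V A B S.
Proof.
move=> cA; apply/eqP; rewrite -subr_eq0; apply/eqP; move: s T.
apply: generic_density.
- by move=> s; rewrite /xterm /vterm; polyfun_tac.
- by move=> T; rewrite /xterm /vterm; polyfun_tac.
- by move=> s T /(kernel_identity_generic x y cA)->; rewrite subrr.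
Qed.

Lemma bracket_identity s T : #|A| = #|B|.+1 ->
  \sum_(S : {set J} | S \subset B)
    (-1) ^+ #|S| * vterm s T X V A B S * vbracket s T X V A B S = 0.
Proof.
move=> cA; move: s T; apply: generic_density.
- by move=> s; rewrite /vbracket /vterm; polyfun_tac.
- by move=> T; rewrite /vbracket /vterm; polyfun_tac.
- by move=> s T /(bracket_identity_generic cA).
Qed.
End Density.
End Kernel.

Lemma prod_lt_pairs (F : fieldType) n (s : F) (f : 'I_n -> 'I_n -> F) (I : {set 'I_n}) :
  \prod_(i < n) \prod_(j < n | (i < j)%N)
    (if i \in I then (if j \in I then s else f i j) else if j \in I then f j i else 1) =
  s ^+ 'C(#|I|, 2) * \prod_(i in I) \prod_(j in setT :\: I) f i j.
Proof.
pose c := (\sum_(i in I) \sum_(j in I | (i < j)%N) 1)%N.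
have -> : 'C(#|I|, 2) = c.
  have cs : c = (\sum_(i in I) \sum_(j in I | (j < i)%N) 1)%N.
    rewrite /c (exchange_big_dep (mem I)) //=; last by move=> i j _ /andP[].
    by apply: eq_bigr => i iI; apply: eq_bigl => j; rewrite iI.
  have : (c + c + #|I| = #|I| * #|I|)%N.
    have cI : #|I| = (\sum_(i in I) 1)%N by rewrite sum1_card.
    rewrite {2}cs -sum_nat_const {1}cI /c -!big_split /=.
    apply: eq_bigr => i iI; rewrite [in RHS]cI.
    rewrite [RHS](bigID (fun j : 'I_n => (i < j)%N)) /= -addnA; congr (_ + _)%N.
    rewrite [RHS](bigID (fun j : 'I_n => (j < i)%N)) /=; congr (_ + _)%N.
      by apply: eq_bigl => j; case: (j \in I) => //=; rewrite -leqNgt; case: ltngtP.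
    rewrite (eq_bigl (pred1 i)) ?big_pred1_eq // => j /=.
    have [->|ji] := eqVneq j i; first by rewrite iI ltnn.
    by move: ji; rewrite -val_eqE /=; case: (j \in I) => //=; case: ltngtP.
  by rewrite bin2; case: #|I| => // r; lia.
have -> : s ^+ c = \prod_(i < n) \prod_(j < n | (i < j)%N)
    (if (i \in I) && (j \in I) then s else 1).
  rewrite /c -prodrXr big_mkcond; apply: eq_bigr => i _; case: ifP => iI /=; last first.
    by rewrite big1.
  by rewrite -prodrXr big_mkcondl /=; apply: eq_bigr => j _; rewrite expr1.
have -> : \prod_(i in I) \prod_(j in setT :\: I) f i j =
    (\prod_(i < n) \prod_(j < n | (i < j)%N) (if (i \in I) && (j \notin I) then f i j else 1)) *
    (\prod_(i < n) \prod_(j < n | (i < j)%N) (if (i \notin I) && (j \in I) then f j i else 1)).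
  rewrite [X in _ * X](exchange_big_dep predT) //= -big_split /= big_mkcond; apply: eq_bigr => i _.
  case: ifP => iI; last by rewrite !big1 ?mulr1 // => j _; rewrite ?andbF.
  rewrite (bigID (fun j : 'I_n => (i < j)%N)) /=; congr (_ * _).
    by rewrite [RHS]big_mkcond [LHS]big_mkcond; apply: eq_bigr => j _; rewrite !inE andbT;
       case: (j \in I); case: ltnP.
  rewrite [RHS]big_mkcond [LHS]big_mkcond; apply: eq_bigr => j _; rewrite !inE andbT -leqNgt.
  have [->|ji] := eqVneq j i; first by rewrite iI ltnn.
  by move: ji; rewrite -val_eqE /=; case: (j \in I) => //=; case: ltngtP.
rewrite -!big_split; apply: eq_bigr => i _; rewrite -!big_split; apply: eq_bigr => j _ /=.
by case: (i \in I); case: (j \in I) => /=; rewrite ?mulr1 ?mul1r.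
Qed.

Lemma big_between (R : comNzRingType) (K : finType) (A B : {set K}) (u w : R) :
  [disjoint A & B] ->
  \sum_(S : {set K} | (A \subset S) && [disjoint S & B]) u ^+ #|~: S| * w ^+ #|S| =
  u ^+ #|B| * w ^+ #|A| * (u + w) ^+ #|~: (A :|: B)|.
Proof.
move=> dAB.
have sumD (D : {set K}) :
    \sum_(S : {set K} | S \subset D) u ^+ #|D :\: S| * w ^+ #|S| = (u + w) ^+ #|D|.
  elim: {D}_.+1 {-2}D (ltnSn #|D|) => // m IHm D leDm.
  have [->|[a aD]] := set_0Vmem D.
    by rewrite big_subset0 set0D !cards0 !expr0 mulr1.
  have cD : #|D| = #|D :\ a|.+1 by rewrite (cardsD1 a) aD.
  rewrite (big_subset_split _ aD) /= cD exprS -IHm; last by rewrite -ltnS -cD.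
  rewrite mulr_sumr; apply: eq_bigr => S sS; have [-> ->] := cards_setDS aD sS.
  have : a \notin S by move: sS; rewrite subsetD1 => /andP[].
  by rewrite cardsU1 => ->; rewrite add1n !exprS; ring.
rewrite -sumD mulr_sumr (reindex_onto (fun S => A :|: S) (fun S => S :\: A)) /=; last first.
  move=> S /andP[sAS _]; apply/setP=> x; rewrite !inE.
  by case: (boolP (x \in A)) => //= /(subsetP sAS)->.
apply: eq_big => S.
  rewrite subsetUl /=; apply/andP/idP => [[dS /eqP eS]|sS].
    apply/subsetP=> x xS; rewrite !inE negb_or; apply/andP; split.
      by have := xS; rewrite -eS inE => /andP[].
    by apply: contraTN dS => xB; apply/pred0Pn; exists x; rewrite /= !inE xS orbT.
  split; last first.
    apply/eqP/setP=> x; rewrite !inE; case: (boolP (x \in A)) => //= xA.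
    by apply/esym/negbTE/negP => /(subsetP sS); rewrite !inE xA.
  rewrite disjoints_subset; apply/subsetP=> x; rewrite !inE => /orP[xA|/(subsetP sS)].
    by have := disjoints_subset A B; rewrite dAB => /esym/subsetP/(_ x xA); rewrite inE.
  by rewrite !inE negb_or => /andP[].
case/andP=> /andP[_ dS] /eqP eS.
have dAS : [disjoint A & S].
  by rewrite -setI_eq0 -eS; apply/eqP/setP=> x; rewrite !inE; case: (x \in A).
have -> : #|A :|: S| = (#|A| + #|S|)%N.
  by rewrite cardsU (eqP (_ : A :&: S == set0)) ?setI_eq0 // cards0 subn0.
have -> : #|~: (A :|: S)| = (#|B| + #|~: (A :|: B) :\: S|)%N.
  rewrite -(cardsID B (~: (A :|: S))); congr (_ + _)%N; apply: eq_card => x.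
    rewrite !inE; case: (boolP (x \in B)); rewrite ?andbF //= andbT => xB.
    by have := disjointFl dS xB; rewrite !inE => ->.
  by rewrite !inE !negb_or; do !case: (x \in _).
by rewrite !exprD; ring.
Qed.

(** * The branching and Pieri coefficients *)

Section BranchingCoefficient.
Variables (F : fieldType) (Q : F) (k : nat).

Definition qb (a : int) : F := 1 - Q ^ a.

Definition qN (a : int) : F := \prod_(l < k.-1) qb (a + l.+1%:Z).

Definition shift n (x : 'I_n -> int) (I : {set 'I_n}) (e : int) : 'I_n -> int :=
  fun i => if i \in I then x i + e else x i.

(* In the shifted coordinates x_i = la_i - k i, a signature has gaps at least k. *)
Definition kdominant n (x : 'I_n -> int) : bool :=
  [forall i : 'I_n, forall j : 'I_n, (i < j)%N ==> (k%:Z <= x i - x j)].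

Definition kinterlace n (x : 'I_n.+1 -> int) (y : 'I_n -> int) : bool :=
  [forall j : 'I_n, x (lift ord0 j) + k%:Z <= y j <= x (widen_ord (leqnSn n) j)].

Definition psi_num n (x : 'I_n.+1 -> int) (y : 'I_n -> int) : F :=
  \prod_(i < n.+1) \prod_(j < n)
    (if (i <= j)%N then qN (x i - y j) else qN (y j - x i - k%:Z)).

Definition psi_denV n (y : 'I_n -> int) : F :=
  \prod_(i < n) \prod_(j < n | (i <= j)%N) qN (y i - y j).

Definition psi_denX n (x : 'I_n -> int) : F :=
  \prod_(i < n) \prod_(j < n | (i < j)%N) qN (x i - x j - k%:Z).

Definition psi0 n (x : 'I_n.+1 -> int) (y : 'I_n -> int) : F :=
  if kinterlace x y then psi_num x y / (psi_denV y * psi_denX x) else 0.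

Definition pieri n (x : 'I_n -> int) (I : {set 'I_n}) : F :=
  \prod_(i < n) \prod_(j < n | (i < j)%N)
    (if (i \notin I) && (j \in I) then
       qb (x i - x j - k%:Z) * qb (x i - x j + k%:Z - 1) /
       (qb (x i - x j) * qb (x i - x j - 1))
     else 1).

Lemma kdominantP n (x : 'I_n -> int) :
  reflect (forall i j : 'I_n, (i < j)%N -> k%:Z <= x i - x j) (kdominant x).
Proof.
apply: (iffP forallP) => [H i j ij|H i]; first by have /forallP/(_ j)/implyP/(_ ij) := H i.
by apply/forallP => j; apply/implyP/H.
Qed.

Lemma kdominant_consec n (x : 'I_n -> int) :
  (forall i j : 'I_n, val j = (val i).+1 -> k%:Z <= x i - x j) -> kdominant x.
Proof.
move=> H; apply/kdominantP => i j; move: {2}(j - i)%N (erefl (j - i)%N) => d.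
elim: d => [|d IHd] in j *; first by lia.
move=> ed ij; have lt_jn : (j.-1 < n)%N by rewrite (leq_ltn_trans (leq_pred _)).
have [ji|ji] := eqVneq (j : nat) i.+1; first exact: H.
have /= := IHd (Ordinal lt_jn) ltac:(simpl; lia) ltac:(simpl; lia).
have := H (Ordinal lt_jn) j ltac:(simpl; lia).
lia.
Qed.

Lemma kinterlaceP n (x : 'I_n.+1 -> int) (y : 'I_n -> int) :
  reflect (forall j : 'I_n, x (lift ord0 j) + k%:Z <= y j <= x (widen_ord (leqnSn n) j))
    (kinterlace x y).
Proof. exact: forallP. Qed.

Lemma kinterlace_dominantX n (x : 'I_n.+1 -> int) (y : 'I_n -> int) :
  kinterlace x y -> kdominant x.
Proof.
move=> /kinterlaceP H; apply: kdominant_consec => i j ij.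
have lt_in : (i < n)%N by have := ltn_ord j; rewrite ij ltnS.
have := H (Ordinal lt_in).
have -> : lift ord0 (Ordinal lt_in) = j by apply: val_inj; rewrite /= /bump ij.
have -> : widen_ord (leqnSn n) (Ordinal lt_in) = i by apply: val_inj.
by lia.
Qed.

Lemma kinterlace_dominantV n (x : 'I_n.+1 -> int) (y : 'I_n -> int) :
  kinterlace x y -> kdominant y.
Proof.
move=> /kinterlaceP H; apply: kdominant_consec => i j ij.
have := H i; have := H j.
have -> : widen_ord (leqnSn n) j = lift ord0 i by apply: val_inj; rewrite /= /bump ij.
by lia.
Qed.

Lemma pieri_nondominant n (x : 'I_n -> int) I :
  kdominant x -> ~~ kdominant (shift x I 1) -> pieri x I = 0.
Proof.
move=> /kdominantP dx ndx.
have [i [j [ij lt]]] : exists i j : 'I_n, (i < j)%N /\ shift x I 1 i - shift x I 1 j < k%:Z.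
  move: ndx => /forallPn[i /forallPn[j]]; rewrite negb_imply -ltNge => /andP[ij lt].
  by exists i, j.
apply/eqP/prodf_eq0; exists i => //; apply/prodf_eq0; exists j => //.
move: lt (dx i j ij); rewrite /shift; case: (i \in I); case: (j \in I) => /= lt ge; try lia.
by rewrite (_ : x i - x j - k%:Z = 0) ?[qb 0]subrr ?mul0r ?eqxx //; lia.
Qed.

Hypotheses (Q0 : Q != 0) (Qgen : forall m, (0 < m)%N -> Q ^+ m != 1) (k0 : (0 < k)%N).

Definition qT : F := Q ^ k%:Z.
Definition qs : F := Q ^ (1 - k%:Z).
Local Notation T := qT.
Local Notation s := qs.

Lemma expQ_inj : injective (fun a : int => Q ^ a).
Proof.
have H (a b : int) : a < b -> Q ^ a != Q ^ b.
  move=> ab; have -> : b = a + (absz (b - a))%:Z by rewrite gez0_abs; lia.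
  rewrite expfzDr // -[X in X != _]mulr1 (inj_eq (mulfI _)) ?expfz_neq0 // eq_sym.
  by apply: Qgen; lia.
by move=> a b ab; case: (ltgtP a b) => // /H /eqP; rewrite ab.
Qed.

Lemma qb_eq0 a : (qb a == 0) = (a == 0).
Proof. by rewrite subr_eq0 -[1](expr0z Q) (inj_eq expQ_inj) eq_sym. Qed.

Lemma qN_neq0 a : 0 <= a -> qN a != 0.
Proof. by move=> a0; apply/prodf_neq0 => l _; rewrite qb_eq0; lia. Qed.

Lemma qN_succ a : qN (a + 1) * qb (a + 1) = qN a * qb (a + k%:Z).
Proof.
rewrite /qN -(prednK k0) /=; elim: (k.-1) a => [|m IHm] a.
  by rewrite !big_ord0.
rewrite !big_ord_recr /= [X in X = _]mulrAC IHm -!mulrA; congr (_ * _).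
by congr (_ * qb _); lia.
Qed.

Lemma sT : s * T = Q.
Proof. by rewrite /qs /qT -expfzDr // subrK. Qed.

Lemma psi_denV_neq0 n (y : 'I_n -> int) : kdominant y -> psi_denV y != 0.
Proof.
move=> /kdominantP dy; apply/prodf_neq0 => i _; apply/prodf_neq0 => j ij; apply: qN_neq0.
have [->|ne] := eqVneq i j; first by rewrite subrr.
by have := dy i j; rewrite ltn_neqAle ij (ne : val i != val j) => /(_ isT); lia.
Qed.

Lemma psi_denX_neq0 n (x : 'I_n -> int) : kdominant x -> psi_denX x != 0.
Proof.
move=> /kdominantP dx; apply/prodf_neq0 => i _; apply/prodf_neq0 => j ij; apply: qN_neq0.
by have := dx i j ij; lia.
Qed.

Definition qC (a : int) : F := \prod_(l < k.-2) qb (a + l.+2%:Z).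

Lemma qN_qC a : (1 < k)%N -> qN a = qb (a + 1) * qC a /\ qN (a + 1) = qC a * qb (a + k%:Z).
Proof.
rewrite /qN /qC; case: k => [|[|m]] // _; split.
  rewrite /= big_ord_recl /=; congr (_ * _); by apply: eq_bigr => l _.
rewrite /= big_ord_recr /=; congr (_ * _); last by congr qb; lia.
by apply: eq_bigr => l _; congr qb; lia.
Qed.

Definition psi_common n (x : 'I_n.+1 -> int) (y : 'I_n -> int) : F :=
  \prod_(i < n.+1) \prod_(j < n)
    (if (i <= j)%N then - qC (x i - y j) / Q ^ y j
     else qC (y j - x i - k%:Z - 1) / (Q * Q ^ x i)).

Lemma psi_num_factor n (x : 'I_n.+1 -> int) (y : 'I_n -> int) (e : 'I_n.+1 -> 'I_n -> bool) :
  (1 < k)%N ->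
  \prod_(i < n.+1) \prod_(j < n)
    (if (i <= j)%N then qN (x i - y j + (e i j)%:Z) else qN (y j - x i - k%:Z - (e i j)%:Z)) =
  psi_common x y * \prod_(i < n.+1) \prod_(j < n)
    (if e i j then (T * Q ^ x i - Q ^ y j) * (if (j < i)%N then s else 1)
     else s * T * Q ^ x i - Q ^ y j).
Proof.
move=> k2; rewrite /psi_common -big_split; apply: eq_bigr => i _.
rewrite -big_split; apply: eq_bigr => j _ /=; rewrite sT ltnNge.
have X0 := expfz_neq0 (x i) Q0; have V0 := expfz_neq0 (y j) Q0.
have k1 := expfz_neq0 k%:Z Q0.
have [ij|ij] := leqP i j.
  have [e0 e1] := qN_qC (x i - y j) k2; case: (e i j); rewrite ?addr0.
    rewrite [in LHS]e1 /qb mulr1 /qT !expfzDr // -!invr_expz.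
    by move: (Q ^ k%:Z) (Q ^ x i) (Q ^ y j) (qC _) k1 X0 V0 => *; field.
  rewrite e0 /qb !expfzDr // expr1z -!invr_expz.
  by move: (Q ^ x i) (Q ^ y j) (qC _) X0 V0 => *; field.
have [e0 e1] := qN_qC (y j - x i - k%:Z - 1) k2; case: (e i j); rewrite ?subr0.
  rewrite e0 /qb subrK /qs /qT !expfzDr // expr1z -!invr_expz.
  move: (Q ^ k%:Z) (Q ^ x i) (Q ^ y j) (qC _) k1 X0 V0 => K X V C K1 X1 V1.
  by rewrite /=; field; rewrite K1 X1 Q0.
rewrite -[in LHS](subrK 1 (y j - x i - k%:Z)) e1 /qb.
rewrite (_ : y j - x i - k%:Z - 1 + k%:Z = y j - x i - 1); last by lia.
rewrite !expfzDr // -!invr_expz expr1z.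
by move: (Q ^ x i) (Q ^ y j) (qC _) X0 V0 => X V C X1 V1; field; rewrite X1 Q0.
Qed.

Lemma prod_if_split (I J : finType) (e : pred I) (A B C : I -> J -> F) (S : {set I}) :
  (forall i, e i = (i \in S)) ->
  \prod_i \prod_j (if e i then A i j * B i j else C i j) =
  (\prod_(i in S) \prod_j B i j) *
  ((\prod_(i in S) \prod_(j in setT) A i j) *
   (\prod_(i in setT :\: S) \prod_(j in setT) C i j)).
Proof.
move=> eS; have setTE (f : J -> F) : \prod_(j in setT) f j = \prod_j f j.
  by apply: eq_bigl => j; rewrite inE.
rewrite (bigID (mem S)) /= mulrA; congr (_ * _).
  by rewrite -big_split; apply: eq_bigr => i iS /=; rewrite eS iS setTE big_split mulrC.
apply: eq_big => [i|i iS]; first by rewrite !inE andbT.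
by rewrite setTE eS (negPf iS).
Qed.

Definition xi n (x : 'I_n -> int) (i : 'I_n) : F := Q ^ x i.

Lemma xi_neq0 n (x : 'I_n -> int) i : xi x i != 0.
Proof. exact: expfz_neq0. Qed.

Lemma xi_inj n (x : 'I_n -> int) : kdominant x -> injective (xi x).
Proof.
move=> /kdominantP dx i j /expQ_inj e; apply: val_inj.
by case: (ltngtP (val i) (val j)) => // ij; [have := dx i j ij|have := dx j i ij]; rewrite e; lia.
Qed.

Lemma qN_succ_inv a : 0 <= a -> (qN (a + 1))^-1 = qb (a + 1) / qb (a + k%:Z) / qN a.
Proof.
move=> a0; have e := qN_succ a.
have N0 : qN a != 0 by exact: qN_neq0.
have N1 : qN (a + 1) != 0 by apply: qN_neq0; lia.
have b1 : qb (a + k%:Z) != 0 by rewrite qb_eq0; lia.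
by apply: (mulfI N1); rewrite !mulrA e divff // mulfK // divff.
Qed.

Lemma qN_pred_inv a : 0 < a -> (qN (a - 1))^-1 = qb (a + k%:Z - 1) / qb a / qN a.
Proof.
move=> a0; have := qN_succ (a - 1); rewrite subrK (_ : a - 1 + k%:Z = a + k%:Z - 1); last by lia.
move=> e; have N0 : qN a != 0 by apply: qN_neq0; lia.
have N1 : qN (a - 1) != 0 by apply: qN_neq0; lia.
have b1 : qb a != 0 by rewrite qb_eq0; lia.
by apply: (mulfI N1); rewrite !mulrA -e divff // mulfK // divff.
Qed.

Lemma qb_quot (a c : int) (X Y r : F) : a != 0 -> X != 0 -> Y != 0 -> 
  Q ^ a = X / Y -> Q ^ c = r -> qb (a + c) / qb a = (r * X - Y) / (X - Y).
Proof.
move=> a0 X0 Y0 ea ec; have := qb_eq0 a; rewrite (negPf a0) /qb expfzDr // ea ec => h.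
have XY : X - Y != 0.
  by apply: contraFneq h => /eqP; rewrite subr_eq0 => /eqP->; rewrite divff // subrr.
by field; rewrite XY Y0 /= -opprB oppr_eq0 XY.
Qed.

Lemma pieri_shiftX n (x : 'I_n -> int) (I : {set 'I_n}) :
  kdominant x -> kdominant (shift x I 1) ->
  pieri x I / psi_denX (shift x I 1) *
    (\prod_(i < n) \prod_(j < n | (i < j)%N) (if j \in I then s else 1)) =
  (psi_denX x)^-1 * (s ^+ 'C(#|I|, 2) *
    \prod_(i in I) \prod_(j in setT :\: I) ((s * xi x i - xi x j) / (xi x i - xi x j))).
Proof.
move=> /kdominantP dx /kdominantP dxI.
rewrite -(prod_lt_pairs s (fun i j => (s * xi x i - xi x j) / (xi x i - xi x j)) I).
rewrite /pieri /psi_denX -!prodfV -!big_split /=; apply: eq_bigr => i _.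
rewrite -!prodfV -!big_split /=; apply: eq_bigr => j ij.
have := dx i j ij; have := dxI i j ij; rewrite /shift.
set d := x i - x j; have dE : x i = d + x j by rewrite subrK.
have s0 : s != 0 by exact: expfz_neq0.
have eX : Q ^ d = xi x i / xi x j by rewrite /xi dE expfzDr // mulfK ?expfz_neq0.
have X0 := xi_neq0 x i; have Y0 := xi_neq0 x j.
case: (boolP (i \in I)) => iI; case: (boolP (j \in I)) => jI /= ge1 ge2.
- rewrite (_ : _ + 1 - _ - _ = d - k%:Z); last by rewrite /d; lia.
  by rewrite mul1r.
- rewrite (_ : _ + 1 - _ - _ = (d - k%:Z) + 1); last by rewrite /d; lia.
  rewrite qN_succ_inv; last by lia.
  rewrite mul1r mulr1 mulrC subrK (_ : d - k%:Z + 1 = d + (1 - k%:Z)); last by lia.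
  by rewrite (qb_quot (X := xi x i) (Y := xi x j) (r := s)) //; lia.
- rewrite (_ : x i - (x j + 1) - k%:Z = (d - k%:Z) - 1); last by rewrite /d; lia.
  rewrite qN_pred_inv; last by lia.
  have -> : (s * xi x j - xi x i) / (xi x j - xi x i) = s * (qb (d + k%:Z - 1) / qb d).
    rewrite -addrA (qb_quot (X := xi x i) (Y := xi x j) (r := s^-1)) //; last 1 first.
    + by rewrite /qs invr_expz; congr (_ ^ _); lia.
    + have XY : xi x i - xi x j != 0.
        apply: contraTneq ge2 => /subr0_eq/expQ_inj e; rewrite /d e; lia.
      by field; rewrite XY s0 -opprB oppr_eq0 XY.
    + by lia.
  have b0 : qb d != 0 by rewrite qb_eq0; lia.
  have b1 : qb (d - 1) != 0 by rewrite qb_eq0; lia.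
  have b2 : qb (d - k%:Z) != 0 by rewrite qb_eq0; lia.
  have b3 : qN (d - k%:Z) != 0 by apply: qN_neq0; lia.
  rewrite (_ : d - k%:Z + k%:Z - 1 = d - 1); last by lia.
  by field; rewrite b0 b1 b2 b3.
- by rewrite mul1r !mulr1.
Qed.

Lemma pieri_shiftV n (y : 'I_n -> int) (J : {set 'I_n}) :
  kdominant y -> kdominant (shift y J (-1)) ->
  pieri (shift y J (-1)) J / psi_denV (shift y J (-1)) *
    (\prod_(i < n) \prod_(j < n | (i <= j)%N) (if i \in J then s else 1)) =
  (psi_denV y)^-1 * (s ^+ 'C(#|J|.+1, 2) *
    \prod_(i in J) \prod_(j in setT :\: J) ((xi y i - s * xi y j) / (xi y i - xi y j))).
Proof.
move=> /kdominantP dy /kdominantP dyJ.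
have diag (G : 'I_n -> 'I_n -> F) : \prod_(i < n) \prod_(j < n | (i <= j)%N) G i j =
    (\prod_(i < n) G i i) * \prod_(i < n) \prod_(j < n | (i < j)%N) G i j.
  rewrite -big_split; apply: eq_bigr => i _; rewrite (bigD1 i) //=; congr (_ * _).
  by apply: eq_bigl => j; rewrite ltn_neqAle andbC eq_sym.
rewrite binS bin1 exprD /psi_denV !diag.
rewrite -[s ^+ 'C(_, _) * _ * _]mulrAC.
rewrite -(prod_lt_pairs s (fun i j => (xi y i - s * xi y j) / (xi y i - xi y j)) J).
have -> : \prod_(i < n) (if i \in J then s else 1) = s ^+ #|J|.
  by rewrite -prodr_const [RHS]big_mkcond.
have -> : \prod_(i < n) qN (shift y J (-1) i - shift y J (-1) i) = \prod_(i < n) qN (y i - y i).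
  by apply: eq_bigr => i _; rewrite !subrr.
rewrite !invfM.
suff e : pieri (shift y J (-1)) J *
    ((\prod_(i < n) \prod_(j < n | (i < j)%N) qN (shift y J (-1) i - shift y J (-1) j))^-1 *
    \prod_(i < n) \prod_(j < n | (i < j)%N) (if i \in J then s else 1)) =
    (\prod_(i < n) \prod_(j < n | (i < j)%N) qN (y i - y j))^-1 *
    \prod_(i < n) \prod_(j < n | (i < j)%N)
    (if i \in J then (if j \in J then s else (xi y i - s * xi y j) / (xi y i - xi y j))
     else if j \in J then (xi y j - s * xi y i) / (xi y j - xi y i) else 1).
  move: e; set P := pieri _ _; set A := _^-1; set B := _^-1; set C := \prod_(i < n) \prod_(j < n | _) _.
  set D := \prod_(i < n) \prod_(j < n | _) _; move: (\prod_(i < n) _)^-1 => E e.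
  transitivity (E * s ^+ #|J| * (P * (A * C))); first by ring.
  by rewrite e; ring.
rewrite /pieri -!prodfV -!big_split /=; apply: eq_bigr => i _.
rewrite -!prodfV -!big_split /=; apply: eq_bigr => j ij.
have := dy i j ij; have := dyJ i j ij; rewrite /shift.
set d := y i - y j; have dE : y i = d + y j by rewrite subrK.
have s0 : s != 0 by exact: expfz_neq0.
have eX : Q ^ d = xi y i / xi y j by rewrite /xi dE expfzDr // mulfK ?expfz_neq0.
have X0 := xi_neq0 y i; have Y0 := xi_neq0 y j.
case: (boolP (i \in J)) => iJ; case: (boolP (j \in J)) => jJ /= ge1 ge2.
- rewrite (_ : y i - 1 - (y j - 1) = d); last by rewrite /d; lia.
  by rewrite mul1r.
- rewrite (_ : y i - 1 - y j = d - 1); last by rewrite /d; lia.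
  rewrite qN_pred_inv; last by lia.
  rewrite -[d + k%:Z - 1]addrA (qb_quot (X := xi y i) (Y := xi y j) (r := s^-1)) //; last 1 first.
  + by rewrite /qs invr_expz; congr (_ ^ _); lia.
  + have XY : xi y i - xi y j != 0.
      by apply: contraTneq ge2 => /subr0_eq/expQ_inj e; rewrite /d e; lia.
    have b3 : qN d != 0 by apply: qN_neq0; lia.
    by field; rewrite XY s0 b3.
  + by lia.
- rewrite (_ : y i - (y j - 1) = d + 1); last by rewrite /d; lia.
  rewrite qN_succ_inv; last by lia.
  have -> : (xi y j - s * xi y i) / (xi y j - xi y i) = qb (d + (1 - k%:Z)) / qb d.
    rewrite (qb_quot (X := xi y i) (Y := xi y j) (r := s)) //; last by lia.
    have XY : xi y i - xi y j != 0.
      by apply: contraTneq ge2 => /subr0_eq/expQ_inj e; rewrite /d e; lia.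
    by field; rewrite XY -opprB oppr_eq0 XY.
  have b0 : qb d != 0 by rewrite qb_eq0; lia.
  have b1 : qb (d + 1) != 0 by rewrite qb_eq0; lia.
  have b2 : qb (d + k%:Z) != 0 by rewrite qb_eq0; lia.
  have b3 : qN d != 0 by apply: qN_neq0; lia.
  rewrite (_ : d + 1 - k%:Z = d + (1 - k%:Z)); last by lia.
  rewrite (_ : d + 1 + k%:Z - 1 = d + k%:Z); last by lia.
  rewrite (_ : d + 1 - 1 = d); last by lia.
  by field; rewrite b0 b1 b2 b3.
- by rewrite mul1r !mulr1.
Qed.
End BranchingCoefficient.

Section Matching.
Variables (F : fieldType) (Q : F) (k : nat).
Hypotheses (Q0 : Q != 0) (Qgen : forall m, (0 < m)%N -> Q ^+ m != 1) (k0 : (0 < k)%N).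
Local Notation T := (qT Q k).
Local Notation s := (qs Q k).

Definition term_common n (x : 'I_n.+1 -> int) (y : 'I_n -> int) : F :=
  psi_common Q k x y / (psi_denV Q k y * psi_denX Q k x).

Lemma psi_termX n (x : 'I_n.+1 -> int) (y : 'I_n -> int) (I : {set 'I_n.+1}) : (1 < k)%N ->
  kdominant k x -> kdominant k (shift x I 1) ->
  pieri Q k x I * (psi_num Q k (shift x I 1) y / (psi_denV Q k y * psi_denX Q k (shift x I 1))) =
  term_common x y * xterm s T (xi Q x) (xi Q y) setT setT I.
Proof.
move=> k2 dx dxI.
have -> : psi_num Q k (shift x I 1) y = \prod_(i < n.+1) \prod_(j < n)
    (if (i <= j)%N then qN Q k (x i - y j + (i \in I)%:Z)
     else qN Q k (y j - x i - k%:Z - (i \in I)%:Z)).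
  apply: eq_bigr => i _; apply: eq_bigr => j _; rewrite /shift.
  by case: (i \in I) => /=; rewrite ?addr0 ?subr0 //; case: ifP => _; congr (qN _ _ _); lia.
rewrite (psi_num_factor Q0 k0 x y (fun i _ => i \in I) k2).
rewrite (prod_if_split (e := fun i => i \in I) _ _ _ (S := I)) //.
have -> : \prod_(i in I) \prod_(j < n) (if (j < i)%N then s else 1) =
    \prod_(i < n.+1) \prod_(j < n.+1 | (i < j)%N) (if j \in I then s else 1).
  rewrite [RHS](exchange_big_dep predT) //= [LHS]big_mkcond; apply: eq_bigr => i _.
  case: (i \in I); last by rewrite big1.
  rewrite [RHS]big_mkcond big_ord_recr /= ltnNge -ltnS ltn_ord mulr1.
  by apply: eq_bigr => j _; case: ifP.
have e := pieri_shiftX Q0 Qgen k0 dx dxI; rewrite /term_common /xterm.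
set U := \prod_(i < n.+1) \prod_(j < n.+1 | _) _ in e *.
set P := pieri _ _ _ _ in e *; set D := psi_denX _ _ (shift _ _ _) in e *.
set A := (\prod_(i in I) \prod_(j in setT) _) * _.
transitivity (psi_common Q k x y / psi_denV Q k y * (P / D * U) * A).
  by rewrite invfM; ring.
by rewrite e invfM; ring.
Qed.

Lemma psi_termV n (x : 'I_n.+1 -> int) (y : 'I_n -> int) (J : {set 'I_n}) : (1 < k)%N ->
  kdominant k y -> kdominant k (shift y J (-1)) ->
  pieri Q k (shift y J (-1)) J *
    (psi_num Q k x (shift y J (-1)) / (psi_denV Q k (shift y J (-1)) * psi_denX Q k x)) =
  term_common x y * vterm s T (xi Q x) (xi Q y) setT setT J.
Proof.
move=> k2 dy dyJ.
have -> : psi_num Q k x (shift y J (-1)) = \prod_(i < n.+1) \prod_(j < n)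
    (if (i <= j)%N then qN Q k (x i - y j + (j \in J)%:Z)
     else qN Q k (y j - x i - k%:Z - (j \in J)%:Z)).
  apply: eq_bigr => i _; apply: eq_bigr => j _; rewrite /shift.
  by case: (j \in J) => /=; rewrite ?addr0 ?subr0 //; case: ifP => _; congr (qN _ _ _); lia.
rewrite (psi_num_factor Q0 k0 x y (fun _ j => j \in J) k2).
rewrite [\prod_(i < n.+1) \prod_(j < n) (if j \in J then _ else _)]exchange_big /=.
rewrite (prod_if_split (e := fun j => j \in J) (fun j i => T * Q ^ x i - Q ^ y j)
  (fun j i => if (j < i)%N then s else 1) (fun j i => s * T * Q ^ x i - Q ^ y j) (S := J)) //.
have -> : \prod_(j in J) \prod_(i < n.+1) (if (j < i)%N then s else 1) =
    \prod_(i < n) \prod_(j < n | (i <= j)%N) (if i \in J then s else 1).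
  rewrite [LHS]big_mkcond; apply: eq_bigr => j _.
  case: (j \in J); last by rewrite big1.
  rewrite [RHS]big_mkcond big_ord_recl /= mul1r.
  by apply: eq_bigr => i _; rewrite /bump /= add1n ltnS.
have e := pieri_shiftV Q0 Qgen k0 dy dyJ; rewrite /term_common /vterm.
set U := \prod_(i < n) \prod_(j < n | _) _ in e *.
set P := pieri _ _ _ _ in e *; set D := psi_denV _ _ (shift _ _ _) in e *.
set A := (\prod_(i in J) \prod_(j in setT) _) * _.
transitivity (psi_common Q k x y / psi_denX Q k x * (P / D * U) * A).
  by rewrite invfM; ring.
by rewrite e invfM; ring.
Qed.
End Matching.

Section Branching.
Variables (F : fieldType) (Q : F) (k : nat).
Hypotheses (ch : [pchar F] =i pred0).
Hypotheses (Q0 : Q != 0) (Qgen : forall m, (0 < m)%N -> Q ^+ m != 1) (k0 : (0 < k)%N).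
Local Notation T := (qT Q k).
Local Notation s := (qs Q k).
Local Notation wid := (widen_ord (leqnSn _)).
Local Notation lft := (lift ord0).

Definition knear n (x : 'I_n.+1 -> int) (y : 'I_n -> int) : bool :=
  [forall j : 'I_n, x (lft j) + k%:Z <= y j <= x (wid j) + 1].

Lemma xtermT_eq0 n (x : 'I_n.+1 -> int) (y : 'I_n -> int) I :
  knear x y -> ~~ kinterlace k (shift x I 1) y ->
  xterm s T (xi Q x) (xi Q y) setT setT I = 0.
Proof.
move=> /forallP near /forallPn[j]; rewrite /shift => nj; have nearj := near j.
rewrite /xterm; have [[e jI]|[e jI]] : (y j = x (wid j) + 1 /\ wid j \notin I) \/
    (y j = x (lft j) + k%:Z /\ lft j \in I).
- move: nj nearj; case: (boolP (lft j \in I)); case: (boolP (wid j \in I)) => *; lia.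
- suff -> : \prod_(i in setT :\: I) \prod_(j in setT) (s * T * xi Q x i - xi Q y j) = 0.
    by rewrite !mulr0.
  apply/eqP/prodf_eq0; exists (wid j); first by rewrite !inE jI.
  apply/prodf_eq0; exists j; first by rewrite inE.
  by rewrite /xi e sT // expfzDr // expr1z [Q * _]mulrC subrr.
- suff -> : \prod_(i in I) \prod_(j in setT) (T * xi Q x i - xi Q y j) = 0.
    by rewrite mul0r mulr0.
  apply/eqP/prodf_eq0; exists (lft j) => //; apply/prodf_eq0; exists j; first by rewrite inE.
  by rewrite /xi e expfzDr // [qT _ _ * _]mulrC subrr.
Qed.

Lemma vtermT_eq0 n (x : 'I_n.+1 -> int) (y : 'I_n -> int) J :
  knear x y -> ~~ kinterlace k x (shift y J (-1)) ->
  vterm s T (xi Q x) (xi Q y) setT setT J = 0.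
Proof.
move=> /forallP near /forallPn[j]; rewrite /shift => nj; have nearj := near j.
rewrite /vterm; have [[e jJ]|[e jJ]] : (y j = x (wid j) + 1 /\ j \notin J) \/
    (y j = x (lft j) + k%:Z /\ j \in J).
- by move: nj nearj; case: (boolP (j \in J)) => *; lia.
- suff -> : \prod_(j in setT :\: J) \prod_(i in setT) (s * T * xi Q x i - xi Q y j) = 0.
    by rewrite !mulr0.
  apply/eqP/prodf_eq0; exists j; first by rewrite !inE jJ.
  apply/prodf_eq0; exists (wid j); first by rewrite inE.
  by rewrite /xi e sT // expfzDr // expr1z [Q * _]mulrC subrr.
- suff -> : \prod_(j in J) \prod_(i in setT) (T * xi Q x i - xi Q y j) = 0.
    by rewrite mul0r mulr0.
  apply/eqP/prodf_eq0; exists j => //; apply/prodf_eq0; exists (lft j); first by rewrite inE.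
  by rewrite /xi e expfzDr // [qT _ _ * _]mulrC subrr.
Qed.

Lemma kinterlace_nearX n (x : 'I_n.+1 -> int) (y : 'I_n -> int) I :
  kinterlace k (shift x I 1) y -> knear x y.
Proof.
move=> /forallP H; apply/forallP => j; have := H j; rewrite /shift.
by case: (lft j \in I); case: (wid j \in I); lia.
Qed.

Lemma kinterlace_nearV n (x : 'I_n.+1 -> int) (y : 'I_n -> int) J :
  kinterlace k x (shift y J (-1)) -> knear x y.
Proof.
move=> /forallP H; apply/forallP => j; have := H j; rewrite /shift.
by case: (j \in J); lia.
Qed.

Lemma shiftK n (y : 'I_n -> int) J : shift (shift y J (-1)) J 1 =1 y.
Proof. by move=> j; rewrite /shift; case: (j \in J); rewrite ?subrK. Qed.

Lemma eq_kdominant n (x y : 'I_n -> int) : x =1 y -> kdominant k x = kdominant k y.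
Proof. by move=> xy; apply: eq_forallb => i; apply: eq_forallb => j; rewrite !xy. Qed.

Lemma psi0_pieri_nondominant n (x : 'I_n.+1 -> int) (y : 'I_n -> int) J :
  ~~ kdominant k y -> psi0 Q k x (shift y J (-1)) * pieri Q k (shift y J (-1)) J = 0.
Proof.
move=> ndy; rewrite /psi0; case: ifP => [yJ|]; last by rewrite mul0r.
have dyJ := kinterlace_dominantV yJ.
by rewrite (pieri_nondominant _ dyJ) ?mulr0 // (eq_kdominant (shiftK y J)).
Qed.

Lemma pieri_psi0X n (x : 'I_n.+1 -> int) (y : 'I_n -> int) I : (1 < k)%N ->
  kdominant k x -> knear x y ->
  pieri Q k x I * psi0 Q k (shift x I 1) y =
  term_common Q k x y * xterm s T (xi Q x) (xi Q y) setT setT I.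
Proof.
move=> k2 dx near; rewrite /psi0; case: ifPn => [xy|nxy]; last first.
  by rewrite (xtermT_eq0 near nxy) !mulr0.
by apply: psi_termX => //; apply: kinterlace_dominantX xy.
Qed.

Lemma pieri_psi0V n (x : 'I_n.+1 -> int) (y : 'I_n -> int) J : (1 < k)%N ->
  kdominant k y -> knear x y ->
  psi0 Q k x (shift y J (-1)) * pieri Q k (shift y J (-1)) J =
  term_common Q k x y * vterm s T (xi Q x) (xi Q y) setT setT J.
Proof.
move=> k2 dy near; rewrite /psi0; case: ifPn => [xy|nxy]; last first.
  by rewrite (vtermT_eq0 near nxy) mul0r mulr0.
by rewrite mulrC; apply: psi_termV => //; apply: kinterlace_dominantV xy.
Qed.

Definition pieri_identity n (x : 'I_n.+1 -> int) (y : 'I_n -> int) := forall u w : F,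
  \sum_(I : {set 'I_n.+1}) u ^+ #|~: I| * w ^+ #|I| * (pieri Q k x I * psi0 Q k (shift x I 1) y) =
  (u + w) * \sum_(J : {set 'I_n}) u ^+ #|~: J| * w ^+ #|J| *
    (psi0 Q k x (shift y J (-1)) * pieri Q k (shift y J (-1)) J).

Definition macdonald_identity n (x : 'I_n.+1 -> int) (y : 'I_n -> int) :=
  \sum_(J : {set 'I_n}) (-1) ^+ #|J| *
    (psi0 Q k x (shift y J (-1)) * pieri Q k (shift y J (-1)) J) *
    vbracket s T (xi Q x) (xi Q y) setT setT J = 0.

Lemma identities_reduce n (x : 'I_n.+1 -> int) (y : 'I_n -> int) :
  (kdominant k y -> knear x y -> pieri_identity x y /\ macdonald_identity x y) ->
  pieri_identity x y /\ macdonald_identity x y.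
Proof.
move=> H; case: (boolP (kdominant k y && knear x y)) => [/andP[dy near]|]; first exact: H.
rewrite negb_and => nn.
have zV J : psi0 Q k x (shift y J (-1)) * pieri Q k (shift y J (-1)) J = 0.
  case: (boolP (kdominant k y)) nn => [dy /= nn|ndy _]; last exact: psi0_pieri_nondominant.
  rewrite /psi0; case: ifP => [yJ|]; last by rewrite mul0r.
  by rewrite (kinterlace_nearV yJ) in nn.
have zX I : psi0 Q k (shift x I 1) y = 0.
  rewrite /psi0; case: ifP => // xy.
  by move: nn; rewrite (kinterlace_dominantV xy) (kinterlace_nearX xy).
split; last by apply: big1 => J _; rewrite zV mulr0 mul0r.
by move=> u w; rewrite !big1 ?mulr0 // => [J _|I _]; rewrite ?zV ?zX !mulr0.
Qed.

Lemma identities_gt1 n (x : 'I_n.+1 -> int) (y : 'I_n -> int) : (1 < k)%N -> kdominant k x ->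
  pieri_identity x y /\ macdonald_identity x y.
Proof.
move=> k2 dx; apply: identities_reduce => dy near.
have cT : #|[set: 'I_n.+1]| = #|[set: 'I_n]|.+1 by rewrite !cardsT !card_ord.
have X0 : {in [set: 'I_n.+1], forall i, xi Q x i != 0} by move=> i _; apply: xi_neq0.
have V0 : {in [set: 'I_n], forall i, xi Q y i != 0} by move=> i _; apply: xi_neq0.
have iX : {in [set: 'I_n.+1] &, injective (xi Q x)} by move=> i j _ _; apply: (xi_inj Q0 Qgen k0 dx).
have iV : {in [set: 'I_n] &, injective (xi Q y)} by move=> i j _ _; apply: (xi_inj Q0 Qgen k0 dy).
split.
  move=> u w; have e := kernel_identity ch X0 V0 iX iV s T u w cT.
  transitivity (term_common Q k x y *
    \sum_(S : {set 'I_n.+1} | S \subset setT) u ^+ #|setT :\: S| * w ^+ #|S| *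
      xterm s T (xi Q x) (xi Q y) setT setT S).
    rewrite mulr_sumr; apply: eq_big => [I|I _]; first by rewrite subsetT.
    by rewrite pieri_psi0X // setTD; ring.
  rewrite e mulrCA mulr_sumr; congr (_ * _); apply: eq_big => [I|I _]; first by rewrite subsetT.
  by rewrite pieri_psi0V // setTD; ring.
have e := bracket_identity ch X0 V0 iX iV s T cT.
rewrite /macdonald_identity -[RHS](mulr0 (term_common Q k x y)) -[X in _ * X]e mulr_sumr.
apply: eq_big => [I|I _]; first by rewrite subsetT.
by rewrite pieri_psi0V //; ring.
Qed.

Lemma psi0_k1 n (x : 'I_n.+1 -> int) (y : 'I_n -> int) : k = 1%N ->
  psi0 Q k x y = (kinterlace k x y)%:R.
Proof.
move=> k1; have N1 a : qN Q k a = 1 by rewrite /qN k1 big_ord0.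
rewrite /psi0; case: ifP => //= _; rewrite /psi_num /psi_denV /psi_denX.
by rewrite !big1 ?mulr1 ?divr1 // => i _; rewrite big1 // => j _; rewrite !N1 ?if_same.
Qed.

Lemma pieri_k1 n (x : 'I_n -> int) I : k = 1%N ->
  kdominant k x -> kdominant k (shift x I 1) -> pieri Q k x I = 1.
Proof.
move=> k1 /kdominantP dx /kdominantP dxI; apply: big1 => i _; apply: big1 => j ij.
case: ifP => // /andP[iI jI]; have := dx i j ij; have := dxI i j ij.
rewrite /shift (negPf iI) jI => H1 H2.
have b0 : qb Q (x i - x j) != 0 by rewrite (qb_eq0 Q0 Qgen k0); lia.
have b1 : qb Q (x i - x j - 1) != 0 by rewrite (qb_eq0 Q0 Qgen k0); lia.
rewrite k1 (_ : x i - x j + 1%:Z - 1 = x i - x j); last by lia.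
by rewrite [X in X / _]mulrC divff // mulf_neq0.
Qed.

Definition tight_top n (x : 'I_n.+1 -> int) (y : 'I_n -> int) : {set 'I_n} :=
  [set j | y j == x (wid j) + 1].
Definition tight_bot n (x : 'I_n.+1 -> int) (y : 'I_n -> int) : {set 'I_n} :=
  [set j | y j == x (lft j) + k%:Z].

Lemma kinterlace_shiftX n (x : 'I_n.+1 -> int) (y : 'I_n -> int) I : knear x y ->
  kinterlace k (shift x I 1) y =
  ([set wid j | j in tight_top x y] \subset I) && [disjoint I & [set lft j | j in tight_bot x y]].
Proof.
move=> /forallP near; apply/forallP/andP => [H|[/subsetP sA dB] j].
  split.
    apply/subsetP => _ /imsetP[j + ->]; rewrite inE => /eqP ej; have := H j.
    by rewrite /shift ej; case: (wid j \in I) => //; lia.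
  rewrite disjoint_sym disjoints_subset; apply/subsetP => _ /imsetP[j + ->]; rewrite !inE => /eqP ej.
  by have := H j; rewrite /shift ej; case: (lft j \in I) => //; lia.
have := near j; rewrite /shift => nj; apply/andP; split.
  case: (boolP (lft j \in I)) => lI; last by lia.
  have : j \notin tight_bot x y.
    by apply: contraTN lI => jb; rewrite (disjointFl dB) // imset_f.
  by rewrite inE; lia.
case: (boolP (wid j \in I)) => wI; first by lia.
have : j \notin tight_top x y by apply: contra wI => jt; apply/sA/imset_f.
by rewrite inE; lia.
Qed.

Lemma kinterlace_shiftV n (x : 'I_n.+1 -> int) (y : 'I_n -> int) J : knear x y ->
  kinterlace k x (shift y J (-1)) = (tight_top x y \subset J) && [disjoint J & tight_bot x y].
Proof.
move=> /forallP near; apply/forallP/andP => [H|[/subsetP sA dB] j].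
  split.
    apply/subsetP => j; rewrite inE => /eqP ej; have := H j.
    by rewrite /shift ej; case: (j \in J) => //; lia.
  rewrite disjoint_sym disjoints_subset; apply/subsetP => j; rewrite !inE => /eqP ej.
  by have := H j; rewrite /shift ej; case: (j \in J) => //; lia.
have := near j; rewrite /shift => nj; case: (boolP (j \in J)) => jJ.
  have : j \notin tight_bot x y by rewrite (disjointFr dB).
  by rewrite inE; lia.
have : j \notin tight_top x y by apply: contra jJ => /sA.
by rewrite inE; lia.
Qed.

Section Equal1.
Variables (n : nat) (x : 'I_n.+1 -> int) (y : 'I_n -> int).
Hypotheses (k1 : k = 1%N) (dx : kdominant k x) (dy : kdominant k y) (near : knear x y).
Local Notation A := (tight_top x y).
Local Notation B := (tight_bot x y).

Lemma tight_disjoint : [disjoint A & B].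
Proof.
rewrite disjoints_subset; apply/subsetP => j; rewrite !inE => /eqP ->.
have := elimT (kdominantP _ _) dx (wid j) (lft j); rewrite /= /bump leq0n add1n => /(_ (ltnSn _)).
by rewrite k1; lia.
Qed.

Lemma tight_neq i j : i \in A -> j \in B -> wid i != lft j :> 'I_n.+1.
Proof.
rewrite !inE => /eqP ei /eqP ej; apply: contra_eqN ei => /eqP e.
have ji : (j < i)%N by have := congr1 val e; rewrite /= /bump => ->.
have := elimT (kdominantP _ _) dy j i ji; rewrite e k1 in ej *; rewrite ej; lia.
Qed.

Lemma lift0_inj : injective (fun j : 'I_n => lft j).
Proof. exact: lift_inj. Qed.

Lemma widen_inj : injective (fun j : 'I_n => wid j).
Proof. by move=> i j /(congr1 val) /= /val_inj. Qed.

Lemma tight_imset_disjoint : [disjoint [set wid j | j in A] & [set lft j | j in B]].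
Proof.
rewrite disjoints_subset; apply/subsetP => _ /imsetP[i iA ->]; rewrite inE.
by apply/imsetP => -[j jB /eqP]; apply/negP/tight_neq.
Qed.

Lemma cards_setCU (K : finType) (U W : {set K}) : [disjoint U & W] ->
  #|~: (U :|: W)| = (#|K| - #|U| - #|W|)%N.
Proof.
by rewrite -setI_eq0 => /eqP dUW; have := cardsC (U :|: W); rewrite cardsU dUW cards0; lia.
Qed.

Lemma sum_interlace_eq1 (u w : F) :
  \sum_(J : {set 'I_n}) u ^+ #|~: J| * w ^+ #|J| *
    (psi0 Q k x (shift y J (-1)) * pieri Q k (shift y J (-1)) J) =
  u ^+ #|B| * w ^+ #|A| * (u + w) ^+ #|~: (A :|: B)|.
Proof.
rewrite -(big_between _ _ tight_disjoint) [RHS]big_mkcond; apply: eq_bigr => J _.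
rewrite psi0_k1 // -kinterlace_shiftV //; case: ifP => /= yJ; last by rewrite mul0r mulr0.
rewrite pieri_k1 ?mulr1 //; first exact: kinterlace_dominantV yJ.
by rewrite (eq_kdominant (shiftK y J)).
Qed.

Lemma pieri_identity_eq1 : pieri_identity x y.
Proof.
move=> u w; rewrite sum_interlace_eq1 //.
transitivity (u ^+ #|B| * w ^+ #|A| * (u + w) ^+ #|~: (A :|: B)|.+1); last by rewrite exprS; ring.
have -> : #|~: (A :|: B)|.+1 =
    #|~: ([set (wid j : 'I_n.+1) | j in A] :|: [set (lft j : 'I_n.+1) | j in B])|.
  rewrite !cards_setCU ?tight_disjoint ?tight_imset_disjoint //.
  rewrite !card_imset ?card_ord; [|exact: lift0_inj|exact: widen_inj].
  have := cards_setCU tight_disjoint; have := subset_leq_card (subsetT (A :|: B)).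
  have := tight_disjoint; rewrite -setI_eq0 => /eqP dAB; rewrite cardsU dAB cards0 cardsT card_ord.
  by move: (#|A|) (#|B|) (#|~: _|) => a b c; lia.
rewrite -{1}(card_imset B lift0_inj) -{1}(card_imset A widen_inj).
rewrite -(big_between _ _ tight_imset_disjoint) [RHS]big_mkcond; apply: eq_bigr => I _.
rewrite psi0_k1 // -kinterlace_shiftX //; case: ifP => /= yJ; last by rewrite !mulr0.
by rewrite pieri_k1 ?mulr1 //; apply: kinterlace_dominantX yJ.
Qed.

Lemma macdonald_identity_eq1 : macdonald_identity x y.
Proof.
have s1 : s = 1 by rewrite /qs k1 subrr expr0z.
have TQ : T = Q by rewrite /qT k1 expr1z.
pose br := \sum_(j < n) xi Q y j + T ^+ n.+1 * (\prod_(i < n.+1) xi Q x i) / (\prod_(j < n) xi Q y j) -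
  T * \sum_(i < n.+1) xi Q x i.
have brE J : vbracket s T (xi Q x) (xi Q y) setT setT J = br.
  rewrite /vbracket s1 subrr mul0r addr0 !mul1r expr1n mulr1 cardsT card_ord /br.
  by congr (_ + _ * _ / _ - _ * _); apply: eq_bigl => i; rewrite inE.
rewrite /macdonald_identity; under eq_bigr => J _ do rewrite brE.
rewrite -mulr_suml.
have -> : \sum_(J : {set 'I_n}) (-1) ^+ #|J| *
    (psi0 Q k x (shift y J (-1)) * pieri Q k (shift y J (-1)) J) =
    1 ^+ #|B| * (-1) ^+ #|A| * (1 + -1) ^+ #|~: (A :|: B)|.
  by rewrite -sum_interlace_eq1 //; apply: eq_bigr => J _; rewrite expr1n mul1r.
case: (posnP #|~: (A :|: B)|) => [|pos]; last by rewrite subrr expr0n eqn0Ngt pos /= mulr0 mul0r.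
move=> /eqP; rewrite cards_eq0 => /eqP fullC.
have full j : j \notin A -> j \in B.
  move=> jA; have : j \notin ~: (A :|: B) by rewrite fullC inE.
  by rewrite !inE negbK in jA *; rewrite (negPf jA).
suff -> : br = 0 by rewrite mulr0.
pose f j : 'I_n.+1 := if j \in A then wid j else lft j.
have f_inj : injective f.
  move=> i j; rewrite /f; case: (boolP (i \in A)) => iA; case: (boolP (j \in A)) => jA.
  - exact: widen_inj.
  - by move=> /eqP; rewrite (negPf (tight_neq iA (full _ jA))).
  - by move=> /esym/eqP; rewrite (negPf (tight_neq jA (full _ iA))).
  - exact: lift0_inj.
have yf j : xi Q y j = T * xi Q x (f j).
  rewrite /xi /f TQ; case: (boolP (j \in A)) => [|/full]; rewrite inE => /eqP->.
    by rewrite expfzDr // expr1z mulrC.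
  by rewrite k1 expfzDr // expr1z mulrC.
have [c cE] : exists c, ~: (f @: setT) = [set c].
  apply/cards1P; have := cardsC (f @: setT); rewrite card_imset // cardsT !card_ord.
  by move=> e; apply/eqP; lia.
have split_sum : \sum_(i < n.+1) xi Q x i = xi Q x c + \sum_(j < n) xi Q x (f j).
  rewrite (bigID (mem (f @: setT))) /= addrC; congr (_ + _).
    by rewrite (eq_bigl (pred1 c)) ?big_pred1_eq // => i; rewrite -in_setC cE inE.
  by rewrite big_imset /=; [apply: eq_bigl => j; rewrite inE | move=> ????; apply: f_inj].
have split_prod : \prod_(i < n.+1) xi Q x i = xi Q x c * \prod_(j < n) xi Q x (f j).
  rewrite (bigID (mem (f @: setT))) /= mulrC; congr (_ * _).
    by rewrite (eq_bigl (pred1 c)) ?big_pred1_eq // => i; rewrite -in_setC cE inE.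
  by rewrite big_imset /=; [apply: eq_bigl => j; rewrite inE | move=> ????; apply: f_inj].
rewrite /br split_sum split_prod (eq_bigr _ (fun j _ => yf j)) -mulr_sumr.
rewrite [\prod_(j < n) xi Q y j](eq_bigr _ (fun j _ => yf j)) big_split /= prodr_const card_ord.
have T0 : T != 0 by rewrite TQ.
have P0 : \prod_(j < n) xi Q x (f j) != 0 by apply/prodf_neq0 => j _; apply: xi_neq0.
by rewrite exprS; field; rewrite P0 expf_neq0.
Qed.
End Equal1.

Lemma branching_identities n (x : 'I_n.+1 -> int) (y : 'I_n -> int) : kdominant k x ->
  pieri_identity x y /\ macdonald_identity x y.
Proof.
move=> dx; case: (ltngtP k 1) k0 => [|k2 _|k1 _]; first by case: k.
  exact: identities_gt1.
by apply: identities_reduce => dy near; split; [exact: pieri_identity_eq1|exact: macdonald_identity_eq1].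
Qed.
End Branching.

Section FiniteSupport.
Variables (V : zmodType) (n : nat).
Implicit Types (f : 'X_{1..n} -> V) (b : nat).

Lemma bmsum_reindex b b' f (t : 'X_{1..n} -> 'X_{1..n}) (t' : 'X_{1..n} -> 'X_{1..n}) (D : pred 'X_{1..n}) :
  {in D, cancel t' t} -> cancel t t' -> (forall m, D (t m)) ->
  (forall m, f m != 0 -> (mdeg m < b)%N /\ (mdeg (t m) < b')%N) ->
  \sum_(m : 'X_{1..n < b}) f m = \sum_(m : 'X_{1..n < b'}) (if D m then f (t' m) else 0).
Proof.
move=> tK t'K Dt supp.
transitivity (\sum_(m : 'X_{1..n < b}) \sum_(m' : 'X_{1..n < b'} | val m' == t m) f m).
  apply: eq_bigr => m _; have [->|fm] := eqVneq (f m) 0; first by rewrite big1.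
  have [_ lt_tm] := supp _ fm.
  by rewrite (eq_bigl (pred1 (BMultinom lt_tm))) ?big_pred1_eq.
rewrite (exchange_big_dep predT) //; apply: eq_bigr => m' _ /=; case: ifPn => Dm'; last first.
  by rewrite big_pred0 // => m; apply: contraNF Dm' => /eqP->.
have [fm|fm] := eqVneq (f (t' m')) 0.
  by rewrite fm big1 // => m /eqP e; rewrite e t'K in fm.
have [lt_m _] := supp _ fm.
rewrite (eq_bigl (pred1 (BMultinom lt_m))) ?big_pred1_eq // => m.
by apply/eqP/eqP => [e|->]; [apply: val_inj; rewrite /= e t'K | rewrite /= tK].
Qed.

Lemma bmsum_widen b b' f :
  (forall m, f m != 0 -> (mdeg m < b)%N /\ (mdeg m < b')%N) ->
  \sum_(m : 'X_{1..n < b}) f m = \sum_(m : 'X_{1..n < b'}) f m.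
Proof. by move=> H; rewrite (@bmsum_reindex b b' f id id predT). Qed.

Lemma bmsum_shift b b' f e :
  (forall m, f m != 0 -> (mdeg m < b)%N /\ (mdeg m + mdeg e < b')%N) ->
  \sum_(m : 'X_{1..n < b}) f m =
  \sum_(m : 'X_{1..n < b'}) (if (e <= m)%MM then f (m - e)%MM else 0).
Proof.
move=> H; apply: (@bmsum_reindex b b' f (fun m => m + e)%MM (fun m => m - e)%MM (fun m => (e <= m)%MM)).
- by move=> m; apply: submK.
- by move=> m; rewrite addmK.
- by move=> m; apply: lem_addl.
- by move=> m /H; rewrite mdegD.
Qed.
End FiniteSupport.

(** * Polynomials defined by the branching rule *)

Section BranchingPolynomial.
Variables (F : fieldType) (Q : F) (k : nat).

Definition mcoord n (m : 'X_{1..n}) : 'I_n -> int := fun i => (m i)%:Z - (k * i)%:Z.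

Fixpoint branching_poly n : 'X_{1..n} -> {mpoly F[n]} :=
  match n with
  | 0 => fun=> 1
  | p.+1 => fun la =>
      \sum_(mu : 'X_{1..p < (mdeg la).+1})
        psi0 Q k (mcoord la) (mcoord mu) *:
          (mwiden (branching_poly mu) * 'X_ord_max ^+ (mdeg la - mdeg mu))
  end.

Lemma eq_psi0 n (x x' : 'I_n.+1 -> int) (y y' : 'I_n -> int) :
  x =1 x' -> y =1 y' -> psi0 Q k x y = psi0 Q k x' y'.
Proof.
move=> ex ey; have eN : psi_num Q k x y = psi_num Q k x' y'.
  by apply: eq_bigr => i _; apply: eq_bigr => j _; rewrite ex ey.
have eV : psi_denV Q k y = psi_denV Q k y'.
  by apply: eq_bigr => i _; apply: eq_bigr => j _; rewrite !ey.
have eX : psi_denX Q k x = psi_denX Q k x'.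
  by apply: eq_bigr => i _; apply: eq_bigr => j _; rewrite !ex.
rewrite /psi0 eN eV eX; congr (if _ then _ else _).
by apply: eq_forallb => j; rewrite !ex ey.
Qed.

Lemma eq_pieri n (x x' : 'I_n -> int) I : x =1 x' -> pieri Q k x I = pieri Q k x' I.
Proof. by move=> ex; apply: eq_bigr => i _; apply: eq_bigr => j _; rewrite !ex. Qed.

Lemma mcoord_addE n (m : 'X_{1..n}) I : mcoord (m + mesym1 I)%MM =1 shift (mcoord m) I 1.
Proof.
by move=> i; rewrite /shift /mcoord mnmDE mnmE; case: (i \in I); rewrite ?addn0 //; lia.
Qed.

Lemma mcoord_subE n (m : 'X_{1..n}) I : (mesym1 I <= m)%MM ->
  mcoord (m - mesym1 I)%MM =1 shift (mcoord m) I (-1).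
Proof.
move=> /mnm_lepP le i; have := le i; rewrite /shift /mcoord mnmBE !mnmE.
by case: (i \in I); rewrite ?subn0 //; lia.
Qed.

Lemma kinterlace_mcoordP n (la : 'X_{1..n.+1}) (mu : 'X_{1..n}) :
  reflect (forall j : 'I_n, (la (lift ord0 j) <= mu j <= la (widen_ord (leqnSn n) j))%N)
    (kinterlace k (mcoord la) (mcoord mu)).
Proof.
apply: (iffP forallP) => H j; have := H j; rewrite /mcoord /= /bump leq0n add1n mulnS.
  by move=> ?; apply/andP; split; lia.
by case/andP=> *; apply/andP; split; lia.
Qed.

Lemma interlace_mdeg n (la : 'X_{1..n.+1}) (mu : 'X_{1..n}) :
  kinterlace k (mcoord la) (mcoord mu) -> (mdeg mu <= mdeg la)%N.
Proof.
move=> /kinterlace_mcoordP H; rewrite !mdegE big_ord_recr /= (leq_trans _ (leq_addr _ _)) //.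
by apply: leq_sum => j _; case/andP: (H j).
Qed.

Lemma psi0_neq0_interlace n (x : 'I_n.+1 -> int) (y : 'I_n -> int) :
  psi0 Q k x y != 0 -> kinterlace k x y.
Proof. by rewrite /psi0; case: ifP => // _; rewrite eqxx. Qed.

Lemma meval_mwiden n (p : {mpoly F[n]}) (v : 'I_n.+1 -> F) :
  (mwiden p).@[v] = p.@[fun i => v (widen_ord (leqnSn n) i)].
Proof.
rewrite [RHS]mevalE {1}(mpolyE p) [mwiden _]raddf_sum raddf_sum; apply: eq_bigr => m _.
rewrite /= mwidenZ mwidenX mevalZ mevalX big_ord_recr /= mnmwiden_ordmax expr0 mulr1.
by congr (_ * _); apply: eq_bigr => i _; rewrite mnmwiden_widen.
Qed.

Definition vwid n (v : 'I_n.+1 -> F) : 'I_n -> F := fun i => v (widen_ord (leqnSn n) i).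

Lemma branching_polyE n b (la : 'X_{1..n.+1}) (v : 'I_n.+1 -> F) :
  (mdeg la < b)%N -> v ord_max != 0 ->
  (branching_poly la).@[v] =
  \sum_(mu : 'X_{1..n < b}) psi0 Q k (mcoord la) (mcoord mu) *
     (v ord_max ^ ((mdeg la)%:Z - (mdeg mu)%:Z) * (branching_poly mu).@[vwid v]).
Proof.
move=> ltb v0; rewrite raddf_sum /=.
rewrite (bmsum_widen (b' := b) (f := fun mu => (psi0 Q k (mcoord la) (mcoord mu) *:
          (mwiden (branching_poly mu) * 'X_ord_max ^+ (mdeg la - mdeg mu))).@[v])); last first.
  move=> mu; have [->|/psi0_neq0_interlace/interlace_mdeg le _] := eqVneq (psi0 Q k (mcoord la) (mcoord mu)) 0.
    by rewrite scale0r meval0 eqxx.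
  by rewrite ltnS le (leq_ltn_trans le).
apply: eq_bigr => mu _; rewrite mevalZ.
have [->|/psi0_neq0_interlace/interlace_mdeg le] := eqVneq (psi0 Q k (mcoord la) (mcoord mu)) 0.
  by rewrite !mul0r.
congr (_ * _); rewrite mevalM meval_mwiden mulrC rmorphXn /= mevalXU; congr (_ * _).
by rewrite subzn.
Qed.
End BranchingPolynomial.

(** * Pieri formula and first Macdonald operator *)

Section PieriFormula.
Variables (F : fieldType) (Q : F) (k : nat).
Hypotheses (ch : [pchar F] =i pred0).
Hypotheses (Q0 : Q != 0) (Qgen : forall m, (0 < m)%N -> Q ^+ m != 1) (k0 : (0 < k)%N).
Local Notation R := (branching_poly Q k).
Local Notation crd := (mcoord k).

Lemma card_set_ord n (J : {set 'I_n}) : (#|J| <= n)%N.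
Proof. by rewrite -[leqRHS]card_ord max_card. Qed.

Lemma psi0_shift_neg n (la : 'X_{1..n.+1}) (nu : 'X_{1..n}) J : ~~ (mesym1 J <= nu)%MM ->
  psi0 Q k (crd la) (shift (crd nu) J (-1)) = 0.
Proof.
move=> nle; rewrite /psi0; case: ifP => // /kinterlaceP H; case/negP: nle; apply/mnm_lepP => j.
rewrite mnmE; case: (boolP (j \in J)) => // jJ; have := H j; rewrite /shift jJ /mcoord /=.
by rewrite /bump leq0n add1n mulnS => /andP[]; lia.
Qed.

(* Expands [sum_mu sum_J] along [nu = mu + e_J]. *)
Lemma sum_interlace_shift n (la : 'X_{1..n.+1}) b (v : 'I_n -> F) (y : F) (G : {set 'I_n} -> ('I_n -> int) -> F) :
  (mdeg la + n < b)%N -> y != 0 ->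
  \sum_(mu : 'X_{1..n < b}) psi0 Q k (crd la) (crd mu) * (y ^ ((mdeg la)%:Z - (mdeg mu)%:Z) *
    \sum_(J : {set 'I_n}) pieri Q k (crd mu) J * G J (crd (mu + mesym1 J)%MM) * (R (mu + mesym1 J)%MM).@[v]) =
  \sum_(nu : 'X_{1..n < b}) y ^ ((mdeg la)%:Z - (mdeg nu)%:Z) * (R nu).@[v] *
    \sum_(J : {set 'I_n}) y ^+ #|J| *
      (psi0 Q k (crd la) (shift (crd nu) J (-1)) * pieri Q k (shift (crd nu) J (-1)) J) * G J (crd nu).
Proof.
move=> lt_b y0.
pose f J (mu : 'X_{1..n}) := psi0 Q k (crd la) (crd mu) * (y ^ ((mdeg la)%:Z - (mdeg mu)%:Z) *
  (pieri Q k (crd mu) J * G J (crd (mu + mesym1 J)%MM) * (R (mu + mesym1 J)%MM).@[v])).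
transitivity (\sum_(J : {set 'I_n}) \sum_(mu : 'X_{1..n < b}) f J mu).
  by rewrite exchange_big; apply: eq_bigr => mu _; rewrite !mulr_sumr; apply: eq_bigr.
transitivity (\sum_(J : {set 'I_n}) \sum_(nu : 'X_{1..n < b})
    (if (mesym1 J <= nu)%MM then f J (nu - mesym1 J)%MM else 0)).
  apply: eq_bigr => J _; apply: bmsum_shift => mu; rewrite /f mulf_eq0 negb_or => /andP[+ _].
  move=> /psi0_neq0_interlace/interlace_mdeg le; rewrite mdeg_mesym1.
  by have := card_set_ord J; lia.
rewrite exchange_big; apply: eq_bigr => nu _; rewrite mulr_sumr; apply: eq_bigr => J _.
case: ifPn => le; last by rewrite psi0_shift_neg // mul0r mulr0 mul0r mulr0.
rewrite /f submK // (eq_psi0 _ _ (fun=> erefl) (mcoord_subE k le)) (eq_pieri _ _ _ (mcoord_subE k le)).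
have -> : (mdeg la)%:Z - (mdeg (nu - mesym1 J))%:Z = (mdeg la)%:Z - (mdeg nu)%:Z + #|J|%:Z.
  have := congr1 (@mdeg n) (submK le); rewrite mdegD mdeg_mesym1; lia.
by rewrite expfzDr // -exprnP; ring.
Qed.

Theorem branching_poly_pieri n (la : 'X_{1..n}) (v : 'I_n -> F) (w : F) :
  kdominant k (crd la) -> (forall i, v i != 0) ->
  (\prod_(i < n) (w + v i)) * (R la).@[v] =
  \sum_(I : {set 'I_n}) w ^+ #|~: I| * pieri Q k (crd la) I * (R (la + mesym1 I)%MM).@[v].
Proof.
elim: n => [|n IHn] in la v *.
  move=> _ _; rewrite (big_pred1 set0) => [|I]; last by apply/esym/eqP/setP => -[].
  by rewrite /pieri !big_ord0 /= !meval1 setC0 cardsT card_ord !mulr1.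
move=> dla v0; pose b := (mdeg la + n.+2)%N; have y0 := v0 ord_max.
have vw0 i : vwid v i != 0 by exact: v0.
rewrite (branching_polyE Q k (b := b)) //; last by rewrite /b; lia.
rewrite big_ord_recr /= mulrAC mulr_sumr.
rewrite [X in X * _](eq_bigr (fun mu : 'X_{1..n < b} => psi0 Q k (crd la) (crd mu) *
   (v ord_max ^ ((mdeg la)%:Z - (mdeg mu)%:Z) * \sum_(J : {set 'I_n}) pieri Q k (crd mu) J *
     w ^+ #|~: J| * (R (mu + mesym1 J)%MM).@[vwid v]))); last first.
  move=> mu _; have [->|/psi0_neq0_interlace im] := eqVneq (psi0 Q k (crd la) (crd mu)) 0.
    by rewrite !mul0r mulr0.
  rewrite mulrCA; congr (_ * _); rewrite mulrCA IHn //; last exact: kinterlace_dominantV im.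
  by congr (_ * _); apply: eq_bigr => J _; congr (_ * _); rewrite mulrC.
rewrite (sum_interlace_shift (vwid v) (fun J _ => w ^+ #|~: J|)) //; last by rewrite /b; lia.
rewrite [RHS](eq_bigr (fun I : {set 'I_n.+1} => \sum_(nu : 'X_{1..n < b})
   (v ord_max ^ ((mdeg la)%:Z - (mdeg nu)%:Z) * (R nu).@[vwid v]) *
   (w ^+ #|~: I| * v ord_max ^+ #|I| * (pieri Q k (crd la) I * psi0 Q k (shift (crd la) I 1) (crd nu))))); last first.
  move=> I _; rewrite (branching_polyE Q k (b := b)) //; last first.
    by rewrite mdegD mdeg_mesym1 /b; have := card_set_ord I; lia.
  rewrite mulr_sumr; apply: eq_bigr => nu _.
  rewrite (eq_psi0 _ _ (mcoord_addE k la I) (fun=> erefl)) mdegD mdeg_mesym1.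
  have -> : (mdeg la + #|I|)%N%:Z - (mdeg nu)%:Z = (mdeg la)%:Z - (mdeg nu)%:Z + #|I|%:Z by lia.
  by rewrite expfzDr // -exprnP; ring.
rewrite exchange_big mulr_suml; apply: eq_bigr => nu _; rewrite -mulr_sumr.
have [/(_ w (v ord_max)) -> _] := branching_identities ch Q0 Qgen k0 (crd nu) dla.
by rewrite [LHS]mulrAC [RHS]mulrA; congr (_ * _); apply: eq_bigr => J _; ring.
Qed.
End PieriFormula.

Section FirstOperator.
Variables (F : fieldType) (Q : F) (k : nat).
Hypotheses (ch : [pchar F] =i pred0).
Hypotheses (Q0 : Q != 0) (Qgen : forall m, (0 < m)%N -> Q ^+ m != 1) (k0 : (0 < k)%N).
Local Notation R := (branching_poly Q k).
Local Notation crd := (mcoord k).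
Local Notation T := (qT Q k).
Local Notation s := (qs Q k).

Definition scale_on n (I : {set 'I_n}) (v : 'I_n -> F) : 'I_n -> F :=
  fun i => if i \in I then Q * v i else v i.

Lemma scale_on_neq0 n (I : {set 'I_n}) (v : 'I_n -> F) :
  (forall i, v i != 0) -> forall i, scale_on I v i != 0.
Proof. by move=> v0 i; rewrite /scale_on; case: ifP => _; rewrite ?mulf_neq0. Qed.

Lemma branching_poly_pieriN n (la : 'X_{1..n}) (v : 'I_n -> F) (z : F) :
  kdominant k (crd la) -> (forall i, v i != 0) ->
  (\prod_(i < n) (z - v i)) * (R la).@[v] =
  \sum_(J : {set 'I_n}) (-1) ^+ #|J| * z ^+ #|~: J| *
     (pieri Q k (crd la) J * (R (la + mesym1 J)%MM).@[v]).
Proof.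
move=> dla v0.
have -> : \prod_(i < n) (z - v i) = (-1) ^+ n * \prod_(i < n) (- z + v i).
  have en : (-1) ^+ n = \prod_(i < n) (-1 : F) by rewrite prodr_const card_ord.
  by rewrite en -big_split; apply: eq_bigr => i _ /=; ring.
rewrite -mulrA (branching_poly_pieri ch) // mulr_sumr; apply: eq_bigr => J _.
have -> : (-1) ^+ n = (-1) ^+ #|J| * (-1) ^+ #|~: J| :> F.
  by rewrite -exprD cardsC card_ord.
have -> : (- z) ^+ #|~: J| = (-1) ^+ #|~: J| * z ^+ #|~: J| by rewrite -exprMn mulN1r.
have e : (-1) ^+ #|~: J| * (-1) ^+ #|~: J| = 1 :> F by rewrite -exprMn mulrNN mulr1 expr1n.
transitivity ((-1) ^+ #|~: J| * (-1) ^+ #|~: J| * ((-1) ^+ #|J| * z ^+ #|~: J| *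
  (pieri Q k (crd la) J * (R (la + mesym1 J)%MM).@[v]))); first by ring.
by rewrite e mul1r.
Qed.

Lemma prod_xi_ratio n (la : 'X_{1..n.+1}) (mu : 'X_{1..n}) :
  T ^+ n * (\prod_i xi Q (crd la) i) / (\prod_j xi Q (crd mu) j) =
  Q ^ ((mdeg la)%:Z - (mdeg mu)%:Z).
Proof.
have xE p (m : 'X_{1..p}) i : xi Q (crd m) i = Q ^+ m i * Q ^ (- (k * i)%N%:Z).
  by rewrite /xi /mcoord expfzDr.
have pE p (m : 'X_{1..p}) :
    \prod_i xi Q (crd m) i = Q ^+ mdeg m * \prod_(i < p) Q ^ (- (k * i)%N%:Z).
  by rewrite (eq_bigr _ (fun i _ => xE p m i)) big_split /= prodrXr mdegE.
have P0 : \prod_(i < n) Q ^ (- (k * i)%N%:Z) != 0.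
  by apply/prodf_neq0 => i _; apply: expfz_neq0.
rewrite !pE big_ord_recr /= expfzDr // -(invr_expz Q (mdeg mu)%:Z).
have -> : Q ^ (- (k * n)%N%:Z) = (T ^+ n)^-1 by rewrite -invr_expz /qT -exprnP -exprM.
have T0 : T ^+ n != 0 by rewrite expf_neq0 // expfz_neq0.
rewrite -!exprnP; move: (\prod_(i < n) _) (T ^+ n) P0 T0 => P U P0 U0.
by field; rewrite P0 U0 expf_neq0.
Qed.

Lemma sum_xi_shift n (mu : 'X_{1..n}) J :
  \sum_j xi Q (crd (mu + mesym1 J)%MM) j - (1 - Q^-1) * (\sum_(j in J) xi Q (crd (mu + mesym1 J)%MM) j)
  = \sum_j xi Q (crd mu) j.
Proof.
rewrite [X in _ - _ * X]big_mkcond mulr_sumr -sumrB; apply: eq_bigr => j _.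
rewrite /xi mcoord_addE /shift; case: (j \in J); last by rewrite mulr0 subr0.
by rewrite expfzDr // expr1z; field.
Qed.

Lemma prod_xi_shift n (mu : 'X_{1..n}) J :
  \prod_j xi Q (crd (mu + mesym1 J)%MM) j = Q ^+ #|J| * \prod_j xi Q (crd mu) j.
Proof.
rewrite -prodr_const [X in X * _]big_mkcond -big_split /=; apply: eq_bigr => j _.
rewrite /xi mcoord_addE /shift; case: (j \in J); last by rewrite mul1r.
by rewrite expfzDr // expr1z mulrC.
Qed.

Definition eigen1 n (la : 'X_{1..n}) : F := T ^+ n / T * \sum_i xi Q (crd la) i.

Lemma Q_neq1 : Q - 1 != 0.
Proof. by rewrite subr_eq0 -[Q]expr1; apply: Qgen. Qed.

Local Notation al := ((T - 1) / (Q - 1)).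
Local Notation be := ((Q - T) / (Q - 1)).

Lemma eigen_bracket n (la : 'X_{1..n.+1}) (mu : 'X_{1..n}) J :
  al * eigen1 (mu + mesym1 J)%MM + be * eigen1 mu +
    Q ^ ((mdeg la)%:Z - (mdeg mu)%:Z) * T ^+ #|~: J| - eigen1 la =
  T ^+ n / (s * T) * vbracket s T (xi Q (crd la)) (xi Q (crd (mu + mesym1 J)%MM)) setT setT J.
Proof.
rewrite /eigen1 /vbracket -(sum_xi_shift mu J) -prod_xi_ratio.
have setTE p (f : 'I_p -> F) : \sum_(j in setT) f j = \sum_j f j.
  by apply: eq_bigl => j; rewrite inE.
have setTE' p (f : 'I_p -> F) : \prod_(j in setT) f j = \prod_j f j.
  by apply: eq_bigl => j; rewrite inE.
rewrite !setTE !setTE' cardsT card_ord (prod_xi_shift mu J).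
set SV := \sum_j xi Q (crd (mu + _)%MM) j; set SJ := \sum_(j in J) _.
set SX := \sum_i _; set PX := \prod_i _; set PV := \prod_j _.
have eT : T ^+ #|~: J| * T ^+ #|J| = T ^+ n by rewrite -exprD addnC cardsC card_ord.
have PV0 : PV != 0 by apply/prodf_neq0 => i _; apply: xi_neq0.
have T0 : T != 0 by apply: expfz_neq0.
have s0 : s != 0 by apply: expfz_neq0.
have QE : Q = s * T by rewrite sT.
have Q1 := Q_neq1.
have eQ : Q ^+ #|J| = s ^+ #|J| * T ^+ #|J| by rewrite -exprMn sT.
have TJ0 : T ^+ #|J| != 0 by rewrite expf_neq0.
have sJ0 : s ^+ #|J| != 0 by rewrite expf_neq0.
clearbody SV SJ SX PX PV; rewrite !exprS eQ -eT.
move: (T ^+ #|J|) (T ^+ #|~: J|) (s ^+ #|J|) TJ0 sJ0 => t u r t0 r0.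
move: (T) (s) T0 s0 QE Q1 => T' s' T0 s0 QE; rewrite QE => Q1.
by field; rewrite T0 s0 PV0 r0 t0 Q1.
Qed.

Definition mac1 n (f : ('I_n -> F) -> F) (v : 'I_n -> F) : F :=
  \sum_(i < n) (\prod_(j < n | j != i) ((T * v i - v j) / (v i - v j))) * f (scale_on [set i] v).

Lemma scale_on_max n (v : 'I_n.+1 -> F) :
  vwid (scale_on [set ord_max] v) =1 vwid v /\ scale_on [set ord_max] v ord_max = Q * v ord_max.
Proof.
split; last by rewrite /scale_on set11.
move=> i; rewrite /vwid /scale_on inE; case: eqP => // /(congr1 val) /= e.
by have := ltn_ord i; rewrite e ltnn.
Qed.

Lemma scale_on_widen n (v : 'I_n.+1 -> F) (i : 'I_n) :
  vwid (scale_on [set widen_ord (leqnSn n) i] v) =1 scale_on [set i] (vwid v) /\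
  scale_on [set widen_ord (leqnSn n) i] v ord_max = v ord_max.
Proof.
split; first by move=> j; rewrite /vwid /scale_on !inE -!val_eqE.
rewrite /scale_on inE; case: eqP => // /(congr1 val) /= e.
by have := ltn_ord i; rewrite -e ltnn.
Qed.

Lemma mac1_recr n (f : ('I_n.+1 -> F) -> F) (v : 'I_n.+1 -> F) : injective v ->
  (\prod_(j < n) (v ord_max - vwid v j)) * mac1 f v =
  \sum_(i < n) (\prod_(j < n | j != i) ((T * vwid v i - vwid v j) / (vwid v i - vwid v j))) *
     ((al * (\prod_(j < n) (v ord_max - scale_on [set i] (vwid v) j)) +
       be * \prod_(j < n) (v ord_max - vwid v j)) *
      f (scale_on [set widen_ord (leqnSn n) i] v)) +
  (\prod_(j < n) (T * v ord_max - vwid v j)) * f (scale_on [set ord_max] v).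
Proof.
move=> iv.
have max_neq (j : 'I_n) : v ord_max - vwid v j != 0.
  rewrite subr_eq0; apply/eqP => /iv /(congr1 val) /= e.
  by have := ltn_ord j; rewrite -e ltnn.
rewrite /mac1 big_ord_recr /= mulrDr; congr (_ + _); last first.
  rewrite mulrA; congr (_ * _); rewrite [X in _ * X]big_mkcond big_ord_recr /= eqxx mulr1 -big_split.
  apply: eq_bigr => j _ /=; rewrite ifT; last by rewrite -val_eqE /= ltn_eqF.
  by rewrite mulrC divfK //; apply: max_neq.
rewrite mulr_sumr; apply: eq_bigr => i _; rewrite mulrA [RHS]mulrA; congr (_ * _).
rewrite [X in _ * X]big_mkcond big_ord_recr /= ifT; last by rewrite -val_eqE /= eq_sym ltn_eqF.
rewrite [v (widen_ord _ i)]/(vwid v i).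
rewrite [X in _ * (X * _)](_ : _ =
  \prod_(j < n | j != i) ((T * vwid v i - vwid v j) / (vwid v i - vwid v j))); last first.
  by rewrite [RHS]big_mkcond; apply: eq_bigr => j _; rewrite -!val_eqE.
rewrite mulrCA; congr (_ * _).
set D := \prod_(j < n) (v ord_max - vwid v j).
have -> : D = (v ord_max - vwid v i) * \prod_(j < n | j != i) (v ord_max - vwid v j).
  by rewrite /D (bigD1 i).
have -> : \prod_(j < n) (v ord_max - scale_on [set i] (vwid v) j) =
    (v ord_max - Q * vwid v i) * \prod_(j < n | j != i) (v ord_max - vwid v j).
  rewrite (bigD1 i) //= {1}/scale_on set11; congr (_ * _).
  by apply: eq_bigr => j ji; rewrite /scale_on inE (negPf ji).
have Q1 := Q_neq1; have mi := max_neq i.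
have mi' : vwid v i - v ord_max != 0 by rewrite -opprB oppr_eq0.
by rewrite -![v (widen_ord _ _)]/(vwid v i); field; rewrite mi' Q1.
Qed.

Lemma vwid_inj n (v : 'I_n.+1 -> F) : injective v -> injective (vwid v).
Proof. by move=> iv i j /iv /(congr1 val) /= /val_inj. Qed.

Theorem branching_poly_mac1 n (la : 'X_{1..n}) (v : 'I_n -> F) :
  kdominant k (crd la) -> (forall i, v i != 0) -> injective v ->
  mac1 (fun u => (R la).@[u]) v = eigen1 la * (R la).@[v].
Proof.
elim: n => [|n IHn] in la v *.
  by move=> _ _ _; rewrite /mac1 /eigen1 !big_ord0 mulr0 mul0r.
move=> dla v0 iv; pose b := (mdeg la + n.+2)%N; have y0 := v0 ord_max.
have vw0 i : vwid v i != 0 by exact: v0.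
set y := v ord_max in y0 *.
pose E := \prod_(j < n) (y - vwid v j).
have E0 : E != 0.
  apply/prodf_neq0 => j _; rewrite subr_eq0; apply/eqP => /iv /(congr1 val) /= e.
  by have := ltn_ord j; rewrite -e ltnn.
have lt_b : (mdeg la < b)%N by rewrite /b; lia.
apply: (mulfI E0); rewrite mac1_recr // -/y -/E.
pose W (mu : 'X_{1..n < b}) := psi0 Q k (crd la) (crd mu) * y ^ ((mdeg la)%:Z - (mdeg mu)%:Z).
have RE : (R la).@[v] = \sum_(mu : 'X_{1..n < b}) W mu * (R mu).@[vwid v].
  by rewrite (branching_polyE Q k lt_b y0); apply: eq_bigr => mu _; rewrite mulrA.
have RW i : (R la).@[scale_on [set widen_ord (leqnSn n) i] v] =
    \sum_(mu : 'X_{1..n < b}) W mu * (R mu).@[scale_on [set i] (vwid v)].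
  have [e1 e2] := scale_on_widen v i.
  rewrite (branching_polyE Q k lt_b); last by rewrite e2.
  by apply: eq_bigr => mu _; rewrite mulrA e2 (meval_eq _ e1).
have RM : (R la).@[scale_on [set ord_max] v] =
    \sum_(mu : 'X_{1..n < b}) W mu * (Q ^ ((mdeg la)%:Z - (mdeg mu)%:Z) * (R mu).@[vwid v]).
  have [e1 e2] := scale_on_max v.
  rewrite (branching_polyE Q k lt_b); last by rewrite e2 mulf_neq0.
  by apply: eq_bigr => mu _; rewrite e2 (meval_eq _ e1) expfzMl /W; ring.
rewrite RM RE; under eq_bigr => i _ do rewrite RW.
have -> : E * (eigen1 la * \sum_(mu : 'X_{1..n < b}) W mu * (R mu).@[vwid v]) =
    \sum_(mu : 'X_{1..n < b}) W mu * (eigen1 la * (E * (R mu).@[vwid v])).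
  by rewrite mulrA mulr_sumr; apply: eq_bigr => mu _; ring.
apply/eqP; rewrite -subr_eq0; apply/eqP.
transitivity (\sum_(mu : 'X_{1..n < b}) psi0 Q k (crd la) (crd mu) *
  (y ^ ((mdeg la)%:Z - (mdeg mu)%:Z) * \sum_(J : {set 'I_n}) pieri Q k (crd mu) J *
    ((-1) ^+ #|J| * y ^+ #|~: J| * (T ^+ n / (s * T) *
      vbracket s T (xi Q (crd la)) (xi Q (crd (mu + mesym1 J)%MM)) setT setT J)) *
     (R (mu + mesym1 J)%MM).@[vwid v])).
  have -> : \sum_(i < n) (\prod_(j < n | j != i) ((T * vwid v i - vwid v j) / (vwid v i - vwid v j))) *
     ((al * \prod_(j < n) (y - scale_on [set i] (vwid v) j) + be * E) *
      \sum_(mu : 'X_{1..n < b}) W mu * (R mu).@[scale_on [set i] (vwid v)]) =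
    \sum_(mu : 'X_{1..n < b}) W mu * (al * mac1 (fun u => (\prod_(j < n) (y - u j)) * (R mu).@[u]) (vwid v) +
      be * E * mac1 (fun u => (R mu).@[u]) (vwid v)).
    under eq_bigr => i _ do rewrite mulr_sumr mulr_sumr.
    rewrite exchange_big; apply: eq_bigr => mu _.
    rewrite /mac1 !mulr_sumr -big_split /= mulr_sumr; apply: eq_bigr => i _; ring.
  rewrite mulr_sumr -sumrN -!big_split /=; apply: eq_bigr => mu _.
  rewrite /W; have [->|/psi0_neq0_interlace im] := eqVneq (psi0 Q k (crd la) (crd mu)) 0.
    by rewrite !mul0r mulr0 subr0 addr0.
  have dmu := kinterlace_dominantV im.
  have e1 : mac1 (fun u => (\prod_(j < n) (y - u j)) * (R mu).@[u]) (vwid v) =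
      \sum_(J : {set 'I_n}) (-1) ^+ #|J| * y ^+ #|~: J| *
        (pieri Q k (crd mu) J * (eigen1 (mu + mesym1 J)%MM * (R (mu + mesym1 J)%MM).@[vwid v])).
    rewrite /mac1; under eq_bigr => i _.
      rewrite (branching_poly_pieriN y dmu); last by apply: scale_on_neq0.
      rewrite mulr_sumr; over.
    rewrite exchange_big; apply: eq_bigr => J _ /=.
    case: (boolP (kdominant k (shift (crd mu) J 1))) => dJ; last first.
      by rewrite (pieri_nondominant _ dmu dJ) mul0r mulr0 big1 // => i _; rewrite mul0r !mulr0.
    rewrite -IHn //; last exact: vwid_inj; last by rewrite (eq_kdominant _ (mcoord_addE k mu J)).
    by rewrite /mac1 !mulr_sumr; apply: eq_bigr => i _; ring.
  have e2 := branching_poly_pieriN y dmu vw0.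
  have e3 := branching_poly_pieriN (T * y) dmu vw0.
  rewrite e1 IHn //; last exact: vwid_inj.
  transitivity (psi0 Q k (crd la) (crd mu) * y ^ ((mdeg la)%:Z - (mdeg mu)%:Z) *
     (al * (\sum_(J : {set 'I_n}) (-1) ^+ #|J| * y ^+ #|~: J| *
        (pieri Q k (crd mu) J * (eigen1 (mu + mesym1 J)%MM * (R (mu + mesym1 J)%MM).@[vwid v]))) +
      be * eigen1 mu * (E * (R mu).@[vwid v]) +
      Q ^ ((mdeg la)%:Z - (mdeg mu)%:Z) * ((\prod_(j < n) (T * y - vwid v j)) * (R mu).@[vwid v]) -
      eigen1 la * (E * (R mu).@[vwid v]))); first by ring.
  rewrite e2 e3 -[LHS]mulrA; do 2!congr (_ * _).
  rewrite !mulr_sumr -sumrN -!big_split /=; apply: eq_bigr => J _.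
  by rewrite -eigen_bracket exprMn; ring.
rewrite (sum_interlace_shift Q0 k0 (vwid v) (fun J yv => (-1) ^+ #|J| * y ^+ #|~: J| * (T ^+ n / (s * T) *
      vbracket s T (xi Q (crd la)) (xi Q yv) setT setT J))) //; last by rewrite /b; lia.
apply: big1 => nu _; rewrite [X in _ * X](_ : _ = 0) ?mulr0 //.
have [_ e] := branching_identities ch Q0 Qgen k0 (crd nu) dla.
rewrite -[RHS](mulr0 (y ^+ n * (T ^+ n / (s * T)))) -[X in _ = _ * X]e mulr_sumr.
apply: eq_bigr => J _; have -> : y ^+ n = y ^+ #|J| * y ^+ #|~: J|.
  by rewrite -exprD cardsC card_ord.
by ring.
Qed.
End FirstOperator.

Section Density.
Variable F : fieldType.
Hypothesis ch : [pchar F] =i pred0.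

Lemma poly_fun_eq0 (p : {poly F}) : (forall w, p.[w] = 0) -> p = 0.
Proof.
move=> p0; pose rs : seq F := [seq n%:R | n <- iota 0 (size p)].
apply: (roots_geq_poly_eq0 (rs := rs)).
- by apply/allP => r _; rewrite rootE p0.
- by rewrite map_inj_uniq ?iota_uniq //; apply: natr_inj_pchar0.
- by rewrite size_map size_iota.
Qed.

Definition mrestr n (m : 'X_{1..n.+1}) : 'X_{1..n} := [multinom m (widen_ord (leqnSn n) i) | i < n].

Lemma mrestrE n (m : 'X_{1..n.+1}) i : mrestr m i = m (widen_ord (leqnSn n) i).
Proof. exact: mnmE. Qed.

Lemma mrestr_eq n (m m' : 'X_{1..n.+1}) :
  (m == m') = (mrestr m == mrestr m') && (m ord_max == m' ord_max).
Proof.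
apply/eqP/andP => [->|[/eqP/mnmP e /eqP em]]; first by rewrite !eqxx.
apply/mnmP => i; case: (unliftP ord_max i) => [j ->|->] //.
have := e j; rewrite !mrestrE; have -> // : widen_ord (leqnSn n) j = lift ord_max j.
by apply: val_inj; rewrite /= /bump leqNgt ltn_ord.
Qed.

Lemma mpoly_fun_eq0 n (p : {mpoly F[n]}) : (forall v, p.@[v] = 0) -> p = 0.
Proof.
elim: n => [|n IHn] in p *.
  move=> p0; rewrite (nvar0_mpolyC p); have := p0 (fun=> 0).
  by rewrite {1}(nvar0_mpolyC p) mevalC => ->; rewrite mpolyC0.
move=> p0; pose pd d := \sum_(m <- msupp p | m ord_max == d) p@_m *: 'X_[mrestr m] : {mpoly F[n]}.
have pd0 d : pd d = 0.
  apply: IHn => v'; pose q := \sum_(m <- msupp p) (p@_m * \prod_(i < n) v' i ^+ mrestr m i) *: 'X^(m ord_max).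
  have q0 : q = 0.
    apply: poly_fun_eq0 => w; pose v (i : 'I_n.+1) := if unlift ord_max i is Some j then v' j else w.
    rewrite -[RHS](p0 v) mevalE horner_sum; apply: eq_bigr => m _.
    rewrite hornerZ hornerXn big_ord_recr /= /v unlift_none mulrA; congr (_ * _ * _).
    apply: eq_bigr => i _; have -> : widen_ord (leqnSn n) i = lift ord_max i.
      by apply: val_inj; rewrite /= /bump leqNgt ltn_ord.
    rewrite liftK mrestrE; congr (_ ^+ m _).
    by apply: val_inj; rewrite /= /bump leqNgt ltn_ord.
  have := congr1 (fun r : {poly F} => r`_d) q0; rewrite coef0 coef_sum => <-.
  rewrite raddf_sum big_mkcond /=; apply: eq_bigr => m _.
  rewrite coefZ coefXn eq_sym; case: eqP => _; last by rewrite mulr0.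
  by rewrite mevalZ mevalX mulr1.
apply/mpolyP => m0; rewrite mcoeff0; apply/eqP; rewrite mcoeff_eq0; apply/negP => m0p.
have := congr1 (mcoeff (mrestr m0)) (pd0 (m0 ord_max)); rewrite mcoeff0 raddf_sum /=.
rewrite big_mkcond (bigD1_seq m0) ?msupp_uniq //= eqxx mcoeffZ mcoeffX eqxx mulr1.
rewrite big1 ?addr0 => [e|m nm]; first by move: m0p; rewrite mcoeff_msupp e eqxx.
case: eqP => // em; rewrite mcoeffZ mcoeffX; move: nm.
by rewrite mrestr_eq em eqxx andbT => /negPf->; rewrite mulr0.
Qed.

Lemma mpoly_dense n (p h : {mpoly F[n]}) : h != 0 ->
  (forall v, h.@[v] != 0 -> p.@[v] = 0) -> p = 0.
Proof.
move=> h0 ph; have : p * h = 0.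
  apply: mpoly_fun_eq0 => v; rewrite mevalM; have [->|/ph->] := eqVneq h.@[v] 0.
    by rewrite mulr0.
  by rewrite mul0r.
by move/eqP; rewrite mulf_eq0 (negPf h0) orbF => /eqP.
Qed.
End Density.

Definition partition_mnm n (m : 'X_{1..n}) := forall i j : 'I_n, (i <= j)%N -> (m j <= m i)%N.

Lemma kdominant_partition k n (m : 'X_{1..n}) : kdominant k (mcoord k m) <-> partition_mnm m.
Proof.
split=> [/kdominantP dm i j|pm].
  move: {2}(j - i)%N (erefl (j - i)%N) => d; elim: d => [|d IHd] in j *.
    move=> e ij; have -> // : i = j by apply: val_inj; apply/eqP; rewrite eqn_leq ij -subn_eq0 e.
  move=> e ij; have lt_jn : (j.-1 < n)%N by rewrite (leq_ltn_trans (leq_pred _)).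
  have j0 : (0 < j)%N by lia.
  have := IHd (Ordinal lt_jn) ltac:(simpl; lia) ltac:(simpl; lia).
  have := dm (Ordinal lt_jn) j ltac:(simpl; lia); rewrite /mcoord /=.
  by rewrite -{3}(prednK j0) mulnS; lia.
apply: kdominant_consec => i j ij; have {}ij : nat_of_ord j = i.+1 by [].
by have := pm i j; rewrite /mcoord ij mulnS => /(_ (leqnSn _)); lia.
Qed.

Section Shape.
Variables (F : fieldType) (Q : F) (k : nat).
Hypotheses (ch : [pchar F] =i pred0).
Hypotheses (Q0 : Q != 0) (Qgen : forall m, (0 < m)%N -> Q ^+ m != 1) (k0 : (0 < k)%N).
Local Notation R := (branching_poly Q k).
Local Notation crd := (mcoord k).

Lemma mcoeff_mwidenX n (p : {mpoly F[n]}) d m :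
  (mwiden p * 'X_ord_max ^+ d)@_m = p@_(mrestr m) * (m ord_max == d)%:R.
Proof.
rewrite {1}(mpolyE p) [mwiden _]raddf_sum mulr_suml raddf_sum /=.
have term (m' : 'X_{1..n}) : (mwiden (p@_m' *: 'X_[m']) * 'X_ord_max ^+ d)@_m =
    p@_m' * (m' == mrestr m)%:R * (m ord_max == d)%:R.
  rewrite mwidenZ mwidenX mpolyXn -scalerAl -mpolyXD mcoeffZ mcoeffX mrestr_eq -mulrA; congr (_ * _).
  have -> : mrestr (mnmwiden m' + U_(ord_max) *+ d)%MM = m'.
    apply/mnmP => i; rewrite mrestrE mnmDE mnmwiden_widen mulmnE mnm1E.
    by rewrite -val_eqE /= gtn_eqF // addn0.
  rewrite mnmDE mnmwiden_ordmax mulmnE mnm1E eqxx mul1n eq_sym [d == _]eq_sym.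
  by rewrite [mrestr m == _]eq_sym -natrM mulnb.
rewrite (eq_bigr _ (fun m' _ => term m')) -mulr_suml; congr (_ * _).
case: (boolP (mrestr m \in msupp p)) => [mp|mp].
  rewrite (bigD1_seq _ mp) ?msupp_uniq //= eqxx mulr1 big1 ?addr0 // => m' /negPf->.
  by rewrite mulr0.
rewrite (memN_msupp_eq0 mp) big_seq big1 // => m' m'p.
by rewrite (negPf (memPn mp _ m'p)) mulr0.
Qed.

Lemma branching_poly_coeff n (la : 'X_{1..n.+1}) m :
  (R la)@_m = \sum_(mu : 'X_{1..n < (mdeg la).+1})
    psi0 Q k (crd la) (crd mu) * ((R mu)@_(mrestr m) * (m ord_max == (mdeg la - mdeg mu)%N)%:R).
Proof. by rewrite raddf_sum; apply: eq_bigr => mu _; rewrite /= mcoeffZ mcoeff_mwidenX. Qed.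

Lemma mdeg_mrestr n (m : 'X_{1..n.+1}) : mdeg m = (mdeg (mrestr m) + m ord_max)%N.
Proof. by rewrite !mdegE big_ord_recr /=; congr (_ + _)%N; apply: eq_bigr => i _; rewrite mrestrE. Qed.

Lemma mdeg_prefix n (m : 'X_{1..n.+1}) : (\sum_(i < n.+1 | (i <= @ord_max n)%N) m i = mdeg m)%N.
Proof. by rewrite mdegE; apply: eq_bigl => i; rewrite -ltnS ltn_ord. Qed.

Lemma prefix_mrestr n (m : 'X_{1..n.+1}) (j : 'I_n) :
  (\sum_(i < n.+1 | i <= widen_ord (leqnSn n) j) m i = \sum_(i < n | i <= j) mrestr m i)%N.
Proof.
rewrite big_mkcond big_ord_recr /= leqNgt ltn_ord addn0 [RHS]big_mkcond.
by apply: eq_bigr => i _; rewrite mrestrE.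
Qed.

Lemma branching_poly_dominated n (la : 'X_{1..n}) m : (R la)@_m != 0 -> dominated m la.
Proof.
elim: n => [|n IHn] in la m *.
  move=> _; rewrite /dominated (_ : m = la); last by apply/mnmP => -[].
  by rewrite eqxx; apply/forallP => -[].
rewrite branching_poly_coeff => nz.
have [mu] : exists mu : 'X_{1..n < (mdeg la).+1}, psi0 Q k (crd la) (crd mu) *
    ((R mu)@_(mrestr m) * (m ord_max == (mdeg la - mdeg mu)%N)%:R) != 0.
  apply/existsP; apply: contraNT nz => /existsPn H; rewrite big1 // => mu _.
  by apply/eqP; rewrite -[_ == _]negbK.
rewrite !mulf_eq0 !negb_or => /andP[/psi0_neq0_interlace im /andP[/IHn /andP[/eqP dmu /forallP pmu]]].
case: (m ord_max =P _) => [emax _|_]; last by rewrite eqxx.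
have lemu := interlace_mdeg im.
have dm : mdeg m = mdeg la by rewrite mdeg_mrestr dmu emax subnKC.
rewrite /dominated dm eqxx; apply/forallP => j; case: (unliftP ord_max j) => [j' ->|->].
  have -> : lift ord_max j' = widen_ord (leqnSn n) j'.
    by apply: val_inj; rewrite /= /bump leqNgt ltn_ord.
  rewrite !prefix_mrestr (leq_trans (pmu j')) //; apply: leq_sum => i _; rewrite mrestrE.
  by have /kinterlace_mcoordP/(_ i)/andP[] := im.
by rewrite !mdeg_prefix dm.
Qed.

Lemma psi0_mrestr n (la : 'X_{1..n.+1}) : partition_mnm la ->
  psi0 Q k (crd la) (crd (mrestr la)) = 1.
Proof.
move=> pla; have dla := (kdominant_partition k la).2 pla.
have im : kinterlace k (crd la) (crd (mrestr la)).
  by apply/kinterlace_mcoordP => j; rewrite mrestrE leqnn andbT; apply: pla; rewrite /= /bump leqnSn.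
rewrite /psi0 im; have dmu := kinterlace_dominantV im.
have -> : psi_num Q k (crd la) (crd (mrestr la)) =
    psi_denV Q k (crd (mrestr la)) * psi_denX Q k (crd la).
  have crE i : crd (mrestr la) i = crd la (widen_ord (leqnSn n) i) by rewrite /mcoord mrestrE.
  rewrite /psi_num (eq_bigr (fun i : 'I_n.+1 =>
     (\prod_(j < n | (i <= j)%N) qN Q k (crd la i - crd (mrestr la) j)) *
     \prod_(j < n | (j < i)%N) qN Q k (crd la (widen_ord (leqnSn n) j) - crd la i - k%:Z))); last first.
    move=> i _; rewrite (bigID (fun j : 'I_n => (i <= j)%N)) /=; congr (_ * _).
      by apply: eq_bigr => j ->.
    by apply: eq_big => [j|j /negPf->]; rewrite ?ltnNge // crE.
  rewrite big_split /=; congr (_ * _).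
    rewrite big_ord_recr /= [X in _ * X]big1 ?mulr1; last by move=> j; rewrite leqNgt ltn_ord.
    by apply: eq_bigr => i _; apply: eq_bigr => j _; rewrite (crE i).
  rewrite /psi_denX [RHS](exchange_big_dep predT) //=; apply: eq_bigr => i _.
  rewrite [RHS]big_mkcond big_ord_recr /= ltnNge -ltnS ltn_ord mulr1 -big_mkcond.
  by apply: eq_bigr.
have d0 : psi_denV Q k (crd (mrestr la)) * psi_denX Q k (crd la) != 0.
  by rewrite mulf_neq0 ?(psi_denV_neq0 Q0 Qgen k0 dmu) ?(psi_denX_neq0 Q0 Qgen k0 dla).
by rewrite divff.
Qed.

Lemma branching_poly_lead n (la : 'X_{1..n}) : partition_mnm la -> (R la)@_la = 1.
Proof.
elim: n => [|n IHn] in la *; first by move=> _; rewrite mcoeff1 (_ : la = 0%MM) ?eqxx //; apply/mnmP => -[].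
move=> pla; rewrite branching_poly_coeff.
have ltd : (mdeg (mrestr la) < (mdeg la).+1)%N by rewrite ltnS mdeg_mrestr leq_addr.
have prla : partition_mnm (mrestr la) by move=> i j ij; rewrite !mrestrE; apply: pla.
rewrite (bigD1 (BMultinom ltd)) //= psi0_mrestr // IHn // !mul1r.
rewrite [in X in X + _](mdeg_mrestr la) addKn eqxx big1 ?addr0 // => mu ne.
have [->|/psi0_neq0_interlace im] := eqVneq (psi0 Q k (crd la) (crd mu)) 0; first by rewrite mul0r.
case: (eqVneq (R mu)@_(mrestr la) 0) => [->|/branching_poly_dominated/andP[/eqP e _]].
  by rewrite mul0r mulr0.
case/eqP: ne; apply: val_inj => /=; apply/mnmP => i.
have le j : (mu j <= mrestr la j)%N by rewrite mrestrE; have /kinterlace_mcoordP/(_ j)/andP[] := im.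
have : (\sum_j (mrestr la j - mu j) = 0)%N by rewrite sumnB // -!mdegE e subnn.
move=> /eqP; rewrite sum_nat_eq0 => /forallP/(_ i)/=; rewrite subn_eq0 => h.
by apply/eqP; rewrite eqn_leq le.
Qed.
End Shape.

Section Symmetry.
Variables (F : fieldType) (Q : F) (k : nat).
Hypotheses (ch : [pchar F] =i pred0).
Hypotheses (Q0 : Q != 0) (Qgen : forall m, (0 < m)%N -> Q ^+ m != 1) (k0 : (0 < k)%N).
Local Notation R := (branching_poly Q k).
Local Notation crd := (mcoord k).

Lemma meval_msym n (t : 'S_n) (p : {mpoly F[n]}) (v : 'I_n -> F) :
  (msym t p).@[v] = p.@[fun i => v (t i)].
Proof.
rewrite [RHS]mevalE {1}(mpolyE p) [msym _ _]raddf_sum raddf_sum; apply: eq_bigr => m _.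
rewrite /= msymZ msymX mevalZ mevalX; congr (_ * _).
by rewrite (reindex_inj (@perm_inj _ t)); apply: eq_bigr => i _; rewrite mnmE permK.
Qed.

Lemma branching_poly_zero n : R (0%MM : 'X_{1..n}) = 1.
Proof.
apply/mpolyP => m; rewrite mcoeff1; case: eqP => [->|m0].
  by apply: (branching_poly_lead Q0 Qgen k0) => i j _; rewrite !mnmE.
have [//|/branching_poly_dominated/andP[]] := eqVneq ((R 0%MM)@_m) 0.
by rewrite mdeg0 mdeg_eq0 => /eqP.
Qed.

Lemma card_ord_lt n r : (r <= n)%N -> #|[set i : 'I_n | (i < r)%N]| = r.
Proof.
by move=> le_rn; rewrite -sum1dep_card -(big_ord_widen n (fun=> 1%N) le_rn) sum1_card card_ord.
Qed.

Lemma initial_segment n (I : {set 'I_n}) :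
  (forall i j : 'I_n, (j <= i)%N -> i \in I -> j \in I) -> I = [set i : 'I_n | (i < #|I|)%N].
Proof.
move=> dc; apply/eqP; rewrite eqEcard card_ord_lt; last first.
  by rewrite -[leqRHS]card_ord max_card.
rewrite leqnn andbT; apply/subsetP => i iI; rewrite inE.
rewrite -[X in (X <= _)%N](card_ord_lt (ltn_ord i)); apply: subset_leq_card.
by apply/subsetP => j; rewrite inE ltnS => /dc/(_ iI).
Qed.

Lemma ltm_swap n (nu : 'X_{1..n}) (I J : {set 'I_n}) r :
  I = [set i : 'I_n | (i < r)%N] -> #|J| = #|I| -> J != I ->
  ((nu + mesym1 J)%MM < (nu + mesym1 I)%MM)%O.
Proof.
move=> IE cJI JI; rewrite ltmc_add2r; apply/ltmcP; first by rewrite !mdeg_mesym1.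
have [i0 i0P] : exists i, (i \in I) != (i \in J).
  apply/existsP; apply: contraNT JI => /existsPn H; apply/eqP/setP => i.
  by have := H i; rewrite negbK => /eqP.
case: (arg_minnP (P := fun i => (i \in I) != (i \in J)) (fun i : 'I_n => val i) i0P) => i iP imin.
have iI : i \in I.
  apply/negPn/negP => iI; move: (iP); rewrite (negPf iI) eq_sym eqbF_neg negbK => iJ.
  have sIJ : I \subset J.
    apply/subsetP => j jI; have : (j < i)%N.
      by move: jI iI; rewrite IE !inE => jr ir; apply: leq_trans jr _; rewrite leqNgt.
    by apply: contraTT => jJ; rewrite -leqNgt; apply: imin; rewrite jI (negPf jJ).
  by case/eqP: JI; apply/esym/eqP; rewrite eqEcard sIJ cJI leqnn.
exists i => [j ji|]; rewrite !mnmE.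
  congr nat_of_bool; apply/eqP; rewrite eq_sym.
  apply: contraTT ji => ne.
  by rewrite -leqNgt; exact: (imin _ ne).
by move: iP; rewrite iI; case: (i \in J).
Qed.

Lemma branching_poly_perm n (la : 'X_{1..n}) (t : 'S_n) (v : 'I_n -> F) :
  partition_mnm la -> (forall i, v i != 0) ->
  (R la).@[fun i => v (t i)] = (R la).@[v].
Proof.
move=> pla v0; move: la pla; elim/(well_founded_induction (@ltom_wf n)) => la IH pla.
have [->|la0] := eqVneq la 0%MM; first by rewrite branching_poly_zero !meval1.
pose I := [set i | la i != 0%N]; pose r := #|I|.
have le_I : (mesym1 I <= la)%MM by apply/mnm_lepP => i; rewrite mnmE inE; case: (la i).
pose nu := (la - mesym1 I)%MM; have laE : la = (nu + mesym1 I)%MM by rewrite submK.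
have nuE i : nu i = (la i).-1 by rewrite mnmBE mnmE inE; case: (la i) => // a; rewrite subn1.
have pnu : partition_mnm nu by move=> i j ij; rewrite !nuE -!subn1 leq_sub2r // pla.
have IE : I = [set i : 'I_n | (i < r)%N].
  apply: initial_segment => i j ji; rewrite !inE -!lt0n => /leq_trans; apply; exact: pla.
have dnu := (kdominant_partition k nu).2 pnu.
pose d (m : 'X_{1..n}) := (R m).@[fun i => v (t i)] - (R m).@[v].
have dnu0 : d nu = 0.
  apply/eqP; rewrite subr_eq0; apply/eqP; apply: IH => //; apply: lt_mdeg_ltmc.
  rewrite [in X in (_ < X)%N]laE mdegD mdeg_mesym1 -[X in (X < _)%N]addn0 ltn_add2l card_gt0.
  apply: contraNneq la0 => I0; apply/eqP/mnmP => i; rewrite mnm0E.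
  have : i \notin I by rewrite I0 inE.
  by rewrite /I inE negbK => /eqP.
pose P : {poly F} := \sum_(J : {set 'I_n}) (pieri Q k (crd nu) J * d (nu + mesym1 J)%MM) *: 'X^(#|~: J|).
have P0 : P = 0.
  apply: poly_fun_eq0 => // w.
  have vt0 i : v (t i) != 0 by [].
  have e1 := branching_poly_pieri ch Q0 Qgen k0 w dnu vt0.
  have e2 := branching_poly_pieri ch Q0 Qgen k0 w dnu v0.
  have ep : \prod_(i < n) (w + v (t i)) = \prod_(i < n) (w + v i).
    by rewrite [RHS](reindex_inj (@perm_inj _ t)).
  transitivity ((\prod_(i < n) (w + v i)) * d nu); last by rewrite dnu0 mulr0.
  rewrite mulrBr e2 -ep e1 -sumrB horner_sum; apply: eq_bigr => J _.
  by rewrite hornerZ hornerXn /d; ring.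
have := congr1 (fun p : {poly F} => p`_(#|~: I|)) P0; rewrite coef0 coef_sum (bigD1 I) //=.
rewrite big1 ?addr0 => [|J JI]; last first.
  rewrite coefZ coefXn; case: eqP => [cJ|_]; last by rewrite mulr0.
  have cJI : #|J| = #|I|.
    by apply/eqP; rewrite -(eqn_add2r #|~: I|) cardsC {1}cJ cardsC.
  rewrite mulr1; case: (boolP (kdominant k (shift (crd nu) J 1))) => dJ; last first.
    by rewrite pieri_nondominant ?mul0r.
  rewrite /d IH ?subrr ?mulr0 //; first by rewrite laE; apply: ltm_swap IE cJI JI.
  by apply/(kdominant_partition k); rewrite (eq_kdominant k (mcoord_addE k nu J)).
rewrite coefZ coefXn eqxx mulr1 -laE => /eqP; rewrite mulf_eq0 => /orP[|/eqP/subr0_eq //].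
have -> : pieri Q k (crd nu) I = 1.
  apply: big1 => i _; apply: big1 => j ij; case: ifP => // /andP[iI jI].
  by move: iI jI; rewrite IE !inE -leqNgt => ri jr; have := leq_trans jr (leq_trans ri (ltnW ij)); rewrite ltnn.
by rewrite oner_eq0.
Qed.

Lemma branching_poly_sym n (la : 'X_{1..n}) : partition_mnm la -> R la \is symmetric.
Proof.
move=> pla; apply/issymP => t; apply/eqP; rewrite -subr_eq0; apply/eqP.
apply: (mpoly_dense ch (h := \prod_(i < n) 'X_i)).
  by apply/prodf_neq0 => i _; rewrite -msupp_eq0 msuppX.
move=> v; rewrite rmorph_prod => /prodf_neq0 v0; rewrite mevalB meval_msym branching_poly_perm ?subrr //.
by move=> i; have := v0 i isT; rewrite /= mevalXU.
Qed.
End Symmetry.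

(** * Commutation of the Macdonald operators *)

Lemma lagrange_lead_coef (F : fieldType) (zs : seq F) (p : {poly F}) :
  uniq zs -> (0 < size zs)%N -> (size p <= size zs)%N ->
  \sum_(z <- zs) p.[z] / (\prod_(w <- zs | w != z) (z - w)) = p`_(size zs).-1.
Proof.
move=> uzs zs0 sp; pose D z : {poly F} := \prod_(w <- zs | w != z) ('X - w%:P).
have De z : (D z).[z] = \prod_(w <- zs | w != z) (z - w).
  by rewrite horner_prod; apply: eq_bigr => w _; rewrite hornerXsubC.
have Dz z y : y \in zs -> y != z -> (D z).[y] = 0.
  by move=> yzs yz; apply/rootP; rewrite /D -big_filter root_prod_XsubC mem_filter yz yzs.
have sD z : z \in zs -> size (D z) = size zs /\ (D z)`_(size zs).-1 = 1.
  move=> zzs; have e : size (D z) = size zs.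
    rewrite /D -big_filter size_prod_XsubC size_filter.
    have -> : count (fun w => w != z) zs = (size zs).-1.
      by rewrite -(count_predC (pred1 z) zs) count_uniq_mem // zzs.
    by rewrite prednK.
  split=> //.
  have := monic_prod_XsubC zs (fun w => w != z) id.
  by rewrite monicE lead_coefE -/(D z) e => /eqP.
pose L : {poly F} := \sum_(z <- zs) (p.[z] / (\prod_(w <- zs | w != z) (z - w))) *: D z.
have pL : p = L.
  apply/eqP; rewrite -subr_eq0; apply/eqP.
  apply: (roots_geq_poly_eq0 (rs := zs)) => //.
    apply/allP => y yzs; rewrite rootE hornerD hornerN horner_sum (bigD1_seq y) //= hornerZ De.
    rewrite divfK; last first.
      by rewrite prodf_seq_neq0; apply/allP => w _; apply/implyP => wy; rewrite subr_eq0 eq_sym.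
    by rewrite big1 ?addr0 ?subrr // => z zy; rewrite hornerZ Dz ?mulr0 // eq_sym.
  rewrite (leq_trans (size_polyD _ _)) // geq_max sp size_polyN.
  rewrite /L big_seq; apply: (leq_trans (size_sum _ _ _)); apply/bigmax_leqP_seq => z zzs _.
  by rewrite (leq_trans (size_scale_leq _ _)) // (sD z zzs).1.
rewrite [in RHS]pL coef_sum [LHS]big_seq [RHS]big_seq; apply: eq_bigr => z zzs.
by rewrite coefZ (sD z zzs).2 mulr1.
Qed.

Lemma prod_linear_poly (F : fieldType) (I : Type) (r : seq I) (a b : I -> F) :
  let p : {poly F} := \prod_(i <- r) (a i *: 'X + (b i)%:P) in
  (size p <= (size r).+1)%N /\ p`_(size r) = \prod_(i <- r) a i.
Proof.
elim: r => [|i r [sp cp]] /=.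
  by rewrite !big_nil size_poly1 coefC.
have sP (c : F) (q : {poly F}) d : (size q <= d)%N -> (size (c *: q) <= d)%N.
  by apply: leq_trans; apply: size_scale_leq.
rewrite !big_cons mulrDl -scalerAl mul_polyC; split.
  rewrite (leq_trans (size_polyD _ _)) // geq_max; apply/andP; split.
    by apply: sP; rewrite mulrC (leq_trans (size_mul_leq _ _)) // size_polyX addn2.
  by apply: sP; apply: leqW.
rewrite coefD !coefZ coefXM /= cp [X in _ + _ * X]nth_default //.
by rewrite mulr0 addr0.
Qed.

Section Commutation.
Variable F : fieldType.
Hypothesis ch : [pchar F] =i pred0.
Variables (Q : F) (n : nat).
Hypotheses (Q0 : Q != 0) (Q1 : Q != 1).

Definition generic_point (v : 'I_n -> F) :=
  [/\ forall i, v i != 0, injective v & forall i j, i != j -> v i != Q * v j].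

Definition mg (T x y : F) : F := (T * x - y) / (x - y).

Lemma commutation_sum (T : F) (v : 'I_n -> F) (K : {set 'I_n}) : generic_point v ->
  \sum_(i in K) \prod_(b in K :\ i) (mg T (v i) (v b) * mg T (v b) (Q * v i)) =
  \sum_(i in K) \prod_(b in K :\ i) (mg T (v b) (v i) * mg T (v i) (Q * v b)).
Proof.
move=> [v0 iv vQ]; apply/eqP; rewrite -subr_eq0; apply/eqP; move: T.
apply: (is_polyfun_dense ch (rs := [:: 1; Q])).
  rewrite /mg; apply: is_polyfunD; last apply: is_polyfunN; apply: is_polyfun_sum => i;
    apply: is_polyfun_prod => b; repeat first [apply: is_polyfun_cst | apply: is_polyfun_id
    | apply: is_polyfunM | apply: is_polyfunD].
move=> T; rewrite !inE negb_or => /andP[T1 TQ].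
pose m := #|K|; pose Qi := Q^-1.
pose zs := 0 :: [seq v i | i in K] ++ [seq Qi * v i | i in K].
pose r := [seq (true, a) | a <- enum K] ++ [seq (false, a) | a <- enum K].
pose ca (c : bool * 'I_n) := if c.1 then T else - Q.
pose cb (c : bool * 'I_n) := if c.1 then - v c.2 else T * v c.2.
have [] := prod_linear_poly r ca cb.
set p : {poly F} := \prod_(c <- r) _ => sp cp.
have sr : size r = (m + m)%N by rewrite size_cat !size_map -!cardE.
have pE z : p.[z] = (\prod_(a in K) (T * z - v a)) * \prod_(a in K) (T * v a - Q * z).
  rewrite horner_prod big_cat !big_map -!big_enum; congr (_ * _); apply: eq_bigr => a _;
    by rewrite /= hornerD hornerZ hornerX hornerC /ca /cb /=; ring.
have lead : p`_(m + m) = (- (T * Q)) ^+ m.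
  rewrite -sr cp big_cat !big_map /= !big_enum !prodr_const -exprMn.
  by congr (_ ^+ _); ring.
have vne i j : i \in K :\ j -> v i - v j != 0.
  by rewrite in_setD1 subr_eq0 => /andP[ij _]; apply: contra ij => /eqP/iv->.
have vQne i j : i \in K :\ j -> v i - Q * v j != 0 /\ v j - Q * v i != 0.
  by rewrite in_setD1 !subr_eq0 => /andP[ij _]; rewrite !vQ // eq_sym.
have uzs : uniq zs.
  have Qi0 : Qi != 0 by rewrite invr_eq0.
  rewrite /zs /= mem_cat negb_or cat_uniq; apply/and3P; split.
  - by apply/andP; split; apply/imageP => -[i _ /esym/eqP]; rewrite ?mulf_eq0 ?(negPf Qi0) (negPf (v0 i)).
  - by rewrite map_inj_uniq ?enum_uniq.
  - apply/andP; split; last first.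
      by rewrite map_inj_uniq ?enum_uniq // => i j /(mulfI Qi0)/iv.
    apply/hasPn => _ /imageP[i iK ->]; apply/imageP => -[j jK] /(congr1 ( *%R Q)).
    rewrite mulVKf // => e; have [ij|ij] := eqVneq i j.
      by move: e; rewrite ij -[X in X = _]mul1r => /(mulIf (v0 j))/esym/eqP; rewrite (negPf Q1).
    by have := vQ i j ij; rewrite e eqxx.
have szs : size zs = (m + m).+1 by rewrite /= size_cat !size_image.
have sumE (G : F -> F) : \sum_(z <- zs) G z =
    G 0 + (\sum_(i in K) G (v i) + \sum_(i in K) G (Qi * v i)).
  by rewrite /zs big_cons big_cat !big_image.
have prodE (G : F -> F) z : \prod_(w <- zs | w != z) G w =
    (if 0 != z then G 0 else 1) * ((\prod_(i in K) (if v i != z then G (v i) else 1)) *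
      \prod_(i in K) (if Qi * v i != z then G (Qi * v i) else 1)).
  by rewrite /zs big_mkcond big_cons big_cat !big_image.
have Qi0 : Qi != 0 by rewrite invr_eq0.
have Qv i : Qi * v i != 0 by rewrite mulf_neq0.
have : (size p <= size zs)%N by rewrite szs -sr.
move=> /(lagrange_lead_coef uzs (ltn0Sn _)); rewrite szs /= lead.
rewrite sumE => E.
have term0 : p.[0] / \prod_(w <- zs | w != 0) (0 - w) = (- (T * Q)) ^+ m.
  rewrite pE prodE eqxx mul1r -!big_split -prodf_div -prodr_const; apply: eq_bigr => i _ /=.
  by rewrite Qv v0 /Qi; have := v0 i => vi; field; rewrite oppr_eq0 Q0.
have term1 i : i \in K -> p.[v i] / \prod_(w <- zs | w != v i) (v i - w) =
  (T - 1) * (T - Q) / (1 - Qi) * (- Q) ^+ m.-1 *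
  \prod_(b in K :\ i) (mg T (v i) (v b) * mg T (v b) (Q * v i)).
  move=> iK; rewrite pE prodE eq_sym v0 !(big_setD1 i iK) /= eqxx mul1r.
  have -> : m.-1 = #|K :\ i| by rewrite /m (cardsD1 i) iK.
  have c1 : \prod_(b in K :\ i) (if v b != v i then v i - v b else 1) = \prod_(b in K :\ i) (v i - v b).
    by apply: eq_bigr => b bK; rewrite ifT // -subr_eq0 vne.
  have c2 : (if Qi * v i != v i then v i - Qi * v i else 1) = (1 - Qi) * v i.
    rewrite ifT; first by ring.
    by rewrite -subr_eq0 -[X in _ - X]mul1r -mulrBl mulf_neq0 // subr_eq0 invr_eq1.
  have c3 : \prod_(b in K :\ i) (if Qi * v b != v i then v i - Qi * v b else 1) =
      \prod_(b in K :\ i) (v i - Qi * v b).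
    apply: eq_bigr => b bK; rewrite ifT //; have [+ _] := vQne b i bK; apply: contra => /eqP <-.
    by rewrite /Qi mulVKf // subrr.
  rewrite c1 c2 c3 -prodr_const !subr0.
  have vi := v0 i; have Q1' : 1 - Qi != 0 by rewrite subr_eq0 eq_sym invr_eq1.
  rewrite -[RHS]mulrA -big_split /=.
  rewrite [X in _ = _ * X](_ : _ = (\prod_(b in K :\ i) (T * v i - v b)) *
    (\prod_(b in K :\ i) (T * v b - Q * v i)) / ((\prod_(b in K :\ i) (v i - v b)) *
    \prod_(b in K :\ i) (v i - Qi * v b))); last first.
    rewrite -!big_split -prodf_div; apply: eq_bigr => b bK /=; rewrite /mg /Qi.
    have [n1 n2] := vQne b i bK; have n3 := vne b i bK.
    have sw (x y : F) : x - y != 0 -> y - x != 0 by rewrite -opprB oppr_eq0.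
    have n4 := sw _ _ n1; have n5 := sw _ _ n2; have n6 := sw _ _ n3.
    by field; rewrite ?[v i * Q]mulrC ?[v b * Q]mulrC ?n1 ?n2 ?n3 ?n4 ?n5 ?n6 ?Q0.
  have d1 : \prod_(b in K :\ i) (v i - v b) != 0.
    by apply/prodf_neq0 => b bK; rewrite -opprB oppr_eq0 vne.
  have d2 : \prod_(b in K :\ i) (v i - Qi * v b) != 0.
    apply/prodf_neq0 => b bK; have [+ _] := vQne b i bK; apply: contra.
    by rewrite !subr_eq0 => /eqP ->; rewrite mulVKf.
  by field; rewrite d1 d2 vi Q1'.
have term2 i : i \in K -> p.[Qi * v i] / \prod_(w <- zs | w != Qi * v i) (Qi * v i - w) =
  - ((T - 1) * (T - Q) / (1 - Qi) * (- Q) ^+ m.-1 *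
  \prod_(b in K :\ i) (mg T (v b) (v i) * mg T (v i) (Q * v b))).
  move=> iK; rewrite pE prodE eq_sym Qv !(big_setD1 i iK) /= eqxx mul1r.
  have -> : m.-1 = #|K :\ i| by rewrite /m (cardsD1 i) iK.
  have c1 : \prod_(b in K :\ i) (if v b != Qi * v i then Qi * v i - v b else 1) =
      \prod_(b in K :\ i) (Qi * v i - v b).
    apply: eq_bigr => b bK; rewrite ifT //; have [_ +] := vQne b i bK; apply: contra => /eqP ->.
    by rewrite mulVKf // subrr.
  have c2 : (if v i != Qi * v i then Qi * v i - v i else 1) = - ((1 - Qi) * v i).
    rewrite ifT; first by ring.
    by rewrite -subr_eq0 -[X in X - _]mul1r -mulrBl mulf_neq0 // subr_eq0 eq_sym invr_eq1.
  have c3 : \prod_(b in K :\ i) (if Qi * v b != Qi * v i then Qi * v i - Qi * v b else 1) =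
      \prod_(b in K :\ i) (Qi * (v i - v b)).
    apply: eq_bigr => b bK; rewrite ifT ?mulrBr // -subr_eq0 -mulrBr mulf_neq0 //; exact: vne.
  rewrite c1 c2 c3 -prodr_const !subr0.
  have vi := v0 i; have Q1' : 1 - Qi != 0 by rewrite subr_eq0 eq_sym invr_eq1.
  rewrite -[X in _ = - X]mulrA -big_split /=.
  rewrite [X in _ = - (_ * X)](_ : _ = (\prod_(b in K :\ i) (T * (Qi * v i) - v b)) *
    (\prod_(b in K :\ i) (T * v b - Q * (Qi * v i))) / ((\prod_(b in K :\ i) (Qi * v i - v b)) *
    \prod_(b in K :\ i) (Qi * (v i - v b)))); last first.
    rewrite -!big_split -prodf_div; apply: eq_bigr => b bK /=; rewrite /mg /Qi.
    have [n1 n2] := vQne b i bK; have n3 := vne b i bK.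
    have sw (x y : F) : x - y != 0 -> y - x != 0 by rewrite -opprB oppr_eq0.
    have n4 := sw _ _ n1; have n5 := sw _ _ n2; have n6 := sw _ _ n3.
    by field; rewrite mulNr [v b * Q]mulrC n2 n3 n6 Q0.
  have d1 : \prod_(b in K :\ i) (Qi * v i - v b) != 0.
    apply/prodf_neq0 => b bK; have [_] := vQne b i bK; apply: contra.
    by rewrite !subr_eq0 => /eqP <-; rewrite mulVKf.
  have d2 : \prod_(b in K :\ i) (Qi * (v i - v b)) != 0.
    by apply/prodf_neq0 => b bK; rewrite mulf_neq0 // -opprB oppr_eq0 vne.
  rewrite [Q * (Qi * v i)]mulVKf //; move: d1 d2.
  move: (\prod_(b in _) (Qi * v i - v b)) (\prod_(b in _) (Qi * _)) => P1 P2 d1 d2.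
  move: (\prod_(b in _) (T * (Qi * v i) - v b)) (\prod_(b in _) (T * v b - v i)) => P3 P4.
  have Qe : Q = Qi^-1 by rewrite invrK.
  rewrite Qe; clearbody Qi; by field; rewrite d1 d2 vi Q1' Qi0 oppr_eq0 mulf_neq0.
move: E; rewrite term0 (eq_bigr _ term1) (eq_bigr _ term2) -[RHS]addr0 => /addrI/eqP.
rewrite sumrN -!mulr_sumr -mulrBr mulf_eq0.
case/orP=> [|/eqP //]; rewrite !mulf_eq0 invr_eq0 expf_eq0 oppr_eq0 (negPf Q0) andbF !orbF.
by rewrite !subr_eq0 (negPf T1) (negPf TQ) /= eq_sym invr_eq1 (negPf Q1).
Qed.
End Commutation.

Lemma sum_insert_set (V : zmodType) (I : finType) s (G : I -> {set I} -> V) :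
  \sum_(i : I) \sum_(S : {set I} | (#|S| == s) && (i \notin S)) G i S =
  \sum_(K : {set I} | #|K| == s.+1) \sum_(i in K) G i (K :\ i).
Proof.
rewrite (exchange_big_dep xpredT) //= [RHS](eq_bigr _ (fun K _ => big_mkcond _ _)) /=.
rewrite exchange_big /=; rewrite (exchange_big_dep xpredT) //=.
apply: eq_bigr => i _; rewrite -big_mkcondr /=.
rewrite (reindex_onto (fun K => K :\ i) (fun S => i |: S)); last first.
  by move=> S /andP[_ iS]; rewrite setU1K.
apply: eq_bigl => K; rewrite setD11 andbT.
have [iK|iK] := boolP (i \in K); first by rewrite setD1K // eqxx (cardsD1 i K) iK eqSS.
rewrite !andbF; apply/negbTE/negP => /andP[_ /eqP e].
by move: iK; rewrite -e setU11.
Qed.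

Section Operators.
Variables (F : fieldType) (Q T : F) (n : nat).
Implicit Types (v : 'I_n -> F) (I K : {set 'I_n}).

Definition macA v I : F := \prod_(i in I) \prod_(j in ~: I) mg T (v i) (v j).

Definition macS s (f : ('I_n -> F) -> F) v : F :=
  \sum_(I : {set 'I_n} | #|I| == s) macA v I * f (scale_on Q I v).

Lemma scale_onC I J v : scale_on Q I (scale_on Q J v) =1 scale_on Q J (scale_on Q I v).
Proof. by move=> i; rewrite /scale_on; case: (i \in I); case: (i \in J). Qed.

Lemma scale_on_setU1 i I v : i \notin I ->
  scale_on Q I (scale_on Q [set i] v) =1 scale_on Q (i |: I) v.
Proof.
move=> iI j; rewrite /scale_on !inE; have [->|ji] := eqVneq j i; first by rewrite (negPf iI).
by [].
Qed.

Lemma mgZ x y : Q != 0 -> mg T (Q * x) (Q * y) = mg T x y.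
Proof. by move=> Q0; rewrite /mg mulrCA -!mulrBr -mulf_div divff // mul1r. Qed.

Lemma macA_setC1_split i K (G : 'I_n -> F) : i \in K ->
  \prod_(j in ~: [set i]) G j = (\prod_(j in K :\ i) G j) * \prod_(j in ~: K) G j.
Proof.
move=> iK; rewrite (big_setID K) /=; congr (_ * _); apply: eq_bigl => j; rewrite !inE.
  by rewrite andbC.
by have [->|] := eqVneq j i; rewrite ?iK ?andbT.
Qed.

Lemma macA_commute_in v i I : Q != 0 -> i \in I ->
  macA v [set i] * macA (scale_on Q [set i] v) I =
  macA v I * macA (scale_on Q I v) [set i].
Proof.
move=> Q0 iI; rewrite /macA !big_set1.
rewrite !(macA_setC1_split _ iI) !(big_setD1 i iI) /=.
have oI j : j \in ~: I -> (j == i) = false.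
  by rewrite inE; apply: contraNF => /eqP ->.
rewrite [X in _ * (X * _) = _](_ : _ = \prod_(j in ~: I) mg T (Q * v i) (v j)); last first.
  by apply: eq_bigr => j jI; rewrite /scale_on !inE eqxx oI.
rewrite [X in _ * (_ * X) = _](_ : _ = \prod_(l in I :\ i) \prod_(j in ~: I) mg T (v l) (v j)); last first.
  apply: eq_bigr => l; rewrite inE => /andP[li _].
  by apply: eq_bigr => j jI; rewrite /scale_on (negPf li) !inE oI // (negPf li).
rewrite [X in _ = _ * (X * _)](_ : _ = \prod_(j in I :\ i) mg T (v i) (v j)); last first.
  apply: eq_bigr => j; rewrite inE => /andP[_ jI]; by rewrite /scale_on iI jI mgZ.
rewrite [X in _ = _ * (_ * X)](_ : _ = \prod_(j in ~: I) mg T (Q * v i) (v j)); last first.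
  by apply: eq_bigr => j; rewrite inE => jI; rewrite /scale_on iI (negPf jI).
by ring.
Qed.

Lemma macA_setD1_split i K (G : 'I_n -> F) : i \in K ->
  \prod_(j in ~: (K :\ i)) G j = G i * \prod_(j in ~: K) G j.
Proof.
move=> iK; rewrite (big_setD1 i) /=; last by rewrite !inE eqxx.
by congr (_ * _); apply: eq_bigl => j; rewrite !inE; have [->|] := eqVneq j i; rewrite ?iK.
Qed.

Lemma macA_outl v i K : i \in K ->
  macA v [set i] * macA (scale_on Q [set i] v) (K :\ i) =
  macA v K * \prod_(b in K :\ i) (mg T (v i) (v b) * mg T (v b) (Q * v i)).
Proof.
move=> iK; rewrite /macA big_set1 (macA_setC1_split _ iK) (big_setD1 i iK) /=.
rewrite [X in _ * X](_ : _ = \prod_(b in K :\ i) (mg T (v b) (Q * v i) *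
   \prod_(j in ~: K) mg T (v b) (v j))); last first.
  apply: eq_bigr => b; rewrite inE => /andP[]; rewrite inE => bi bK.
  rewrite (macA_setD1_split _ iK) /scale_on !inE eqxx (negPf bi); congr (_ * _).
  apply: eq_bigr => j; rewrite !inE => jK; rewrite ifF //.
  by apply: contraNF jK => /eqP ->.
by rewrite !big_split /=; ring.
Qed.

Lemma macA_outr v i K : i \in K ->
  macA v (K :\ i) * macA (scale_on Q (K :\ i) v) [set i] =
  macA v K * \prod_(b in K :\ i) (mg T (v b) (v i) * mg T (v i) (Q * v b)).
Proof.
move=> iK; rewrite /macA big_set1 (macA_setC1_split _ iK) (big_setD1 i iK) /=.
rewrite [X in X * _](_ : _ = \prod_(b in K :\ i) (mg T (v b) (v i) *
   \prod_(j in ~: K) mg T (v b) (v j))); last first.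
  by apply: eq_bigr => b _; rewrite (macA_setD1_split _ iK).
rewrite [X in _ * (X * _)](_ : _ = \prod_(b in K :\ i) mg T (v i) (Q * v b)); last first.
  by apply: eq_bigr => b bK; rewrite /scale_on bK !inE eqxx.
rewrite [X in _ * (_ * X)](_ : _ = \prod_(j in ~: K) mg T (v i) (v j)); last first.
  by apply: eq_bigr => j; rewrite inE => jK; rewrite /scale_on !inE eqxx (negPf jK) andbF.
by rewrite !big_split /=; ring.
Qed.

Hypotheses (ch : [pchar F] =i pred0) (Q0 : Q != 0) (Q1 : Q != 1).

Theorem macS_commute s (f : ('I_n -> F) -> F) v :
  (forall u u', u =1 u' -> f u = f u') -> generic_point Q v ->
  \sum_i macA v [set i] * macS s f (scale_on Q [set i] v) =
  macS s (fun u => \sum_i macA u [set i] * f (scale_on Q [set i] u)) v.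
Proof.
move=> fE gv; rewrite /macS.
under eq_bigr => i _ do rewrite mulr_sumr (bigID (fun I : {set 'I_n} => i \in I)) /=.
under [RHS]eq_bigr => I _ do rewrite mulr_sumr.
rewrite [RHS]exchange_big /=.
under [RHS]eq_bigr => i _ do rewrite (bigID (fun I : {set 'I_n} => i \in I)) /=.
rewrite !big_split /=; congr (_ + _).
  apply: eq_bigr => i _; apply: eq_bigr => I /andP[_ iI].
  by rewrite !mulrA macA_commute_in //; congr (_ * _); apply/fE/scale_onC.
rewrite !sum_insert_set; apply: eq_bigr => K _.
rewrite (eq_bigr (fun i => macA v K * f (scale_on Q K v) *
   \prod_(b in K :\ i) (mg T (v i) (v b) * mg T (v b) (Q * v i)))); last first.
  move=> i iK; rewrite mulrA macA_outl // (fE _ (scale_on Q K v)); first by ring.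
  by move=> j; rewrite scale_on_setU1 ?setD1K // !inE eqxx.
rewrite [RHS](eq_bigr (fun i => macA v K * f (scale_on Q K v) *
   \prod_(b in K :\ i) (mg T (v b) (v i) * mg T (v i) (Q * v b)))); last first.
  move=> i iK; rewrite mulrA macA_outr // (fE _ (scale_on Q K v)); first by ring.
  by move=> j; rewrite scale_onC scale_on_setU1 ?setD1K // !inE eqxx.
by rewrite -!mulr_sumr (commutation_sum ch).
Qed.
End Operators.

(** * Leading terms and the higher operators *)

Section LeadingTerms.
Variables (F : fieldType) (n : nat).
Implicit Types (v : 'I_n -> F) (p : {mpoly F[n]}) (I : {set 'I_n}) (m : 'X_{1..n}).

Definition vdm : {mpoly F[n]} := \prod_(i < n) \prod_(j < n | (i < j)%N) ('X_i - 'X_j).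

Definition stair : 'X_{1..n} := [multinom (n.-1 - i)%N | i < n].

Definition mscale (c : F) I p : {mpoly F[n]} :=
  p \mPo [tuple if i \in I then c *: 'X_i else 'X_i | i < n].

Lemma meval_mscale c I p v : (mscale c I p).@[v] = p.@[scale_on c I v].
Proof.
rewrite /mscale comp_mpoly_meval; apply: meval_eq => i.
by rewrite tnth_mktuple /scale_on; case: ifP; rewrite ?mevalZ mevalXU.
Qed.

Lemma mcoeff_mscale c I p m : (mscale c I p)@_m = c ^+ (\sum_(i in I) m i) * p@_m.
Proof.
have XE m' : mscale c I 'X_[m'] = c ^+ (\sum_(i in I) m' i) *: 'X_[m'].
  rewrite /mscale comp_mpolyX [in RHS]mpolyXE_id -prodrXr [\prod_(i in I) _]big_mkcond /=.
  rewrite -scaler_prod; apply: eq_bigr => i _; rewrite tnth_mktuple.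
  by case: ifP => _; rewrite ?exprZn ?scale1r.
have -> : mscale c I p = \sum_(m' <- msupp p) p@_m' *: mscale c I 'X_[m'].
  rewrite {1}[p]mpolyE /mscale raddf_sum /=; apply: eq_bigr => m' _.
  by rewrite linearZ.
rewrite raddf_sum /= (eq_bigr (fun m' => c ^+ (\sum_(i in I) m i) * (p@_m' * (m' == m)%:R))).
  rewrite -mulr_sumr; congr (_ * _); rewrite [in RHS](mpolyE p) raddf_sum /=.
  by apply: eq_bigr => m' _; rewrite mcoeffZ mcoeffX.
move=> m' _; rewrite XE !mcoeffZ mcoeffX; have [->|] := eqVneq m' m; first by ring.
by rewrite !mulr0.
Qed.

Lemma mlead_mscale c I p m : (mlead p <= m)%O -> (mlead (mscale c I p) <= m)%O.
Proof.
move=> le; have [->|nz] := eqVneq (mscale c I p) 0; first by rewrite mlead0 le0x.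
have := mlead_supp nz; rewrite mcoeff_msupp mcoeff_mscale mulf_eq0 negb_or -mcoeff_msupp => /andP[_].
by move/msupp_le_mlead/le_trans; apply.
Qed.

Lemma mlead_X_sub (i j : 'I_n) : (i < j)%N ->
  mlead ('X_i - 'X_j : {mpoly F[n]}) = U_(i)%MM /\ mleadc ('X_i - 'X_j : {mpoly F[n]}) = 1.
Proof.
move=> ij; have lt : (U_(j)%MM < U_(i)%MM :> 'X_{1..n})%O.
  apply/ltmcP; first by rewrite !mdeg1.
  exists i => [k ki|]; rewrite !mnm1E.
    by rewrite -!val_eqE /= !gtn_eqF // (ltn_trans ki ij).
  by rewrite eqxx -val_eqE /= gtn_eqF.
have e : mlead ('X_i - 'X_j : {mpoly F[n]}) = U_(i)%MM.
  by rewrite mleadDl ?mleadXm // mleadN !mleadXm.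
split=> //; rewrite e mcoeffB !mcoeffX eqxx.
have -> : (U_(j)%MM == U_(i)%MM :> 'X_{1..n}) = false by rewrite lt_eqF.
by rewrite subr0.
Qed.

Lemma X_sub_neq0 (i j : 'I_n) : (i < j)%N -> 'X_i - 'X_j != 0 :> {mpoly F[n]}.
Proof. by move=> /mlead_X_sub[_ e]; rewrite -mleadc_eq0 e oner_eq0. Qed.

Lemma vdm_neq0 : vdm != 0.
Proof. by apply/prodf_neq0 => i _; apply/prodf_neq0 => j; apply: X_sub_neq0. Qed.

Lemma mlead_vdm : mlead vdm = stair /\ vdm@_stair = 1.
Proof.
have e1 : (\sum_(i < n) \sum_(j < n | (i < j)%N) mlead ('X_i - 'X_j : {mpoly F[n]}))%MM = stair.
  apply/mnmP => l; rewrite mnm_sumE mnmE.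
  rewrite (eq_bigr (fun i : 'I_n => if i == l then (n.-1 - l)%N else 0%N)).
    by rewrite -big_mkcond big_pred1_eq.
  move=> i _; rewrite mnm_sumE.
  rewrite (eq_bigr (fun _ => (i == l) : nat)); last first.
    by move=> j /mlead_X_sub[-> _]; rewrite mnm1E.
  case: eqP => [->|_]; last by rewrite big1.
  rewrite sum1_card; have := cardC [pred j : 'I_n | (j <= l)%N]; rewrite card_ord.
  have -> : #|[pred j : 'I_n | (j <= l)%N]| = l.+1.
    by rewrite -[RHS](card_ord_lt (ltn_ord l)) cardsE; apply: eq_card.
  have -> : #|[predC [pred j : 'I_n | (j <= l)%N]]| = #|(fun j : 'I_n => (l < j)%N)|.
    by apply: eq_card => j; rewrite !inE -ltnNge.
  set c := #|_| => e; have := ltn_ord l; lia.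
have e2 : mlead vdm = stair.
  rewrite -e1 /vdm mlead_prod; last first.
    by move=> i _ _; apply/prodf_neq0 => j; apply: X_sub_neq0.
  apply: eq_bigr => i _; rewrite mlead_prod //.
  by move=> j _; apply: X_sub_neq0.
split=> //; rewrite -e1 /vdm.
transitivity (\prod_(i < n) mleadc (\prod_(j < n | (i < j)%N) ('X_i - 'X_j : {mpoly F[n]}))); last first.
  rewrite big1 // => i _; rewrite mlead_prod; last first.
    by move=> j _; apply: X_sub_neq0.
  by rewrite mleadc_prod big1 // => j /mlead_X_sub[].
rewrite -mleadc_prod; congr (_ @_ _); apply: eq_bigr => i _; rewrite mlead_prod //.
by move=> j _; apply: X_sub_neq0.
Qed.

Lemma meval_vdm v : vdm.@[v] = \prod_(i < n) \prod_(j < n | (i < j)%N) (v i - v j).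
Proof.
rewrite /vdm rmorph_prod; apply: eq_bigr => i _; rewrite rmorph_prod; apply: eq_bigr => j _.
by rewrite /= mevalB !mevalXU.
Qed.

Lemma meval_vdm_neq0 v : (vdm.@[v] != 0) <-> injective v.
Proof.
rewrite meval_vdm; split=> [|iv].
  move=> /prodf_neq0 nz i j e; apply/eqP/negPn/negP => ij.
  wlog lt : i j e ij / (i < j)%N.
    move=> H; case: (ltngtP i j) => [lt|lt|/val_inj eij].
    - exact: (H i j).
    - by apply: (H j i) => //; rewrite eq_sym.
    - by rewrite eij eqxx in ij.
  have := nz i isT => /prodf_neq0/(_ j lt).
  by rewrite e subrr eqxx.
apply/prodf_neq0 => i _; apply/prodf_neq0 => j ij.
by rewrite subr_eq0; apply/eqP => /iv e; rewrite e ltnn in ij.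
Qed.

Lemma vdm_scale_on T I v : injective v ->
  vdm.@[scale_on T I v] = T ^+ 'C(#|I|, 2) * macA T v I * vdm.@[v].
Proof.
move=> iv; rewrite /macA.
have -> : \prod_(i in I) \prod_(j in ~: I) mg T (v i) (v j) =
    \prod_(i in I) \prod_(j in setT :\: I) mg T (v i) (v j).
  by rewrite setTD.
rewrite -prod_lt_pairs !meval_vdm -big_split; apply: eq_bigr => i _ /=.
rewrite -big_split; apply: eq_bigr => j ij /=.
have d : v i - v j != 0 by rewrite subr_eq0; apply/eqP => /iv e; rewrite e ltnn in ij.
have d' : v j - v i != 0 by rewrite -opprB oppr_eq0.
rewrite /scale_on /mg; case: (i \in I); case: (j \in I); rewrite ?mul1r ?mulrBr ?divfK //; by field.
Qed.

Definition macpoly (Q T : F) s p : {mpoly F[n]} :=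
  \sum_(I : {set 'I_n} | #|I| == s) mscale T I vdm * mscale Q I p.

Lemma meval_macpoly Q T s p v : injective v ->
  (macpoly Q T s p).@[v] = T ^+ 'C(s, 2) * vdm.@[v] * macS Q T s (fun u => p.@[u]) v.
Proof.
move=> iv; rewrite /macpoly /macS mulr_sumr raddf_sum; apply: eq_bigr => I /eqP cI.
by rewrite /= mevalM !meval_mscale vdm_scale_on // cI; ring.
Qed.

Lemma macpoly_coeff Q T s p m : (mlead p <= m)%O ->
  (macpoly Q T s p)@_(stair + m)%MM =
  (\sum_(I : {set 'I_n} | #|I| == s) \prod_(i in I) (T ^+ stair i * Q ^+ m i)) * p@_m.
Proof.
move=> le; have [e1 e2] := mlead_vdm.
rewrite /macpoly raddf_sum mulr_suml; apply: eq_bigr => I _ /=.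
rewrite mleadcMW; last 1 first; try by apply: mlead_mscale; rewrite // e1.
by rewrite !mcoeff_mscale e2 mulr1 big_split /= !prodrXr; ring.
Qed.
End LeadingTerms.

Section Exponents.
Variable N : nat.
Hypothesis N1 : (1 < N)%N.

Lemma sum_exp_lt n (a : 'I_n.+1 -> nat) : {homo a : i j / (i < j)%N >-> (j < i)%N} ->
  (\sum_i N ^ a i < N ^ (a ord0).+1)%N.
Proof.
elim: n a => [|n IH] a da; first by rewrite big_ord1 ltn_exp2l.
rewrite big_ord_recl expnS (leq_trans (n := 2 * N ^ a ord0)) //; last by rewrite leq_mul2r N1 orbT.
rewrite mul2n -addnn ltn_add2l.
have := IH (fun i => a (lift ord0 i)) (fun i j ij => da (lift ord0 i) (lift ord0 j) ij).
move=> /leq_trans; apply; rewrite leq_exp2l //.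
exact: da.
Qed.

Lemma sum_exp_inj n (a b : 'I_n -> nat) :
  {homo a : i j / (i < j)%N >-> (j < i)%N} -> {homo b : i j / (i < j)%N >-> (j < i)%N} ->
  (\sum_i N ^ a i = \sum_i N ^ b i)%N -> a =1 b.
Proof.
elim: n a b => [|n IH] a b da db e i; first by case: i.
have e0 : a ord0 = b ord0.
  wlog lt : a b da db e / (a ord0 < b ord0)%N.
    move=> H; case: (ltngtP (a ord0) (b ord0)) => // lt; first exact: H.
    by apply/esym/H.
  have := sum_exp_lt da; rewrite e ltnNge => /negP[]; rewrite big_ord_recl.
  by rewrite (leq_trans _ (leq_addr _ _)) // leq_exp2l.
move: e; rewrite !big_ord_recl e0 => /addnI e.
have H := IH (fun i => a (lift ord0 i)) (fun i => b (lift ord0 i))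
  (fun i j ij => da (lift ord0 i) (lift ord0 j) ij) (fun i j ij => db (lift ord0 i) (lift ord0 j) ij) e.
by case: (unliftP ord0 i) => [j ->|-> //]; apply: H.
Qed.
End Exponents.

Section Antisymmetry.
Variables (F : fieldType) (n : nat).
Implicit Types (v : 'I_n -> F) (I : {set 'I_n}) (t : 'S_n).

Lemma meval_vdm_perm t v : (vdm F n).@[fun i => v (t i)] = (-1) ^+ t * (vdm F n).@[v].
Proof.
have E u : (vdm F n).@[u] = \det (Vandermonde n (\row_j - u j)).
  rewrite det_Vandermonde meval_vdm; apply: eq_bigr => i _; apply: eq_bigr => j _.
  by rewrite !mxE opprK addrC.
rewrite !E -[in (-1) ^+ t](invgK t) odd_permV -det_perm mulrC -det_mulmx; congr (\det _).
by rewrite -col_permE; apply/matrixP => i j; rewrite !mxE.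
Qed.

Lemma scale_on_perm (Q : F) t I v :
  scale_on Q I (fun i => v (t i)) =1 (fun i => scale_on Q (t @: I) v (t i)).
Proof. by move=> i; rewrite /scale_on mem_imset //; apply: perm_inj. Qed.

Lemma macA_perm (T : F) t I v : macA T (fun i => v (t i)) I = macA T v (t @: I).
Proof.
rewrite /macA big_imset /=; last by move=> i j _ _; apply: perm_inj.
apply: eq_bigr => i _; have -> : ~: (t @: I) = t @: (~: I).
  apply/setP => j; rewrite -[j](permKV t) inE !mem_imset ?inE //; exact: perm_inj.
by rewrite big_imset //= => i' j _ _; apply: perm_inj.
Qed.

Lemma macS_perm (Q T : F) s (p : {mpoly F[n]}) t v : p \is symmetric ->
  macS Q T s (fun u => p.@[u]) (fun i => v (t i)) = macS Q T s (fun u => p.@[u]) v.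
Proof.
move=> /issymP sp; rewrite /macS [RHS](reindex (fun I : {set 'I_n} => t @: I)) /=; last first.
  exists (fun I : {set 'I_n} => t^-1%g @: I) => I _; rewrite -imset_comp -[RHS]imset_id;
    by apply: eq_imset => i; rewrite /= ?permK ?permKV.
apply: eq_big => I; first by rewrite card_imset //; apply: perm_inj.
move=> _; rewrite macA_perm; congr (_ * _).
by rewrite -[in RHS](sp t) meval_msym; apply: meval_eq; apply: scale_on_perm.
Qed.

Hypothesis ch : [pchar F] =i pred0.

Lemma mlead_antisym (h : {mpoly F[n]}) : h != 0 ->
  (forall t : 'S_n, msym t h = (-1) ^+ t *: h) ->
  {homo mlead h : i j / (i < j)%N >-> (j < i)%N}.
Proof.
move=> h0 ah i j ij; rewrite ltnNge; apply/negP => le.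
have nij : i != j by rewrite -val_eqE /= ltn_eqF.
have := congr1 (fun p : {mpoly F[n]} => p@_(mlead h)) (ah (tperm i j)).
rewrite mcoeff_sym odd_tperm nij /= mcoeffZ expr1 mulN1r.
have m0 : h@_(mlead h) != 0 by rewrite mleadc_eq0.
set ms := [multinom _ | _ < _]; have [eq|ne] := eqVneq (mlead h i) (mlead h j).
  have -> : ms = mlead h.
    apply/mnmP => l; rewrite mnmE; case: tpermP => [->|->|//]; by rewrite eq.
  move=> /eqP; rewrite -addr_eq0 -mulr2n -mulr_natl mulf_eq0 (negPf m0) orbF.
  by rewrite -[0](mulr0n 1) => /eqP /(natr_inj_pchar0 ch).
have lt : (mlead h < ms)%O.
  apply/ltmcP; first exact/esym/mdeg_mperm.
  exists i => [k lt_ki|]; last by rewrite mnmE tpermL ltn_neqAle ne.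
  rewrite mnmE tpermD // neq_ltn orbC ?lt_ki // (ltn_trans lt_ki) //.
rewrite (mcoeff_gt_mlead lt) => /esym/eqP; rewrite oppr_eq0; exact/negP.
Qed.

End Antisymmetry.

Lemma dominated_le n (m la : 'X_{1..n}) : dominated m la -> (m <= la)%O.
Proof.
case/andP=> /eqP edeg /forallP dom; have [->//|ne] := eqVneq m la.
have [i0 i0P] : exists i, m i != la i.
  apply/existsP; apply: contraNT ne => /existsPn H; apply/eqP/mnmP => i.
  by have := H i; rewrite negbK => /eqP.
case: (arg_minnP (P := fun i => m i != la i) (fun i : 'I_n => val i) i0P) => i iP imin.
apply/ltW/ltmcP => //; have lt (j : 'I_n) : (j < i)%N -> m j = la j.
  by move=> ji; apply/eqP; apply: contraTT ji => ne'; rewrite -leqNgt; apply: imin.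
exists i => //; have := dom i; rewrite (bigD1 i) //= [leqRHS](bigD1 i) //=.
rewrite [X in (_ + X <= _)%N](eq_bigr la) ?leq_add2r; first by rewrite ltn_neqAle iP.
by move=> j /andP[ji ne']; apply: lt; rewrite ltn_neqAle ji andbT.
Qed.

Lemma mcoeff_prodW (R : idomainType) n (I : Type) (r : seq I) (P : pred I)
    (G : I -> {mpoly R[n]}) (M : I -> 'X_{1..n}) :
  (forall i, P i -> (mlead (G i) <= M i)%O) ->
  (mlead (\prod_(i <- r | P i) G i) <= (\sum_(i <- r | P i) M i)%MM)%O /\
  (\prod_(i <- r | P i) G i)@_(\sum_(i <- r | P i) M i)%MM = \prod_(i <- r | P i) (G i)@_(M i).
Proof.
move=> le; elim: r => [|i r [IH1 IH2]]; first by rewrite !big_nil mlead1 mcoeff1 eqxx.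
rewrite !big_cons; case: ifP => // Pi; rewrite mleadcMW // ?IH2 ?le //; split=> //.
by rewrite (le_trans (mleadM_le _ _)) // lem_add // le.
Qed.

Section Operator.
Variables (F : fieldType) (k : nat) (Q : F).
Hypotheses (ch : [pchar F] =i pred0) (k0 : (0 < k)%N).
Hypotheses (Q0 : Q != 0) (Qgen : forall m, (0 < m)%N -> Q ^+ m != 1).
Local Notation R := (branching_poly Q k).
Local Notation T := (qT Q k).
Variables (n : nat) (la : 'X_{1..n}).
Hypothesis pla : partition_mnm la.
Implicit Types v : 'I_n -> F.

Lemma mlead_branching_poly : mlead (R la) = la.
Proof.
have l1 := branching_poly_lead Q0 Qgen k0 pla; have Rn : R la != 0.
  by apply/eqP => e; move: l1; rewrite e mcoeff0 => /eqP; rewrite eq_sym oner_eq0.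
apply/le_anti/andP; split.
  apply/dominated_le/(branching_poly_dominated (F := F) (Q := Q) (k := k)).
  by rewrite mleadc_eq0.
by apply: msupp_le_mlead; rewrite mcoeff_msupp l1 oner_neq0.
Qed.

Definition eigen_sum s : F :=
  \sum_(I : {set 'I_n} | #|I| == s) \prod_(i in I) (T ^+ stair n i * Q ^+ la i).

Lemma mac1E f v : mac1 Q k f v = \sum_i macA T v [set i] * f (scale_on Q [set i] v).
Proof.
apply: eq_bigr => i _; rewrite /macA big_set1; congr (_ * _).
by apply: eq_bigl => j; rewrite !inE.
Qed.

Lemma scale_on_inj v I : generic_point Q v -> injective (scale_on Q I v).
Proof.
move=> [v0 iv vQ] i j; rewrite /scale_on; case: (i \in I); case: (j \in I).
- by move/(mulfI Q0)/iv.
- move=> e; apply/eqP/negPn/negP => ij; by have := vQ j i; rewrite eq_sym ij e eqxx => /(_ isT).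
- by move=> e; apply/eqP/negPn/negP => ij; have := vQ i j ij; rewrite e eqxx.
- exact: iv.
Qed.

Definition generic_mpoly : {mpoly F[n]} :=
  (\prod_i 'X_i) * vdm F n * \prod_i \prod_(j | j != i) ('X_i - Q *: 'X_j).

Lemma generic_mpoly_neq0 : generic_mpoly != 0.
Proof.
have X0 (i : 'I_n) : 'X_i != 0 :> {mpoly F[n]}.
  by apply/eqP => /(congr1 (fun p : {mpoly F[n]} => p@_U_(i))) /eqP; rewrite mcoeffX eqxx mcoeff0 oner_eq0.
rewrite !mulf_neq0 ?vdm_neq0 //; first by apply/prodf_neq0 => i _.
apply/prodf_neq0 => i _; apply/prodf_neq0 => j ji; apply/eqP.
move=> /(congr1 (fun p : {mpoly F[n]} => p@_U_(i))) /eqP.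
rewrite mcoeffB mcoeffZ !mcoeffX eqxx mcoeff0 eq_mnm1 (negPf ji) mulr0 subr0 oner_eq0 //.
Qed.

Lemma generic_mpolyP v : generic_mpoly.@[v] != 0 -> generic_point Q v.
Proof.
rewrite /generic_mpoly !mevalM !mulf_eq0 !negb_or => /andP[/andP[]].
move=> + dv; rewrite !rmorph_prod /= => v0 vQ.
split; [|exact/meval_vdm_neq0|].
- by move=> i; move/prodf_neq0/(_ i isT): v0; rewrite mevalXU.
- move=> i j ij; move/prodf_neq0/(_ i isT): vQ; rewrite rmorph_prod => /prodf_neq0/(_ j).
  by rewrite eq_sym ij /= mevalB mevalZ !mevalXU subr_eq0; apply.
Qed.

Definition eigen_defect s : {mpoly F[n]} :=
  macpoly Q T s (R la) - eigen_sum s *: (vdm F n * R la).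

Lemma eigen_defect_lead s : (eigen_defect s)@_(stair n + la)%MM = 0.
Proof.
have [e1 e2] := mlead_vdm F n.
rewrite mcoeffB mcoeffZ macpoly_coeff ?mlead_branching_poly // -/(eigen_sum s).
by rewrite mleadcMW ?mlead_branching_poly ?e1 // e2 mul1r subrr.
Qed.

Lemma eigen_defectE s v : injective v -> (eigen_defect s).@[v] =
  (vdm F n).@[v] * (T ^+ 'C(s, 2) * macS Q T s (fun u => (R la).@[u]) v - eigen_sum s * (R la).@[v]).
Proof. by move=> iv; rewrite mevalB mevalZ mevalM meval_macpoly //; ring. Qed.

Lemma eigen_defect_antisym s (t : 'S_n) : msym t (eigen_defect s) = (-1) ^+ t *: eigen_defect s.
Proof.
have sR := branching_poly_sym ch Q0 Qgen k0 pla.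
apply/eqP; rewrite -subr_eq0; apply/eqP; apply: (mpoly_dense ch (vdm_neq0 F n)) => v.
move/meval_vdm_neq0 => iv; rewrite mevalB mevalZ meval_msym.
rewrite !eigen_defectE //; last by move=> i j /iv/perm_inj.
rewrite macS_perm // meval_vdm_perm -meval_msym; move/issymP: sR => ->.
by rewrite mulrA subrr.
Qed.

Lemma eigen1E : eigen1 Q k la = \sum_i T ^+ stair n i * Q ^+ la i.
Proof.
rewrite /eigen1 mulr_sumr; apply: eq_bigr => i _; rewrite /xi /mcoord.
have -> : Q ^ ((la i)%:Z - (k * i)%N%:Z) = Q ^+ la i / T ^+ i.
  by rewrite expfzDr // -invr_expz /qT -!exprnP -exprM.
have T0 : T != 0 by apply: expfz_neq0.
have -> : T ^+ n = T ^+ stair n i * T ^+ i * T.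
  by rewrite -exprD -exprSr mnmE; congr (_ ^+ _); have := ltn_ord i; lia.
by have := expf_neq0 i T0 => Ti; field; rewrite T0 Ti.
Qed.

Lemma eigen_defect_mac1 s :
  \sum_i mscale T [set i] (vdm F n) * (mscale Q [set i] (eigen_defect s) *
     \prod_(j < n | j != i) mscale Q [set j] (vdm F n)) =
  eigen1 Q k la *: (eigen_defect s * \prod_(j < n) mscale Q [set j] (vdm F n)).
Proof.
apply/eqP; rewrite -subr_eq0; apply/eqP; apply: (mpoly_dense ch generic_mpoly_neq0) => v.
move=> /generic_mpolyP gv; have [v0 iv vQ] := gv.
set D := vdm F n; set P := \prod_(j < n) (D.@[scale_on Q [set j] v]).
have Ds i : D.@[scale_on T [set i] v] = macA T v [set i] * D.@[v].
  by rewrite vdm_scale_on // cards1 expr0 mul1r.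
pose g u := T ^+ 'C(s, 2) * macS Q T s (fun u => (R la).@[u]) u - eigen_sum s * (R la).@[u].
have Ri u : (forall i, u i != 0) -> injective u ->
    \sum_i macA T u [set i] * (R la).@[scale_on Q [set i] u] = eigen1 Q k la * (R la).@[u].
  move=> u0 iu; transitivity (mac1 Q k (fun u => (R la).@[u]) u); first by rewrite mac1E.
  by rewrite branching_poly_mac1 //; apply/kdominant_partition.
rewrite mevalB mevalZ mevalM raddf_sum /= rmorph_prod /=.
under [\prod_(i < n) (mscale _ _ _).@[v]]eq_bigr => j _ do rewrite meval_mscale.
rewrite -/P eigen_defectE // -/(g v).
rewrite (eq_bigr (fun i => D.@[v] * P * (macA T v [set i] * g (scale_on Q [set i] v)))); last first.
  move=> i _; rewrite !mevalM !meval_mscale [(\prod_(j < n | _) _).@[v]]rmorph_prod /= Ds.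
  rewrite eigen_defectE; last exact: scale_on_inj.
  rewrite [P](bigD1 i) //= -/(g _) -/D.
  under eq_bigr => j _ do rewrite meval_mscale.
  by ring.
rewrite -mulr_sumr; suff -> : \sum_i macA T v [set i] * g (scale_on Q [set i] v) = eigen1 Q k la * g v.
  by ring.
transitivity (T ^+ 'C(s, 2) * (\sum_i macA T v [set i] * macS Q T s (fun u => (R la).@[u]) (scale_on Q [set i] v))
  - eigen_sum s * \sum_i macA T v [set i] * (R la).@[scale_on Q [set i] v]).
  by rewrite /g !mulr_sumr -sumrB; apply: eq_bigr => i _; ring.
have Q1 : Q != 1 by have := Qgen (ltn0Sn 0); rewrite expr1.
rewrite (macS_commute T ch) //; last by move=> u u' e; apply: meval_eq.
rewrite Ri // /g mulrBr; congr (_ - _); last by ring.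
rewrite mulrCA; congr (_ * _); rewrite /macS mulr_sumr; apply: eq_bigr => I _.
rewrite Ri; [by ring | exact: scale_on_neq0 | exact: scale_on_inj].
Qed.

End Operator.

Lemma natr_good (F : fieldType) (N : nat) : [pchar F] =i pred0 -> (1 < N)%N ->
  (N%:R : F) != 0 /\ forall m, (0 < m)%N -> (N%:R : F) ^+ m != 1.
Proof.
move=> ch N1; split=> [|m m0]; first by rewrite -[0](mulr0n 1) (inj_eq (natr_inj_pchar0 ch)); lia.
rewrite -natrX -[1](mulr1n 1) (inj_eq (natr_inj_pchar0 ch)).
by rewrite -[X in _ != X](expn0 N) eqn_exp2l //; lia.
Qed.

Section NaturalParameter.
Variables (F : fieldType) (k N : nat).
Hypotheses (ch : [pchar F] =i pred0) (k0 : (0 < k)%N) (N1 : (1 < N)%N).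
Local Notation Q := (N%:R : F).
Local Notation R := (branching_poly Q k).
Local Notation T := (qT Q k).

Lemma eigen_natr n (la : 'X_{1..n}) s : partition_mnm la -> eigen_defect k Q la s = 0.
Proof.
move=> pla; have [Q0 Qgen] := natr_good ch N1; set h := eigen_defect k Q la s.
have [//|h0] := eqVneq h 0; exfalso; set m := mlead h.
have dm : {homo m : i j / (i < j)%N >-> (j < i)%N}.
  by apply: (mlead_antisym ch h0) => t; apply: eigen_defect_antisym.
have [e1 e2] := mlead_vdm F n; have hm0 : h@_m != 0 by rewrite mleadc_eq0.
have Dl c I : (mlead (mscale c I (vdm F n)) <= stair n)%O by apply: mlead_mscale; rewrite e1.
have Dc c (i : 'I_n) : (mscale c [set i] (vdm F n))@_(stair n) = c ^+ stair n i.
  by rewrite mcoeff_mscale e2 mulr1 big_set1.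
pose E := (\sum_(j < n) stair n j)%N.
have := congr1 (fun p : {mpoly F[n]} => p@_(m + \sum_(j < n) stair n)%MM)
  (eigen_defect_mac1 ch k0 Q0 Qgen pla s).
rewrite -/h mcoeffZ; have [f1 f2] := mcoeff_prodW (index_enum _) (P := xpredT) (fun j _ => Dl Q [set j]).
rewrite mleadcMW // f2 raddf_sum /=.
rewrite (eq_bigr (fun i => h@_m * (T ^+ stair n i * Q ^+ (m i + (E - stair n i))))); last first.
  move=> i _; rewrite [X in (m + X)%MM](bigD1 i) //= addmA (addmC m) -addmA.
  have [g1 g2] := mcoeff_prodW (index_enum _) (P := predC1 i) (fun j _ => Dl Q [set j]).
  have lm : (mlead (mscale Q [set i] h) <= m)%O by exact: mlead_mscale.
  rewrite mleadcMW ?Dl //; last by rewrite (le_trans (mleadM_le _ _)) // lem_add.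
  rewrite mleadcMW // g2 Dc mcoeff_mscale big_set1 (eq_bigr _ (fun j _ => Dc Q j)) prodrXr.
  have -> : (E - stair n i)%N = (\sum_(j < n | j != i) stair n j)%N by rewrite /E (bigD1 i) //= addKn.
  rewrite exprD; move: (T ^+ _) (Q ^+ m i) (Q ^+ (\sum_(j < n | _) _)) (h@_m) => x y z w; by ring.
rewrite (eq_bigr _ (fun j _ => Dc Q j)) prodrXr -/E -mulr_sumr mulrCA => /(mulfI hm0).
rewrite eigen1E // mulr_suml => eqs.
have TE a : T ^+ a = (N ^ (k * a))%:R by rewrite /qT -exprnP -exprM natrX.
pose a i := (k * stair n i + (m i + (E - stair n i)))%N.
pose b i := (k * stair n i + (la i + E))%N.
have {}eqs : (\sum_i N ^ a i = \sum_i N ^ b i)%N.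
  apply: (natr_inj_pchar0 ch); rewrite !natr_sum.
  transitivity (\sum_i T ^+ stair n i * Q ^+ (m i + (E - stair n i))).
    by apply: eq_bigr => i _; rewrite TE -natrX -natrM -expnD.
  by rewrite eqs; apply: eq_bigr => i _; rewrite TE -!natrX -!natrM -!expnD /b addnA.
have ds : {homo stair n : i j / (i < j)%N >-> (j < i)%N}.
  by move=> i j ij; rewrite !mnmE; have := ltn_ord j; lia.
have Eb i : (stair n i <= E)%N by rewrite /E (bigD1 i) //= leq_addr.
have := sum_exp_inj N1 (a := a) (b := b).
have mono (i j : 'I_n) : (i < j)%N -> (k * stair n j < k * stair n i)%N.
  by move=> /ds; rewrite ltn_mul2l k0.
have da : {homo a : i j / (i < j)%N >-> (j < i)%N}.
  move=> i j ij; have := mono i j ij; have := dm _ _ ij; have := ds _ _ ij.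
  by have := Eb i; have := Eb j; rewrite /a; move: (m i) (m j) => x y; nia.
have db : {homo b : i j / (i < j)%N >-> (j < i)%N}.
  by move=> i j ij; have := mono i j ij; have := pla i j (ltnW ij); rewrite /b; lia.
move=> /(_ da db eqs) ab; suff: h@_m = 0 by move/eqP; rewrite (negPf hm0).
have -> : m = (stair n + la)%MM.
  by apply/mnmP => i; rewrite mnmDE; have := ab i; have := Eb i; rewrite /a /b; lia.
exact: eigen_defect_lead.
Qed.
End NaturalParameter.

Section RationalFunctions.
Variable F : fieldType.
Implicit Types (f g : F -> F) (Q : F).

Definition good Q := Q != 0 /\ forall m, (0 < m)%N -> Q ^+ m != 1.

Definition ratfun f := exists N M : {poly F}, forall Q, good Q -> M.[Q] != 0 /\ f Q * M.[Q] = N.[Q].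

Lemma ratfun_ext f g : (forall Q, good Q -> f Q = g Q) -> ratfun g -> ratfun f.
Proof. by move=> e [N [M H]]; exists N, M => Q gQ; rewrite e //; apply: H. Qed.

Lemma ratfun_cst c : ratfun (fun=> c).
Proof. by exists c%:P, 1 => Q _; rewrite !hornerE oner_neq0. Qed.

Lemma ratfun_id : ratfun id.
Proof. by exists 'X, 1 => Q _; rewrite !hornerE oner_neq0. Qed.

Lemma ratfunD f g : ratfun f -> ratfun g -> ratfun (fun Q => f Q + g Q).
Proof.
move=> [N [M H]] [N' [M' H']]; exists (N * M' + N' * M), (M * M') => Q gQ.
have [m e] := H Q gQ; have [m' e'] := H' Q gQ.
by rewrite ?hornerD !hornerM mulf_neq0 // -e -e'; split=> //; ring.
Qed.

Lemma ratfunM f g : ratfun f -> ratfun g -> ratfun (fun Q => f Q * g Q).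
Proof.
move=> [N [M H]] [N' [M' H']]; exists (N * N'), (M * M') => Q gQ.
have [m e] := H Q gQ; have [m' e'] := H' Q gQ.
by rewrite ?hornerD !hornerM mulf_neq0 // -e -e'; split=> //; ring.
Qed.

Lemma ratfunN f : ratfun f -> ratfun (fun Q => - f Q).
Proof.
by move=> /(ratfunM (ratfun_cst (-1))); apply: ratfun_ext => Q _; rewrite mulN1r.
Qed.

Lemma ratfunV f : (forall Q, good Q -> f Q != 0) -> ratfun f -> ratfun (fun Q => (f Q)^-1).
Proof.
move=> f0 [N [M H]]; exists M, N => Q gQ; have [m e] := H Q gQ.
by rewrite -e mulf_neq0 ?f0 // mulKf ?f0.
Qed.

Lemma ratfunX f n : ratfun f -> ratfun (fun Q => f Q ^+ n).
Proof.
move=> rf; elim: n => [|n IH]; first exact: ratfun_cst.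
by apply: ratfun_ext (ratfunM rf IH) => Q _; rewrite exprS.
Qed.

Lemma ratfun_sum (I : Type) (r : seq I) (P : pred I) (f : I -> F -> F) :
  (forall i, P i -> ratfun (f i)) -> ratfun (fun Q => \sum_(i <- r | P i) f i Q).
Proof.
move=> rf; elim: r => [|i r IH].
  by apply: ratfun_ext (ratfun_cst 0) => Q _; rewrite big_nil.
case Pi: (P i); last by apply: ratfun_ext IH => Q _; rewrite big_cons Pi.
by apply: ratfun_ext (ratfunD (rf i Pi) IH) => Q _; rewrite big_cons Pi.
Qed.

Lemma ratfun_prod (I : Type) (r : seq I) (P : pred I) (f : I -> F -> F) :
  (forall i, P i -> ratfun (f i)) -> ratfun (fun Q => \prod_(i <- r | P i) f i Q).
Proof.
move=> rf; elim: r => [|i r IH].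
  by apply: ratfun_ext (ratfun_cst 1) => Q _; rewrite big_nil.
case Pi: (P i); last by apply: ratfun_ext IH => Q _; rewrite big_cons Pi.
by apply: ratfun_ext (ratfunM (rf i Pi) IH) => Q _; rewrite big_cons Pi.
Qed.

Lemma ratfun_exprz (a : int) : ratfun (fun Q => Q ^ a).
Proof.
case: a => a; first by apply: ratfun_ext (ratfunX a ratfun_id).
apply: ratfun_ext (ratfunV _ (ratfunX a.+1 ratfun_id)) => // Q [Q0 _].
by rewrite expf_neq0.
Qed.

Lemma ratfun_meval n (p : {mpoly F[n]}) (v : F -> 'I_n -> F) :
  (forall i, ratfun (v^~ i)) -> ratfun (fun Q => p.@[v Q]).
Proof.
move=> rv; pose f Q := \sum_(m <- msupp p) p@_m * \prod_i v Q i ^+ m i.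
apply: (@ratfun_ext _ f) => [Q _|]; first by rewrite mevalE.
apply: ratfun_sum => m _; apply: ratfunM; first exact: ratfun_cst.
by apply: ratfun_prod => i _; apply: ratfunX.
Qed.

Lemma ratfun_qN k a : ratfun (fun Q => qN Q k a).
Proof.
apply: ratfun_prod => l _; apply: ratfunD; first exact: ratfun_cst.
exact/ratfunN/ratfun_exprz.
Qed.

Hypothesis ch : [pchar F] =i pred0.

Lemma ratfun_eq0 f : ratfun f -> (forall N : nat, (1 < N)%N -> f N%:R = 0) ->
  forall Q, good Q -> f Q = 0.
Proof.
move=> [N [M H]] f0; suff N0 : N = 0.
  by move=> Q gQ; have [m] := H Q gQ; rewrite N0 horner0 => /eqP; rewrite mulf_eq0 (negPf m) orbF => /eqP.
pose rs : seq F := [seq n%:R | n <- iota 2 (size N)].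
apply: (roots_geq_poly_eq0 (rs := rs)).
- apply/allP => r /mapP[n]; rewrite mem_iota => /andP[n1 _] ->; rewrite rootE.
  have [_ <-] := H n%:R (natr_good ch n1); by rewrite f0 // mul0r.
- by rewrite map_inj_uniq ?iota_uniq //; apply: natr_inj_pchar0.
- by rewrite size_map size_iota.
Qed.

Variable k : nat.
Hypothesis k0 : (0 < k)%N.

Lemma ratfun_psi0 n (x : 'I_n.+1 -> int) (y : 'I_n -> int) : ratfun (fun Q => psi0 Q k x y).
Proof.
have [ik|nik] := boolP (kinterlace k x y); last first.
  by apply: ratfun_ext (ratfun_cst 0) => Q _; rewrite /psi0 (negPf nik).
pose f Q := psi_num Q k x y * (psi_denV Q k y * psi_denX Q k x)^-1.
apply: (@ratfun_ext _ f) => [Q _|]; first by rewrite /psi0 ik.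
apply: ratfunM.
  apply: ratfun_prod => i _; apply: ratfun_prod => j _; case: (i <= j)%N; exact: ratfun_qN.
apply: ratfunV => [Q [Q0 Qg]|].
  rewrite mulf_neq0 //.
    exact/(psi_denV_neq0 Q0 Qg k0)/(kinterlace_dominantV ik).
  exact/(psi_denX_neq0 Q0 Qg k0)/(kinterlace_dominantX ik).
by apply: ratfunM; apply: ratfun_prod => i _; apply: ratfun_prod => j _; apply: ratfun_qN.
Qed.

Lemma ratfun_branching_poly n (la : 'X_{1..n}) (v : F -> 'I_n -> F) :
  (forall i, ratfun (v^~ i)) -> ratfun (fun Q => (branching_poly Q k la).@[v Q]).
Proof.
elim: n => [|n IH] in la v *; move=> rv.
  by apply: ratfun_ext (ratfun_cst 1) => Q _; rewrite /= meval1.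
pose f Q := \sum_(mu : 'X_{1..n < (mdeg la).+1}) psi0 Q k (mcoord k la) (mcoord k mu) *
   ((branching_poly Q k mu).@[vwid (v Q)] * v Q ord_max ^+ (mdeg la - mdeg mu)).
apply: (@ratfun_ext _ f) => [Q _|].
  rewrite /= raddf_sum; apply: eq_bigr => mu _ /=.
  by rewrite mevalZ mevalM rmorphXn /= mevalXU meval_mwiden.
apply: ratfun_sum => mu _; apply: ratfunM; first exact: ratfun_psi0.
apply: ratfunM; last exact: ratfunX.
by apply: IH => i; apply: rv.
Qed.

Theorem eigen_defect_eq0 Q n (la : 'X_{1..n}) s : good Q -> partition_mnm la ->
  eigen_defect k Q la s = 0.
Proof.
move=> gQ pla; apply: mpoly_fun_eq0 => // v.
pose f Q := (eigen_defect k Q la s).@[v]; apply: (@ratfun_eq0 f) gQ; last first.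
  by move=> N N1; rewrite /f eigen_natr // meval0.
have rsc (c : F -> F) I : ratfun c -> forall i : 'I_n, ratfun (fun Q => scale_on (c Q) I v i).
  move=> rc i; rewrite /scale_on; case: (i \in I); last exact: ratfun_cst.
  by apply: ratfunM => //; apply: ratfun_cst.
have rT : ratfun (fun Q => qT Q k) by exact: ratfun_exprz.
pose g Q := (\sum_(I : {set 'I_n} | #|I| == s) (vdm F n).@[scale_on (qT Q k) I v] *
     (branching_poly Q k la).@[scale_on Q I v]) +
  - ((\sum_(I : {set 'I_n} | #|I| == s) \prod_(i in I) (qT Q k ^+ stair n i * Q ^+ la i)) *
    ((vdm F n).@[v] * (branching_poly Q k la).@[v])).
apply: (@ratfun_ext _ g) => [Q' _|].
  rewrite /f mevalB mevalZ mevalM raddf_sum; congr (_ + _); apply: eq_bigr => I _.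
  by rewrite /= mevalM !meval_mscale.
apply: ratfunD; last apply: ratfunN; last apply: ratfunM; last apply: ratfunM.
- apply: ratfun_sum => I _; apply: ratfunM; first by apply: ratfun_meval; exact: rsc.
  by apply: ratfun_branching_poly; apply: rsc; apply: ratfun_id.
- apply: ratfun_sum => I _; apply: ratfun_prod => i _; apply: ratfunM; apply: ratfunX => //.
  exact: ratfun_id.
- exact: ratfun_cst.
- by apply: ratfun_branching_poly => i; apply: ratfun_cst.
Qed.
End RationalFunctions.

(** * Identification with the Macdonald polynomials *)

Lemma meval_mesym (F : fieldType) n r (f : 'I_n -> F) :
  (mesym n F r).@[f] = \sum_(I : {set 'I_n} | #|I| == r) \prod_(i in I) f i.
Proof.
rewrite /mesym raddf_sum; apply: eq_bigr => I _; rewrite /= rmorph_prod.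
by apply: eq_bigr => i _; rewrite /= mevalXU.
Qed.

Section MacdonaldOperator.
Variables (F : fieldType) (k : nat) (q : F).
Hypotheses (ch : [pchar F] =i pred0) (k0 : (0 < k)%N) (q0 : q != 0).
Variable n : nat.
Implicit Types (p : {mpoly F[n]}) (la m : 'X_{1..n}) (I : {set 'I_n}).
Local Notation K := {fraction {mpoly F[n]}}.
Local Notation t := (q ^+ k).
Local Notation Q := (q ^+ 2).
Local Notation T := (qT Q k).
Local Notation "x %:F" := (@tofrac {mpoly F[n]} x).

Lemma qTE : T = t ^+ 2.
Proof. by rewrite /qT -exprnP -!exprM mulnC. Qed.

Lemma tofrac_mscale_vdm I :
  (mscale T I (vdm F n))%:F = (T ^+ 'C(#|I|, 2))%:MP%:F * macdonald_coef t I * (vdm F n)%:F.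
Proof.
pose x i := ('X_i : {mpoly F[n]})%:F; pose T' := (T%:MP : {mpoly F[n]})%:F.
have ix : injective x.
  move=> i j /eqP; rewrite tofrac_eq => /eqP /(congr1 (fun p : {mpoly F[n]} => p@_U_(i))) /eqP.
  by rewrite !mcoeffX eqxx eq_mnm1; case: (j =P i) => [->//|_]; rewrite oner_eq0.
have xs i : ((if i \in I then T *: 'X_i else 'X_i) : {mpoly F[n]})%:F = scale_on T' I x i.
  by rewrite /scale_on; case: (i \in I); rewrite // -mul_mpolyC rmorphM.
have -> : (mscale T I (vdm F n))%:F = (vdm K n).@[scale_on T' I x].
  rewrite meval_vdm /mscale /vdm !rmorph_prod; apply: eq_bigr => i _.
  rewrite !rmorph_prod; apply: eq_bigr => j _ /=.
  by rewrite comp_mpolyB !comp_mpolyXU -!tnth_nth !tnth_mktuple rmorphB /= !xs.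
have -> : (vdm F n)%:F = (vdm K n).@[x].
  rewrite meval_vdm /vdm rmorph_prod; apply: eq_bigr => i _.
  by rewrite rmorph_prod; apply: eq_bigr => j _; rewrite /= rmorphB.
rewrite vdm_scale_on //; congr (_ * _ * _); first by rewrite /T' -!rmorphXn.
apply: eq_bigr => i _; apply: eq_bigr => j _; rewrite /mg /T' qTE.
by rewrite -mul_mpolyC !tofracB tofracM.
Qed.

Definition eigen_at la r : F :=
  \sum_(I : {set 'I_n} | #|I| == r) \prod_(i in I) (T ^+ stair n i * Q ^+ la i).

Lemma eigen_atE la r : (r <= n)%N ->
  eigen_at la r = t ^ (r%:Z * (n%:Z - 1)) * macdonald_eigenval q t la r.
Proof.
move=> rn; have t0 : t != 0 by rewrite expf_neq0.
rewrite /macdonald_eigenval meval_mesym mulr_sumr; apply: eq_bigr => I /eqP cI.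
have -> : t ^ (r%:Z * (n%:Z - 1)) = \prod_(i in I) t ^ (n%:Z - 1).
  by rewrite prodr_const cI exprnP exprz_exp mulrC.
rewrite -big_split; apply: eq_bigr => i _ /=.
rewrite qTE; move: (q ^+ k) t0 => t' t'0; rewrite -!exprM mulrCA -expfzDr // mulrC [t' ^+ _]exprnP.
congr (_ * _ ^ _); rewrite mnmE; have := ltn_ord i; lia.
Qed.

Lemma macdonald_opP p la r : (r <= n)%N ->
  macdonald_op q t r p = (macdonald_eigenval q t la r *: p)%:F <->
  macpoly Q T r p = eigen_at la r *: (vdm F n * p).
Proof.
move=> rn; have t0 : t != 0 by rewrite expf_neq0.
have D0 : (vdm F n)%:F != 0 by rewrite tofrac_eq0 vdm_neq0.
have Cf (c : F) : c != 0 -> (c%:MP)%:F != 0 by rewrite tofrac_eq0 mpolyC_eq0.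
pose c := t ^ (r%:Z * (r%:Z - n%:Z)); have c0 : c != 0 by apply: expfz_neq0.
have T0 : T != 0 by rewrite qTE expf_neq0.
have Te : T ^+ 'C(r, 2) = c * t ^ (r%:Z * (n%:Z - 1)).
  rewrite /c -expfzDr // qTE; move: (q ^+ k) t0 => t' t'0.
  rewrite -exprM exprnP; congr (_ ^ _); rewrite -mulrDr (_ : _ - _ + _ = r%:Z - 1); last by ring.
  have := mul_bin_diag r 1; rewrite bin1 => <-; case: (r) => [|r'] //=.
  by rewrite PoszM; congr (_ * _); lia.
have E : (T ^+ 'C(r, 2))%:MP%:F * macdonald_op q t r p * (vdm F n)%:F =
    (c *: macpoly Q T r p)%:F.
  rewrite /macdonald_op /macpoly -mul_mpolyC rmorphM /= -/c rmorph_sum /=.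
  rewrite mulrCA -!mulrA; congr (_ * _); rewrite mulrA mulr_sumr mulr_suml.
  apply: eq_bigr => I /eqP cI; rewrite rmorphM /= tofrac_mscale_vdm cI.
  rewrite -[qshift q I p]/(mscale Q I p); ring.
have T'0 := Cf _ (expf_neq0 'C(r, 2) T0).
split=> H.
  apply: (scalerI c0); apply/eqP; rewrite -tofrac_eq; apply/eqP.
  rewrite -E H eigen_atE // -!mul_mpolyC !rmorphM /= Te !rmorphM /=; ring.
apply: (mulfI T'0); apply: (mulIf D0); rewrite E H eigen_atE //.
rewrite -!mul_mpolyC !rmorphM /= Te !rmorphM /=; ring.
Qed.
End MacdonaldOperator.

Lemma esym_inj (F : fieldType) n (c d : 'I_n -> F) :
  (forall r, (r <= n)%N -> \sum_(I : {set 'I_n} | #|I| == r) \prod_(i in I) c i =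
     \sum_(I : {set 'I_n} | #|I| == r) \prod_(i in I) d i) ->
  [seq c i | i : 'I_n] =i [seq d i | i : 'I_n].
Proof.
move=> e; pose P (f : 'I_n -> F) : {poly F} := \prod_(i < n) ('X - (f i)%:P).
have Pt f : P f = \prod_(z <- [tuple f i | i < n]) ('X - z%:P).
  by rewrite big_tuple; apply: eq_bigr => i _; rewrite tnth_mktuple.
have sP f : size (P f) = n.+1 by rewrite Pt size_prod_XsubC size_tuple.
have PE : P c = P d.
  apply/polyP => j; case: (ltnP j n.+1) => jn; last by rewrite !nth_default ?sP.
  have rn : (n - j < n.+1)%N by rewrite ltnS leq_subr.
  have -> : j = (n - Ordinal rn)%N by rewrite /= subKn.
  rewrite !Pt !mroots_coeff !meval_mesym /=; congr (_ * _).
  under eq_bigr => I _ do under eq_bigr => i _ do rewrite tnth_mktuple.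
  under [RHS]eq_bigr => I _ do under eq_bigr => i _ do rewrite tnth_mktuple.
  by apply: e; rewrite leq_subr.
have mE f z : (z \in [seq f i | i : 'I_n]) = root (P f) z.
  by rewrite Pt root_prod_XsubC.
by move=> z; rewrite !mE PE.
Qed.

Section Uniqueness.
Variables (F : fieldType) (k : nat) (q : F).
Hypotheses (ch : [pchar F] =i pred0) (k0 : (0 < k)%N) (q0 : q != 0).
Hypothesis qgen : forall m : nat, (0 < m)%N -> ~~ m.-unity_root q.
Local Notation t := (q ^+ k).
Local Notation Q := (q ^+ 2).
Local Notation T := (qT Q k).

Lemma good_sqr : good Q.
Proof.
split=> [|m m0]; first by rewrite expf_neq0.
have := qgen (m := (2 * m)%N); rewrite muln_gt0 m0 => /(_ isT).
by rewrite unity_rootE exprM.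
Qed.

Lemma eigen_at_inj n (la m : 'X_{1..n}) : partition_mnm la -> partition_mnm m ->
  (forall r, (r <= n)%N -> eigen_at k q m r = eigen_at k q la r) -> m = la.
Proof.
move=> pla pm /esym_inj E; have [Q0 Qg] := good_sqr.
pose a (la : 'X_{1..n}) i := (k * stair n i + la i)%N.
have aE (la' : 'X_{1..n}) : (fun i => T ^+ stair n i * Q ^+ la' i) =1 (fun i => Q ^+ a la' i).
  by move=> i; rewrite /qT; move: (q ^+ 2) => z; rewrite -exprnP -exprM -exprD.
have da la' : partition_mnm la' -> {homo a la' : i j / (i < j)%N >-> (j < i)%N}.
  move=> pl i j ij; have := pl i j (ltnW ij); have := ltn_ord j; rewrite /a !mnmE.
  have : (k * (n.-1 - j) < k * (n.-1 - i))%N by rewrite ltn_mul2l k0 /=; have := ltn_ord j; lia.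
  lia.
have ia la' : partition_mnm la' -> injective (a la').
  move=> /da d i j e; apply: val_inj; case: (ltngtP i j) => // /d; by rewrite e ltnn.
have memE (la' : 'X_{1..n}) x : (Q ^+ x \in [seq T ^+ stair n i * Q ^+ la' i | i : 'I_n]) =
    (x \in [seq a la' i | i : 'I_n]).
  apply/imageP/imageP => -[i _ e]; exists i => //; last by rewrite e aE.
  move: e; rewrite aE => e; have : Q ^ x%:Z = Q ^ (a la' i)%:Z by rewrite -!exprnP.
  by move=> /(expQ_inj Q0 Qg k0) [].
have pe : perm_eq [seq a m i | i : 'I_n] [seq a la i | i : 'I_n].
  apply: uniq_perm; try by rewrite map_inj_uniq -?enumT ?enum_uniq //; apply: ia.
  by move=> x; rewrite -!memE E.
have eqs : (\sum_i 2 ^ a m i = \sum_i 2 ^ a la i)%N.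
  by have := perm_big _ pe (op := addn) (x := 0%N) (P := xpredT) (F := fun x => 2 ^ x)%N;
    rewrite !big_image /=.
have := sum_exp_inj (ltnSn 1) (da _ pm) (da _ pla) eqs.
by move=> ab; apply/mnmP => i; have := ab i; rewrite /a => /addnI.
Qed.

Lemma macpolyB n (p p' : {mpoly F[n]}) r :
  macpoly Q T r (p - p') = macpoly Q T r p - macpoly Q T r p'.
Proof.
rewrite /macpoly -sumrB; apply: eq_bigr => I _.
by rewrite -mulrBr /mscale comp_mpolyB.
Qed.

Lemma is_macdonald_unique n (la : 'X_{1..n}) p p' : partition_mnm la ->
  is_macdonald q t la p -> is_macdonald q t la p' -> p = p'.
Proof.
move=> pla [s1 l1 _ e1] [s2 l2 _ e2]; apply/eqP; rewrite -subr_eq0; apply/negPn/negP => d0.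
set d := p - p' in d0; pose m := mlead d.
have sd : d \is symmetric by rewrite rpredB.
have pm : partition_mnm m by move=> i j; apply: mlead_msym_sorted.
suff em : m = la.
  by move: d0; rewrite -mleadc_eq0 -/m em mcoeffB l1 l2 subrr eqxx.
apply: eigen_at_inj => // r rn; have [v1 v2] := mlead_vdm F n.
have : macpoly Q T r d = eigen_at k q la r *: (vdm F n * d).
  rewrite macpolyB mulrBr scalerBr; congr (_ - _).
    by apply/macdonald_opP => //; apply: e1.
  by apply/macdonald_opP => //; apply: e2.
move/(congr1 (fun p : {mpoly F[n]} => p@_(stair n + m)%MM)).
rewrite macpoly_coeff // mcoeffZ mleadcMW ?v1 // v2 mul1r.
by apply: mulIf; rewrite mleadc_eq0.
Qed.

Lemma is_macdonald_branching n (la : 'X_{1..n}) : partition_mnm la ->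
  is_macdonald q t la (branching_poly Q k la).
Proof.
move=> pla; have [Q0 Qg] := good_sqr; split.
- exact: branching_poly_sym.
- exact: branching_poly_lead.
- by move=> m; rewrite mcoeff_msupp; apply: branching_poly_dominated.
- move=> r rn; apply/macdonald_opP => //; apply/eqP; rewrite -subr_eq0; apply/eqP.
  exact: (eigen_defect_eq0 ch k0 r good_sqr pla).
Qed.

Theorem macdonald_poly_branching n (la : 'X_{1..n}) : partition_mnm la ->
  macdonald_poly q t la = branching_poly Q k la.
Proof.
move=> pla; have H := is_macdonald_branching pla.
apply: (is_macdonald_unique pla) (H).
by apply: ClassicalEpsilon.epsilon_spec; exists (branching_poly Q k la).
Qed.
End Uniqueness.

(** * Signatures and the final formula *)

Lemma big_ord_ltS (R : Type) (idx : R) (op : Monoid.com_law idx) n (f : nat -> nat -> R) :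
  \big[op/idx]_(i < n.+1) \big[op/idx]_(j < n.+1 | (i < j)%N) f i j =
  \big[op/idx]_(i < n) \big[op/idx]_(j < n | (i <= j)%N) f i j.+1.
Proof.
rewrite big_ord_recr /= [X in op _ X]big1 ?Monoid.mulm1; last first.
  by move=> j; rewrite ltnNge -ltnS ltn_ord.
apply: eq_bigr => i _; rewrite big_mkcond big_ord_recl /= Monoid.mul1m [RHS]big_mkcond.
by apply: eq_bigr => j _; rewrite /bump leq0n add1n ltnS.
Qed.

Section QFactors.
Variables (F : fieldType) (q : F) (k : nat).
Hypotheses (q0 : q != 0) (k0 : (0 < k)%N).
Hypothesis qgen : forall m : nat, (0 < m)%N -> ~~ m.-unity_root q.
Local Notation Q := (q ^+ 2).

Lemma q_subV_neq0 : q - q^-1 != 0.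
Proof.
have := qgen (ltn0Sn 1); apply: contra; rewrite unity_rootE subr_eq0 => /eqP e.
by rewrite expr2 {2}e mulfV.
Qed.

Definition qfall_unit (a : int) : F :=
  \prod_(l < k.-1) (- (q ^ (- (a + l.+1%:Z)) / (q - q^-1))).

Lemma qfall_unit_neq0 a : qfall_unit a != 0.
Proof.
apply/prodf_neq0 => l _; rewrite oppr_eq0 mulf_neq0 ?expfz_neq0 //.
by rewrite invr_eq0 q_subV_neq0.
Qed.

Lemma qfall_unit_balanced a b c d : a + b = c + d ->
  qfall_unit a * qfall_unit b = qfall_unit c * qfall_unit d.
Proof.
move=> e; rewrite -!big_split; apply: eq_bigr => l _ /=.
rewrite !mulrNN !mulf_div -!expfzDr //; congr (_ ^ _ / _); lia.
Qed.

Lemma qfallE a b : b = a + k%:Z - 1 -> qfall q b k.-1 = qfall_unit a * qN Q k a.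
Proof.
move=> ->; rewrite /qfall /qfall_unit /qN -big_split /= (reindex_inj rev_ord_inj) /=.
apply: eq_bigr => l _; rewrite /qint /qb.
have -> : a + k%:Z - 1 - (k.-1 - l.+1)%N%:Z = a + l.+1%:Z by have := ltn_ord l; lia.
set b' := a + _; have -> : Q ^ b' = q ^ b' * q ^ b'.
  by rewrite exprnP exprz_exp mulrC -exprz_exp -exprnP expr2.
rewrite -invr_expz; have q1 := q_subV_neq0; have qb0 : q ^ b' != 0 by apply: expfz_neq0.
by move: (q ^ b') (q - q^-1) qb0 q1 => x y x0 y0; field; rewrite y0 x0.
Qed.
End QFactors.

Section PsiPairs.
Variables (F : fieldType) (Q : F) (k n : nat).

Lemma psi0_pairs (x y : nat -> int) :
  kinterlace k (fun i : 'I_n.+1 => x i) (fun j : 'I_n => y j) ->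
  psi0 Q k (fun i : 'I_n.+1 => x i) (fun j : 'I_n => y j) =
  \prod_(i < n) \prod_(j < n | (i <= j)%N)
    ((qN Q k (x i - y j) * qN Q k (y i - x j.+1 - k%:Z)) /
     (qN Q k (y i - y j) * qN Q k (x i - x j.+1 - k%:Z))).
Proof.
move=> ki; rewrite /psi0 ki.
have -> : psi_num Q k (fun i : 'I_n.+1 => x i) (fun j : 'I_n => y j) =
    (\prod_(i < n) \prod_(j < n | (i <= j)%N) qN Q k (x i - y j)) *
    (\prod_(i < n) \prod_(j < n | (i <= j)%N) qN Q k (y i - x j.+1 - k%:Z)).
  rewrite /psi_num.
  transitivity ((\prod_(i < n.+1) \prod_(j < n | (i <= j)%N) qN Q k (x i - y j)) *
     \prod_(i < n.+1) \prod_(j < n | (j < i)%N) qN Q k (y j - x i - k%:Z)).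
    rewrite -big_split; apply: eq_bigr => i _ /=.
    rewrite [X in _ = X * _]big_mkcond [X in _ = _ * X]big_mkcond -big_split /=.
    by apply: eq_bigr => j _; rewrite ltnNge; case: (i <= j)%N; rewrite ?mulr1 ?mul1r.
  congr (_ * _).
    rewrite big_ord_recr /= [X in _ * X]big1 ?mulr1 // => j.
    by rewrite leqNgt ltn_ord.
  rewrite (exchange_big_dep xpredT) //=; apply: eq_bigr => j _.
  rewrite big_mkcond big_ord_recl /= mul1r [RHS]big_mkcond.
  by apply: eq_bigr => i _; rewrite /bump leq0n add1n ltnS.
rewrite /psi_denX (big_ord_ltS _ _ (fun i j => qN Q k (x i - x j - k%:Z))) /psi_denV.
rewrite -!big_split -prodf_div; apply: eq_bigr => i _ /=.
by rewrite -!big_split -prodf_div.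
Qed.

End PsiPairs.

Lemma psi_pairs (F : fieldType) (V : archiNumDomainType) (q : F) (k n : nat)
    (la : n.+1.-tuple V) (mu : n.-tuple V) (x y : nat -> int) :
  q != 0 -> (0 < k)%N -> (forall m : nat, (0 < m)%N -> ~~ m.-unity_root q) ->
  (forall i j, (i < n.+1)%N -> (j < n)%N ->
     la`_i - mu`_j = (x i + (k * i)%N%:Z - (y j + (k * j)%N%:Z))%:~R) ->
  (forall i j, (i < n.+1)%N -> (j < n.+1)%N ->
     la`_i - la`_j = (x i + (k * i)%N%:Z - (x j + (k * j)%N%:Z))%:~R) ->
  (forall i j, (i < n)%N -> (j < n)%N ->
     mu`_i - mu`_j = (y i + (k * i)%N%:Z - (y j + (k * j)%N%:Z))%:~R) ->
  kinterlace k (fun i : 'I_n.+1 => x i) (fun j : 'I_n => y j) ->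
  psi q k la mu = psi0 (q ^+ 2) k (fun i : 'I_n.+1 => x i) (fun j : 'I_n => y j).
Proof.
move=> q0 k0 qgen elm ell emm ki; rewrite psi0_pairs // /psi.
rewrite (big_ord_ltS _ _ (fun i j => qfall q (Num.floor (mu`_i - la`_j) + k%:Z * (j%:Z - i%:Z) - 1) k.-1)).
rewrite (big_ord_ltS _ _ (fun i j => qfall q (Num.floor (la`_i - la`_j) + k%:Z * (j%:Z - i%:Z) - 1) k.-1)).
rewrite -!big_split -prodf_div; apply: eq_bigr => i _ /=.
rewrite -!big_split -prodf_div; apply: eq_bigr => j ij /=.
have [lti ltj] := (ltn_ord i, ltn_ord j).
have lti' := leqW lti; have ltj' : (j.+1 < n.+1)%N by [].
have eml : mu`_i - la`_j.+1 = (y i + (k * i)%N%:Z - (x j.+1 + (k * j.+1)%N%:Z))%:~R.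
  by rewrite -opprB elm // -rmorphN /=; congr (_%:~R); ring.
rewrite elm // eml ell // emm // !intrKfloor.
rewrite (qfallE q0 k0 qgen (a := x i - y j)); last by rewrite !PoszM; ring.
rewrite (qfallE q0 k0 qgen (a := y i - x j.+1 - k%:Z)); last by rewrite !PoszM; ring.
rewrite (qfallE q0 k0 qgen (a := y i - y j)); last by rewrite !PoszM; ring.
rewrite (qfallE q0 k0 qgen (a := x i - x j.+1 - k%:Z)); last by rewrite !PoszM; ring.
set u1 := qfall_unit _ _ (x i - y j); set u2 := qfall_unit _ _ (y i - _ - _).
set u3 := qfall_unit _ _ (y i - y j); set u4 := qfall_unit _ _ (x i - _ - _).
have u : u1 * u2 = u3 * u4 by apply: qfall_unit_balanced => //; ring.
have u30 : u3 != 0 by apply: qfall_unit_neq0.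
have u40 : u4 != 0 by apply: qfall_unit_neq0.
rewrite [u1 * _ * _]mulrACA u [u3 * _ * (u4 * _)]mulrACA. by rewrite -[LHS]mulf_div divff ?mul1r // mulf_neq0.
Qed.

Section GroupAlgebraMorphism.
Variables (F : fieldType) (A : zmodType).

Lemma gscaleE c (g : group_alg F A) : c *: g = gmonom 0 c * g.
Proof.
change (monalg.fgscale c g = gmul (gmonom 0 c) g).
rewrite [in RHS](gmonomE g) gmul_sumr; apply: eq_bigr => a _.
by rewrite gmulMM add0r.
Qed.

Lemma gscaleAr c (g h : group_alg F A) : g * (c *: h) = c *: (g * h).
Proof. by rewrite !gscaleE mulrCA. Qed.

Fact gmonom0_zmod_morphism : zmod_morphism (gmonom (0 : A) : F -> group_alg F A).
Proof. by move=> c d; rewrite gmonomD; congr (_ + _); apply: monalg.monalgUN. Qed.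

HB.instance Definition _ := GRing.isZmodMorphism.Build F (group_alg F A)
  (gmonom (0 : A)) gmonom0_zmod_morphism.

Fact gmonom0_monoid_morphism : monoid_morphism (gmonom (0 : A) : F -> group_alg F A).
Proof. by split=> // c d; rewrite [RHS](gmulMM 0 0 c d) addr0. Qed.

HB.instance Definition _ := GRing.isMonoidMorphism.Build F (group_alg F A)
  (gmonom (0 : A)) gmonom0_monoid_morphism.
End GroupAlgebraMorphism.

Lemma branching_poly_shift (F : fieldType) (Q : F) k n (la : 'X_{1..n}) d :
  [pchar F] =i pred0 -> good Q -> (0 < k)%N -> partition_mnm la ->
  branching_poly Q k (la + [multinom d | _ < n])%MM = (\prod_i 'X_i) ^+ d * branching_poly Q k la.
Proof.
move=> ch [Q0 Qg] k0 pla; elim: d => [|d IH].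
  by rewrite mul1r; congr (branching_poly _ _ _); apply/mnmP => i; rewrite !mnmE addn0.
set la' := (la + [multinom d.+1 | _ < n])%MM.
have pla' : partition_mnm (la + [multinom d | _ < n])%MM.
  by move=> i j ij; rewrite !mnmE leq_add2r pla.
have -> : la' = ((la + [multinom d | _ < n]) + mesym1 setT)%MM.
  by apply/mnmP => i; rewrite !mnmE inE addn1 addnS.
rewrite exprS -mulrA -IH; apply/eqP; rewrite eq_sym -subr_eq0; apply/eqP.
have X0 : \prod_(i < n) 'X_i != 0 :> {mpoly F[n]}.
  apply/prodf_neq0 => i _; apply/eqP => /(congr1 (fun p : {mpoly F[n]} => p@_U_(i))) /eqP.
  by rewrite mcoeffX eqxx mcoeff0 oner_eq0.
apply: (mpoly_dense ch X0) => v; rewrite rmorph_prod /= => v0.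
have vi i : v i != 0 by move/prodf_neq0/(_ i isT): v0; rewrite mevalXU.
rewrite mevalB mevalM rmorph_prod /=; under eq_bigr => i _ do rewrite mevalXU.
have := branching_poly_pieri ch Q0 Qg k0 0 (iffRL (kdominant_partition k _) pla') vi.
rewrite (eq_bigr v) => [->|i _]; last by rewrite add0r.
rewrite (bigD1 setT) //= setCT cards0 expr0 mul1r [pieri _ _ _ _]big1 ?mul1r.
  rewrite big1 ?addr0 ?subrr // => I IT; rewrite expr0n cards_eq0 -(inj_eq (@setC_inj _)).
  by rewrite setCK setC0 (negPf IT) !mul0r.
by move=> i _; apply: big1 => j _; rewrite inE.
Qed.

Section Laurent.
Variables (F : fieldType) (V : archiNumDomainType).

Lemma xpowD N (i : 'I_N) (c d : V) : xpow F i (c + d) = xpow F i c * xpow F i d.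
Proof. by rewrite /xpow [RHS]gmulMM -scalerDl mulr1. Qed.

Lemma xpow0 N (i : 'I_N) : xpow F i (0 : V) = 1.
Proof. by rewrite /xpow scale0r. Qed.

Lemma xpow_nat N (i : 'I_N) d : xpow F i (1 : V) ^+ d = xpow F i d%:R.
Proof.
elim: d => [|d IH]; first by rewrite expr0 mulr0n xpow0.
rewrite exprS IH -xpowD -mulrS; reflexivity.
Qed.

Definition gev n N (w : 'I_n -> 'I_N) : {mpoly F[n]} -> gpoly F V N :=
  mmap (gmonom 0) (fun i => xpow F (w i) (1 : V)).

Lemma gevM n N (w : 'I_n -> 'I_N) p p' : gev w (p * p') = gev w p * gev w p'.
Proof. exact: rmorphM. Qed.

Lemma gev_sum n N (w : 'I_n -> 'I_N) (I : Type) (r : seq I) (G : I -> {mpoly F[n]}) :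
  gev w (\sum_(i <- r) G i) = \sum_(i <- r) gev w (G i).
Proof. exact: raddf_sum. Qed.

Lemma gevZ n N (w : 'I_n -> 'I_N) c p : gev w (c *: p) = c *: gev w p.
Proof. by rewrite gscaleE; apply: mmapZ. Qed.

Lemma gevXm n N (w : 'I_n -> 'I_N) m : gev w 'X_[m] = \prod_i xpow F (w i) (m i)%:R.
Proof.
by rewrite [LHS]mmapX; apply: eq_bigr => i _; rewrite xpow_nat.
Qed.

Lemma gevX n N (w : 'I_n -> 'I_N) i d : gev w ('X_i ^+ d) = xpow F (w i) d%:R.
Proof. rewrite /gev rmorphXn /= mmapX mmap1U xpow_nat; reflexivity. Qed.

Lemma gev_mwiden n N (w : 'I_n.+1 -> 'I_N) p :
  gev w (mwiden p) = gev (fun i => w (widen_ord (leqnSn n) i)) p.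
Proof.
have mE m : gev w 'X_[mnmwiden m] = gev (fun i => w (widen_ord (leqnSn n) i)) 'X_[m].
  rewrite !gevXm big_ord_recr /= mnmwiden_ordmax mulr0n xpow0 mulr1.
  apply: eq_bigr => i _; rewrite mnmwiden_widen; reflexivity.
rewrite (mpolyE p) [mwiden _]raddf_sum !gev_sum; apply: eq_bigr => m _ /=.
rewrite mwidenZ mwidenX !gevZ mE; reflexivity.
Qed.

Variables (k : nat) (q : F).
Hypotheses (ch : [pchar F] =i pred0) (k0 : (0 < k)%N) (q0 : q != 0).
Hypothesis qgen : forall m : nat, (0 < m)%N -> ~~ m.-unity_root q.
Local Notation R := (branching_poly (q ^+ 2) k).

Lemma macdonald_branching n N (w : 'I_n -> 'I_N) (mu : n.-tuple V) (nu : 'X_{1..n}) c :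
  partition_mnm nu -> (forall i : 'I_n, mu`_i = c + (nu i)%:R) ->
  macdonald q (q ^+ k) w mu = (\prod_i xpow F (w i) c) * gev w (R nu).
Proof.
case: n => [|n] in w mu nu *; move=> pnu munu.
  rewrite /macdonald; set nu0 := [multinom _ | _ < _]; have p0 : partition_mnm nu0 by case.
  rewrite (macdonald_poly_branching ch k0 q0 qgen p0).
  have e0 (G : 'I_0 -> gpoly F V N) : \prod_(i < 0) G i = 1 by exact: big_ord0.
  have e : nu0 = nu by apply/mnmP; case.
  rewrite e; exact: (congr1 (fun z => z * gev w (R nu)) (etrans (e0 _) (esym (e0 _)))).
pose d := nu ord_max; pose nu0 := [multinom (nu i - d)%N | i < n.+1].
have ce : last 0 mu = c + d%:R.
  by rewrite (last_nth 0) size_tuple -(munu ord_max).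
have nuE : nu = (nu0 + [multinom d | _ < n.+1])%MM.
  by apply/mnmP => i; rewrite !mnmE subnK //; apply/pnu/leq_ord.
have nu0E : [multinom Num.truncn (mu`_i - last 0 mu)%R | i < n.+1] = nu0.
  apply/mnmP => i; rewrite !mnmE munu ce opprD addrACA subrr add0r.
  by rewrite -natrB ?natrK //; apply/pnu/leq_ord.
have pnu0 : partition_mnm nu0.
  by move=> i j /pnu; rewrite nuE !mnmE leq_add2r.
have XE : (\prod_i 'X_i) ^+ d = 'X_[[multinom d | _ < n.+1]] :> {mpoly F[n.+1]}.
  by rewrite mpolyXE_id -prodrXl; apply: eq_bigr => i _; rewrite mnmE.
have E : R nu = 'X_[[multinom d | _ < n.+1]] * R nu0.
  by rewrite nuE branching_poly_shift // ?XE //; exact: good_sqr.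
rewrite E gevM mulrA gevXm -big_split -(macdonald_poly_branching ch k0 q0 qgen pnu0).
rewrite /macdonald nu0E ce.
rewrite (eq_bigr (fun i => xpow F (w i) c * xpow F (w i) ([multinom d | _ < n.+1] i)%:R)).
  reflexivity.
move=> i _; rewrite mnmE xpowD; reflexivity.
Qed.
End Laurent.

Section Reindexing.
Variables (V : archiNumDomainType) (n : nat) (la : n.+1.-tuple V).
Hypothesis sla : is_signature la.
Local Notation c := (la`_n).

Definition signature_mnm : 'X_{1..n.+1} := [multinom Num.truncn (la`_i - c)%R | i < n.+1].
Local Notation la0 := signature_mnm.

Lemma signature_mnmE (i : 'I_n.+1) : la`_i = c + (la0 i)%:R.
Proof.
have [le int] := sla (leq_ord i : (i <= @ord_max n)%N).
rewrite mnmE truncnK; first by rewrite addrC subrK.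
by rewrite natrEint int subr_ge0.
Qed.

Lemma signature_mnm_partition : partition_mnm la0.
Proof.
move=> i j ij; have [le _] := sla ij.
by move: le; rewrite !signature_mnmE lerD2l ler_nat.
Qed.

Definition mu_mnm (mu : n.-tuple V) : 'X_{1..n} := [multinom Num.truncn (mu`_i - c)%R | i < n].

Definition mnm_mu (nu : 'X_{1..n}) : n.-tuple V := [tuple c + (nu i)%:R | i < n].

Lemma mnm_muK : cancel mnm_mu mu_mnm.
Proof.
move=> nu; apply/mnmP => i; rewrite mnmE -tnth_nth tnth_mktuple addrC addKr.
by rewrite natrK.
Qed.

Lemma nth_mnm_mu nu (i : 'I_n) : (mnm_mu nu)`_i = c + (nu i)%:R.
Proof. by rewrite -tnth_nth tnth_mktuple. Qed.

Lemma mu_mnmK mu : interlace mu la -> mnm_mu (mu_mnm mu) = mu.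
Proof.
case/andP=> /forallP le /forallP int; apply: eq_from_tnth => i.
rewrite tnth_mktuple mnmE truncnK; first by rewrite addrC subrK (tnth_nth 0).
rewrite natrEint; apply/andP; split.
  by rewrite -opprB rpredN; move/forallP/(_ i): (int ord_max).
have /andP[le1 _] := le i; rewrite subr_ge0 (le_trans _ le1) //.
by have [] := sla (leq_ord (lift ord0 i) : (lift ord0 i <= @ord_max n)%N).
Qed.

Lemma interlace_mnm_mu k nu : (0 < k)%N ->
  interlace (mnm_mu nu) la = kinterlace k (mcoord k la0) (mcoord k nu).
Proof.
move=> k0; apply/andP/(kinterlace_mcoordP k la0 nu) => [[/forallP le _] j|le].
  have := le j; rewrite nth_mnm_mu.
  have -> : la`_j.+1 = la`_(lift ord0 j) by [].
  have -> : la`_j = la`_(widen_ord (leqnSn n) j) by [].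
  by rewrite !signature_mnmE !lerD2l !ler_nat.
split; apply/forallP => i.
  rewrite nth_mnm_mu.
  have -> : la`_i.+1 = la`_(lift ord0 i) by [].
  have -> : la`_i = la`_(widen_ord (leqnSn n) i) by [].
  by rewrite !signature_mnmE !lerD2l !ler_nat.
apply/forallP => j; rewrite nth_mnm_mu signature_mnmE opprD addrACA subrr add0r.
by rewrite rpredB // natr_int.
Qed.

Lemma sum_interlacing k (U : zmodType) (G : 'X_{1..n} -> U) b : (0 < k)%N -> (mdeg la0 < b)%N ->
  \sum_(mu <- interlacing la) G (mu_mnm mu) =
  \sum_(nu : 'X_{1..n < b} | kinterlace k (mcoord k la0) (mcoord k nu)) G nu.
Proof.
move=> k0 lb; rewrite -[LHS](big_map mu_mnm xpredT) -[RHS]big_filter.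
rewrite -[RHS](big_map val xpredT); apply: perm_big; apply: uniq_perm.
- rewrite map_inj_in_uniq ?interlacing_uniq // => mu mu'.
  rewrite !mem_interlacing // => /mu_mnmK {2}<- /mu_mnmK {2}<- -> //.
- by rewrite map_inj_uniq ?filter_uniq ?index_enum_uniq //; apply: val_inj.
move=> nu; apply/mapP/mapP => [[mu]|[m]].
  rewrite mem_interlacing // => im ->.
  have ki : kinterlace k (mcoord k la0) (mcoord k (mu_mnm mu)).
    by rewrite -interlace_mnm_mu // mu_mnmK.
  have lt := leq_ltn_trans (interlace_mdeg ki) lb.
  by exists (BMultinom lt); rewrite // mem_filter mem_index_enum andbT.
rewrite mem_filter => /andP[ki _] ->; exists (mnm_mu m); last by rewrite mnm_muK.
by rewrite mem_interlacing // (interlace_mnm_mu m k0).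
Qed.

Lemma weight_signature : weight la = c *+ n.+1 + (mdeg la0)%:R.
Proof.
rewrite /weight (eq_bigr _ (fun i _ => signature_mnmE i)) big_split /= sumr_const card_ord.
by rewrite mdegE natr_sum.
Qed.

Lemma weight_mnm_mu nu : weight (mnm_mu nu) = c *+ n + (mdeg nu)%:R.
Proof.
rewrite /weight (eq_bigr _ (fun i _ => nth_mnm_mu nu i)) big_split /= sumr_const card_ord.
by rewrite mdegE natr_sum.
Qed.

Lemma psi_psi0 (F : fieldType) (q : F) k nu : q != 0 -> (0 < k)%N ->
  (forall m : nat, (0 < m)%N -> ~~ m.-unity_root q) ->
  kinterlace k (mcoord k la0) (mcoord k nu) ->
  psi q k la (mnm_mu nu) = psi0 (q ^+ 2) k (mcoord k la0) (mcoord k nu).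
Proof.
move=> q0 k0 qgen ki.
pose x i : int := (Num.truncn (la`_i - c))%:Z - (k * i)%N%:Z.
pose y j : int := (Num.truncn ((mnm_mu nu)`_j - c))%:Z - (k * j)%N%:Z.
have ex i : (i < n.+1)%N -> la`_i = c + (x i + (k * i)%N%:Z)%:~R.
  by move=> lt; rewrite (signature_mnmE (Ordinal lt)) /= mnmE subrK.
have ey j : (j < n)%N -> (mnm_mu nu)`_j = c + (y j + (k * j)%N%:Z)%:~R.
  move=> lt; rewrite (nth_mnm_mu nu (Ordinal lt)) /y subrK.
  by rewrite -{2}[j]/(val (Ordinal lt)) nth_mnm_mu [c + _ - c]addrC addKr natrK.
have ex' : mcoord k la0 =1 (fun i : 'I_n.+1 => x i) by move=> i; rewrite /mcoord mnmE.
have ey' : mcoord k nu =1 (fun j : 'I_n => y j).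
  by move=> j; rewrite /mcoord /y nth_mnm_mu [c + _ - c]addrC addKr natrK.
have dif (a b : int) : c + a%:~R - (c + b%:~R) = (a - b)%:~R :> V.
  by rewrite rmorphB /= opprD addrACA subrr add0r.
rewrite (eq_psi0 _ _ ex' ey'); apply: psi_pairs => //.
- by move=> i j li lj; rewrite (ex _ li) (ey _ lj) dif.
- by move=> i j li lj; rewrite (ex _ li) (ex _ lj) dif.
- by move=> i j li lj; rewrite (ey _ li) (ey _ lj) dif.
- move: ki => /kinterlaceP ki; apply/kinterlaceP => j; by rewrite -!ex' -ey'.
Qed.
End Reindexing.

Theorem theorem5p1 (F : fieldType) (V : archiNumDomainType) (n k : nat) (q : F)
    (la : n.+1.-tuple V) :
  [pchar F] =i pred0 ->
  q != 0 ->
  (forall m : nat, (0 < m)%N -> ~~ m.-unity_root q) ->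
  (2 <= n.+1)%N ->
  (0 < k)%N ->
  is_signature la ->
  macdonald q (q ^+ k) (fun i : 'I_n.+1 => i) la =
  \sum_(mu <- interlacing la)
    psi q k la mu *:
      (xpow F ord_max (weight la - weight mu) *
       macdonald q (q ^+ k) (widen_ord (leqnSn n)) mu).
Proof.
move=> ch q0 qgen _ k0 sla; set c := la`_n; set la0 := signature_mnm la.
pose R := branching_poly (q ^+ 2) k; pose w := widen_ord (leqnSn n).
pose W : gpoly F V n.+1 := \prod_(i < n) xpow F (w i) c.
pose G nu : gpoly F V n.+1 := psi0 (q ^+ 2) k (mcoord k la0) (mcoord k nu) *:
  (xpow F ord_max (c + (mdeg la0 - mdeg nu)%:R) * (W * gev V w (R n nu))).
pose H mu : gpoly F V n.+1 := psi q k la mu *: (xpow F ord_max (weight la - weight mu) *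
  macdonald q (q ^+ k) w mu).
have GH : {in interlacing la, (fun mu => G (mu_mnm la mu)) =1 H}.
  move=> mu muin; have im : interlace mu la by rewrite -mem_interlacing.
  rewrite /H /G.
  set nu := mu_mnm la mu; have muE : mu = mnm_mu la nu by rewrite mu_mnmK.
  have ki : kinterlace k (mcoord k la0) (mcoord k nu) by rewrite -interlace_mnm_mu // -muE.
  have pnu : partition_mnm nu by apply/(kdominant_partition k)/(kinterlace_dominantV ki).
  have -> : psi q k la mu = psi0 (q ^+ 2) k (mcoord k la0) (mcoord k nu).
    by rewrite [in LHS]muE psi_psi0.
  have -> : weight la - weight mu = c + (mdeg la0 - mdeg nu)%:R.
    rewrite muE weight_signature // weight_mnm_mu mulrS natrB ?(interlace_mdeg ki) //.
    by rewrite -/c -/la0; ring.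
  rewrite (macdonald_branching ch k0 q0 qgen w pnu (c := c)); last first.
    by move=> i; rewrite muE nth_mnm_mu.
  reflexivity.
refine (etrans _ (eq_big_seq _ GH)).
refine (etrans _ (esym (sum_interlacing sla G k0 (ltnSn _)))).
transitivity (\sum_(nu : 'X_{1..n < (mdeg la0).+1}) G nu); last first.
  rewrite [RHS]big_mkcond; apply: eq_bigr => nu _; case: ifPn => // nki.
  by rewrite /G /psi0 (negPf nki) scale0r.
rewrite (macdonald_branching ch k0 q0 qgen _ (signature_mnm_partition sla) (signature_mnmE sla)).
have -> : branching_poly (q ^+ 2) k la0 = \sum_(nu : 'X_{1..n < (mdeg la0).+1})
    psi0 (q ^+ 2) k (mcoord k la0) (mcoord k nu) *:
      (mwiden (R n nu) * 'X_ord_max ^+ (mdeg la0 - mdeg nu)) by [].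
rewrite gev_sum mulr_sumr; apply: eq_bigr => nu _.
have mulACA (S : comNzRingType) (x y z t : S) : x * y * (z * t) = y * t * (x * z) by ring.
rewrite gevZ gevM gev_mwiden gevX big_ord_recr gscaleAr mulACA -xpowD; reflexivity.
Qed.
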